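(* Let $0<a<b<\infty$ and $\Omega_{a,b}=\{x\in\mathbb{R}^2: a<|x|<b\}$. Let $v=(v_1,v_2)\in C^2(\overline{\Omega_{a,b}})$ be a flow solving the steady Euler equations $$v\cdot\nabla v+\nabla p=0\ \text{ and }\ \mathrm{div}\,v=0\ \text{ in }\Omega_{a,b}$$ (for some pressure $p$), with the boundary conditions $v\cdot e_r=0$ on $C_a$ and on $C_b$, and such that $$\{x\in\overline{\Omega_{a,b}}:|v(x)|=0\}\subsetneq C_a\ \text{ or }\ \{x\in\overline{\Omega_{a,b}}:|v(x)|=0\}\subsetneq C_b.$$ Then $|v|>0$ in $\overline{\Omega_{a,b}}$, $v$ is a circular flow, and there is a $C^2([a,b])$ function $V$ with constant strict sign (that is, $V>0$ on all of $[a,b]$ or $V<0$ on all of $[a,b]$) such that $v(x)=V(|x|)\,e_\theta(x)$ for all $x\in\overline{\Omega_{a,b}}$.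
   Context: $|\cdot|$ is the Euclidean norm in $\mathbb{R}^2$; $C_r=\{x\in\mathbb{R}^2:|x|=r\}$. For $x=(x_1,x_2)\neq0$, $e_r(x)=x/|x|$ and $e_\theta(x)=(-x_2/|x|,x_1/|x|)$. $E\subsetneq F$ means $E\subset F$ and $E\neq F$ (in particular $E=\emptyset$ is allowed). Solutions $(v,p)$ of the Euler equations are understood in the classical sense: $v$ and $p$ are (at least) of class $C^1$ in the open domain and the equations hold at every point. A flow $v$ in $\Omega_{a,b}$ is called circular if $v(x)$ is parallel to $e_\theta(x)$ at every $x\in\Omega_{a,b}$, i.e. $v\cdot e_r=0$ in $\Omega_{a,b}$. *)

(* Defs.v *)
(* Stdlib reals and Coquelicot; the plane is [R * R]. *)
From Stdlib Require Export Reals Ensembles.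
From Coquelicot Require Export Coquelicot.
Open Scope R_scope.

Definition enorm (x : R * R) : R := sqrt (fst x ^ 2 + snd x ^ 2).

Definition dot (x y : R * R) : R := fst x * fst y + snd x * snd y.

Definition e_r (x : R * R) : R * R := (fst x / enorm x, snd x / enorm x).

Definition e_theta (x : R * R) : R * R := (- snd x / enorm x, fst x / enorm x).

Definition circle (r : R) : Ensemble (R * R) := fun x => enorm x = r.

Definition annulus (a b : R) : Ensemble (R * R) := fun x => a < enorm x < b.

Definition closed_annulus (a b : R) : Ensemble (R * R) :=
  fun x => a <= enorm x <= b.

(* For [U] open and [U ⊆ K ⊆ closure of U]: [f] is of class C^n in [U], and
   its partial derivatives of order at most [n] extend continuously to [K].
   The functions [g1], [g2] are the extended partial derivatives of [f].
   [Cn_on n U (closure of U)] is thus C^n up to the boundary, and [Cn_on n U U]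
   is plain C^n in the open set [U]. *)
Fixpoint Cn_on (n : nat) (U K : R * R -> Prop) (f : R * R -> R) : Prop :=
  match n with
  | O => continuous_on K f
  | S m =>
      continuous_on K f /\
      exists g1 g2 : R * R -> R,
        (forall x, U x ->
           is_derive (fun t => f (t, snd x)) (fst x) (g1 x) /\
           is_derive (fun t => f (fst x, t)) (snd x) (g2 x)) /\
        Cn_on m U K g1 /\ Cn_on m U K g2
  end.

(* One-variable version, C^n([a,b]): the derivatives of order at most [n] in
   (a,b) extend continuously to [a,b]. *)
Fixpoint Cn_segment (n : nat) (a b : R) (f : R -> R) : Prop :=
  match n with
  | O => continuous_on (fun r => a <= r <= b) f
  | S m =>
      continuous_on (fun r => a <= r <= b) f /\
      exists g : R -> R,
        (forall r, a < r < b -> is_derive f r (g r)) /\ Cn_segment m a b g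
  end.

Definition d1 (f : R * R -> R) (x : R * R) : R :=
  Derive (fun t => f (t, snd x)) (fst x).

Definition d2 (f : R * R -> R) (x : R * R) : R :=
  Derive (fun t => f (fst x, t)) (snd x).

Definition grad (f : R * R -> R) (x : R * R) : R * R := (d1 f x, d2 f x).

Definition v1 (v : R * R -> R * R) (x : R * R) : R := fst (v x).

Definition v2 (v : R * R -> R * R) (x : R * R) : R := snd (v x).

(* [d1] and [d2] are junk values where a partial derivative does not exist, so
   the regularity of a classical solution is part of the definition. *)
Definition steady_Euler (U : R * R -> Prop) (v : R * R -> R * R)
    (p : R * R -> R) : Prop :=
  Cn_on 1 U U (v1 v) /\ Cn_on 1 U U (v2 v) /\ Cn_on 1 U U p /\
  forall x, U x ->
    dot (v x) (grad (v1 v) x) + d1 p x = 0 /\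
    dot (v x) (grad (v2 v) x) + d2 p x = 0 /\
    d1 (v1 v) x + d2 (v2 v) x = 0.

Definition circular (U : R * R -> Prop) (v : R * R -> R * R) : Prop :=
  forall x, U x -> exists c : R, v x = scal c (e_theta x).

Definition stagnation_set (K : R * R -> Prop) (v : R * R -> R * R) :
    Ensemble (R * R) :=
  fun x => K x /\ enorm (v x) = 0.

(* Main.v *)
Require Import Defs.
From Stdlib Require Import Reals Ensembles.
From Coquelicot Require Import Coquelicot.
From Stdlib Require Import Lra Classical ClassicalEpsilon.
Open Scope R_scope.

(** Write [v = (- d_2 u, d_1 u)]. Taking the curl of the equation, [v . grad (Lap u) = 0],
    so the vorticity [Lap u] is constant along level curves of [u]. As [u] is constant on
    both circles and has no critical point inside, its level sets are connected: this is
    clear near the circle without stagnation points, and it propagates from level to level.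
    Hence [|Lap u (x) - Lap u (y)| <= M |u x - u y|] on the whole annulus; a non-stagnation
    point of the other circle gives a uniform [M] up to the extreme value of [u] there.
    This Lipschitz bound is all that the method of moving planes needs. Say [u] is larger on
    the inner circle. For every half-plane that does not contain the origin, the
    difference between the reflected [u] and [u] is nonnegative in the cap: it is positive on
    the curved part of the boundary of the cap, so only points of the moving line itself
    can obstruct the motion, and there the Hopf lemma gives the sign of the normal derivative.
    Where the line meets a circle at a stagnation point, the Hessian of [u] is the vorticity
    times [e_r (x) e_r], and the Hopf lemma for [u] on that circle gives the sign of the
    vorticity. Thus [u] is radial. *)

(** * Compactness and a comparison principle *)

(** The difficulty lies in the relation between [Lap u] and [u]: the vorticity is a function of the
    value of [u] only if each level is connected, and this function may lose regularity at a value
    taken on a wall with stagnation points, where the gradient degenerates. On a compact range of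
    interior values all levels are graphs at one common scale. A chain of small steps on one level
    can then be pushed to every sufficiently close level, with a threshold that is the same for all
    of them. Near an end value a single ray is enough: it leaves the wall at a point where the
    normal derivative is not zero, crosses all nearby levels with a definite slope, and each level
    carries one vorticity, so a bound along the ray is a bound on the annulus. For the moving
    planes, let w be the difference of the reflected [u] and [u]. It is nonnegative for an
    admissible plane, so the Lipschitz bound becomes the one-sided inequality [Lap w <= M w]; a
    steep exponential barrier h with [Lap h > M h] is compared with it, whatever the size of [M]. *)

Definition cont_in (K : R -> R -> Prop) (f : R -> R -> R) (x y : R) : Prop :=
  forall eps, 0 < eps -> exists d, 0 < d /\ forall x' y', K x' y' ->
    Rabs (x' - x) < d -> Rabs (y' - y) < d -> Rabs (f x' y' - f x y) < eps.

(** Finitely many neighbourhoods cover the rectangle, so their radii have a positive lower bound. In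
    [P x y e] the number [e] is at once the radius of the neighbourhood and the constant of the
    estimate; monotonicity in [e] makes both uniform. *)
Lemma local_to_uniform (P : R -> R -> R -> Prop) (a b c d : R) :
  (forall x y e e', 0 < e' <= e -> P x y e -> P x y e') ->
  (forall x y, a <= x <= b -> c <= y <= d -> exists e, 0 < e /\
     forall x' y', a <= x' <= b -> c <= y' <= d ->
       Rabs (x' - x) < e -> Rabs (y' - y) < e -> P x' y' e) ->
  exists e, 0 < e /\ forall x y, a <= x <= b -> c <= y <= d -> P x y e.
Proof.
  intros mono loc.
  assert (H : forall x y, exists e : posreal,
    a <= x <= b -> c <= y <= d ->
    forall x' y', a <= x' <= b -> c <= y' <= d ->
       Rabs (x' - x) < e -> Rabs (y' - y) < e -> P x' y' e).
  { intros x y.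
    destruct (classic (a <= x <= b /\ c <= y <= d)) as [[Hx Hy]|Hn].
    - destruct (loc x y Hx Hy) as [e [He H]].
      exists (mkposreal e He); auto.
    - exists (mkposreal 1 Rlt_0_1). intros Hx Hy; tauto. }
  destruct (compactness_value_2d a b c d
    (fun x y => proj1_sig (constructive_indefinite_description _ (H x y))))
    as [e He].
  exists e; split; [apply cond_pos|].
  intros x y Hx Hy.
  specialize (He x y Hx Hy). apply NNPP in He.
  destruct He as [u [v [Hu [Hv [H1 [H2 H3]]]]]].
  destruct (constructive_indefinite_description _ (H u v)) as [e' He']; simpl in *.
  apply mono with e'; [split; [apply cond_pos|exact H3]|].
  apply He'; assumption.
Qed.

(** The passage from local to uniform is used twice: local bounds [- / e < f] make the infimum [- m]
    finite, and if it were not attained, [f + m] would be locally, hence uniformly, above a positive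
    constant. *)
Lemma compact_min (K : R -> R -> Prop) (f : R -> R -> R) (a b c d : R) :
  (forall x y, K x y -> a <= x <= b /\ c <= y <= d) ->
  (forall x y, ~ K x y -> exists e, 0 < e /\ forall x' y',
     Rabs (x' - x) < e -> Rabs (y' - y) < e -> ~ K x' y') ->
  (exists x y, K x y) ->
  (forall x y, K x y -> cont_in K f x y) ->
  exists x y, K x y /\ forall x' y', K x' y' -> f x y <= f x' y'.
Proof.
  intros bdK clK [x0 [y0 K0]] cf.
  destruct (local_to_uniform (fun x y e => K x y -> - / e < f x y) a b c d)
    as [e [He Hb]].
  { intros x y e e' [He' Hee] H HK. specialize (H HK).
    assert (/ e <= / e') by (apply Rinv_le_contravar; lra). lra. }
  { intros x y _ _. destruct (classic (K x y)) as [HK|HK].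
    - destruct (cf x y HK 1 Rlt_0_1) as [d' [Hd' H]].
      set (A := Rabs (f x y) + 1).
      assert (HA : 0 < A) by (unfold A; pose proof (Rabs_pos (f x y)); lra).
      exists (Rmin d' (/ A)).
      assert (HiA := Rinv_0_lt_compat _ HA).
      assert (Hm : 0 < Rmin d' (/ A)) by (apply Rmin_glb_lt; lra).
      split; [exact Hm|].
      intros x' y' _ _ H1 H2 HK'.
      assert (Rabs (f x' y' - f x y) < 1)
        by (apply H; auto; eapply Rlt_le_trans; eauto; apply Rmin_l).
      assert (A <= / Rmin d' (/ A)).
      { rewrite <- (Rinv_inv A) at 1. apply Rinv_le_contravar; [lra|apply Rmin_r]. }
      unfold A in *. revert H0 H3. unfold Rabs; repeat destruct Rcase_abs; lra.
    - destruct (clK x y HK) as [e [He H]]. exists e; split; auto.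
      intros x' y' _ _ H1 H2 HK'. exfalso; apply (H x' y'); auto. }
  set (E := fun m => exists x y, K x y /\ m = - f x y).
  assert (bE : bound E).
  { exists (/ e). intros m [x [y [HK ->]]].
    destruct (bdK x y HK) as [Hx Hy]. specialize (Hb x y Hx Hy HK). lra. }
  destruct (completeness E bE) as [m [Hm1 Hm2]].
  { exists (- f x0 y0), x0, y0; auto. }
  apply NNPP; intros Hno.
  destruct (local_to_uniform (fun x y e => K x y -> f x y + m > e) a b c d)
    as [e2 [He2 Hb2]].
  { intros; specialize (H0 H1); lra. }
  { intros x y _ _. destruct (classic (K x y)) as [HK|HK].
    - assert (Hlt : 0 < f x y + m).
      { destruct (Rle_lt_dec (f x y + m) 0) as [Hle|]; [|lra].
        exfalso; apply Hno. exists x, y; split; auto.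
        intros x' y' HK'. assert (- f x' y' <= m) by (apply Hm1; exists x', y'; auto). lra. }
      destruct (cf x y HK ((f x y + m) / 2)) as [d' [Hd' H]]; [lra|].
      exists (Rmin d' ((f x y + m) / 2)). split; [apply Rmin_glb_lt; lra|].
      intros x' y' _ _ H1 H2 HK'.
      assert (Rabs (f x' y' - f x y) < (f x y + m) / 2)
        by (apply H; auto; eapply Rlt_le_trans; eauto; apply Rmin_l).
      pose proof (Rmin_r d' ((f x y + m) / 2)).
      apply Rabs_lt_between in H0. lra.
    - destruct (clK x y HK) as [e' [He' H]]. exists e'; split; auto.
      intros x' y' _ _ H1 H2 HK'. exfalso; apply (H x' y'); auto. }
  assert (m <= m - e2); [|lra].
  apply Hm2. intros z [x [y [HK ->]]].
  destruct (bdK x y HK) as [Hx Hy]. specialize (Hb2 x y Hx Hy HK). lra.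
Qed.

Lemma second_derivative_test (f f1 : R -> R) (x f2 e : R) :
  0 < e ->
  (forall t, Rabs (t - x) < e -> is_derive f t (f1 t)) ->
  is_derive f1 x f2 ->
  (forall t, Rabs (t - x) < e -> f x <= f t) ->
  0 <= f2.
Proof.
  intros He Hf Hf1 Hmin.
  assert (Hex : Rabs (x - x) < e) by (rewrite Rminus_diag, Rabs_R0; lra).
  assert (H0 : f1 x = 0).
  { assert (Hd : derivable_pt_lim f x (f1 x)) by (apply is_derive_Reals; auto).
    assert (pr : derivable_pt f x) by (exists (f1 x); exact Hd).
    rewrite <- (derive_pt_eq_0 f x (f1 x) pr Hd).
    apply (deriv_minimum f (x - e) (x + e)); try lra.
    intros t H1 H2. apply Hmin. apply Rabs_lt_between; lra. }
  destruct (Rle_lt_dec 0 f2) as [|Hneg]; [assumption|exfalso].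
  apply is_derive_Reals in Hf1.
  destruct (Hf1 (- f2 / 2)) as [d Hd]; [lra|].
  set (h := Rmin (d / 2) (e / 2)).
  pose proof (cond_pos d).
  assert (Hh : 0 < h) by (apply Rmin_glb_lt; lra).
  assert (h <= d / 2) by apply Rmin_l.
  assert (h <= e / 2) by apply Rmin_r.
  assert (Hneg1 : forall t, x < t <= x + h -> f1 t < 0).
  { intros t Ht. specialize (Hd (t - x)).
    replace (x + (t - x)) with t in Hd by ring.
    assert (Hq : Rabs ((f1 t - f1 x) / (t - x) - f2) < - f2 / 2)
      by (apply Hd; [lra | apply Rabs_lt_between; lra]).
    apply Rabs_lt_between in Hq. rewrite H0 in Hq.
    assert ((f1 t - 0) / (t - x) < 0) by lra.
    replace (f1 t) with ((f1 t - 0) / (t - x) * (t - x)) by (field; lra).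
    apply Rmult_neg_pos; lra. }
  destruct (MVT_cor2 f f1 x (x + h)) as [c [Heq Hc]].
  { lra. }
  { intros t Ht. apply is_derive_Reals, Hf. apply Rabs_lt_between; lra. }
  assert (Hle : f x <= f (x + h)) by (apply Hmin; apply Rabs_lt_between; lra).
  specialize (Hneg1 c). nra.
Qed.

(** * The barrier estimate on a ball *)

Definition dist2 (y1 y2 x1 x2 : R) : R := (x1 - y1) ^ 2 + (x2 - y2) ^ 2.

Lemma dist2_ge0 (y1 y2 x1 x2 : R) : 0 <= dist2 y1 y2 x1 x2.
Proof. unfold dist2. apply Rplus_le_le_0_compat; apply pow2_ge_0. Qed.

Lemma dist2_cont (y1 y2 x1 x2 : R) : continuity_2d_pt (dist2 y1 y2) x1 x2.
Proof.
  unfold dist2; simpl.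
  apply continuity_2d_pt_plus; apply continuity_2d_pt_mult;
    try apply continuity_2d_pt_mult; try apply continuity_2d_pt_const;
    apply continuity_2d_pt_minus; try apply continuity_2d_pt_const;
    (apply continuity_2d_pt_id1 || apply continuity_2d_pt_id2).
Qed.

Lemma continuity_2d_cont_in K f x y : continuity_2d_pt f x y -> cont_in K f x y.
Proof.
  intros H eps He. destruct (H (mkposreal eps He)) as [d Hd].
  exists d; split; [apply cond_pos|]. intros; apply Hd; auto.
Qed.

Lemma continuity_2d_lt (f : R -> R -> R) (x y c : R) :
  continuity_2d_pt f x y -> f x y < c ->
  exists d, 0 < d /\ forall x' y', Rabs (x' - x) < d -> Rabs (y' - y) < d -> f x' y' < c.
Proof.
  intros H Hlt. destruct (H (mkposreal (c - f x y) ltac:(lra))) as [d Hd]. simpl in Hd.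
  exists d; split; [apply cond_pos|]. intros x' y' H1 H2.
  specialize (Hd x' y' H1 H2). apply Rabs_lt_between in Hd. lra.
Qed.

Lemma continuity_2d_gt (f : R -> R -> R) (x y c : R) :
  continuity_2d_pt f x y -> c < f x y ->
  exists d, 0 < d /\ forall x' y', Rabs (x' - x) < d -> Rabs (y' - y) < d -> c < f x' y'.
Proof.
  intros H Hlt. destruct (H (mkposreal (f x y - c) ltac:(lra))) as [d Hd]. simpl in Hd.
  exists d; split; [apply cond_pos|]. intros x' y' H1 H2.
  specialize (Hd x' y' H1 H2). apply Rabs_lt_between in Hd. lra.
Qed.

Lemma cont_in_minus K f g x y :
  cont_in K f x y -> cont_in K g x y -> cont_in K (fun u v => f u v - g u v) x y.
Proof.
  intros Hf Hg eps He.
  destruct (Hf (eps / 2)) as [d1 [Hd1 H1]]; [lra|].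
  destruct (Hg (eps / 2)) as [d2 [Hd2 H2]]; [lra|].
  exists (Rmin d1 d2); split; [apply Rmin_glb_lt; auto|].
  intros x' y' HK Hx Hy.
  pose proof (Rmin_l d1 d2). pose proof (Rmin_r d1 d2).
  specialize (H1 x' y' HK ltac:(lra) ltac:(lra)).
  specialize (H2 x' y' HK ltac:(lra) ltac:(lra)).
  apply Rabs_lt_between in H1, H2. apply Rabs_lt_between. lra.
Qed.

Lemma cont_in_subset (K K' : R -> R -> Prop) f x y :
  (forall u v, K' u v -> K u v) -> cont_in K f x y -> cont_in K' f x y.
Proof.
  intros HK H eps He. destruct (H eps He) as [d [Hd H']].
  exists d; split; auto.
Qed.

Lemma exp_le_1 (x : R) : x <= 0 -> exp x <= 1.
Proof.
  intros H. rewrite <- exp_0. destruct H as [H| ->]; [|lra].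
  left; apply exp_increasing; exact H.
Qed.

Lemma pow2_le_abs (x s : R) : 0 <= s -> x ^ 2 <= s ^ 2 -> Rabs x <= s.
Proof.
  intros Hs H. rewrite <- (Rabs_pos_eq s Hs). apply Rsqr_le_abs_0.
  unfold Rsqr. lra.
Qed.

Lemma exp_tangent (A B : R) : exp B * (A - B) <= exp A - exp B.
Proof.
  replace (exp A) with (exp B * exp (A - B)) by (rewrite <- exp_plus; f_equal; ring).
  pose proof (exp_pos B). pose proof (exp_ineq1_le (A - B)). nra.
Qed.

(* Comparison with the barrier [eps (exp (- al |x - y|^2) - exp (- al R^2))]:
   this one estimate yields both the strong maximum principle and the Hopf lemma. *)
Lemma ball_lower_bound (w w1 w2 w11 w22 : R -> R -> R) (y1 y2 r M rho : R) :
  0 < rho < r -> 0 <= M ->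
  (forall x1 x2, dist2 y1 y2 x1 x2 < r ^ 2 ->
     is_derive (fun t => w t x2) x1 (w1 x1 x2) /\
     is_derive (fun t => w x1 t) x2 (w2 x1 x2) /\
     is_derive (fun t => w1 t x2) x1 (w11 x1 x2) /\
     is_derive (fun t => w2 x1 t) x2 (w22 x1 x2) /\
     w11 x1 x2 + w22 x1 x2 <= M * w x1 x2) ->
  (forall x1 x2, dist2 y1 y2 x1 x2 <= r ^ 2 ->
     cont_in (fun x1 x2 => dist2 y1 y2 x1 x2 <= r ^ 2) w x1 x2) ->
  (forall x1 x2, dist2 y1 y2 x1 x2 <= r ^ 2 -> 0 <= w x1 x2) ->
  (forall x1 x2, dist2 y1 y2 x1 x2 <= rho ^ 2 -> 0 < w x1 x2) ->
  exists k, 0 < k /\ forall x1 x2, dist2 y1 y2 x1 x2 <= r ^ 2 ->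
    k * (r ^ 2 - dist2 y1 y2 x1 x2) <= w x1 x2.
Proof.
  intros Hrho HM Hd Hc Hnn Hpos.
  assert (box : forall s x1 x2, 0 < s -> dist2 y1 y2 x1 x2 <= s ^ 2 ->
      y1 - s <= x1 <= y1 + s /\ y2 - s <= x2 <= y2 + s).
  { intros s x1 x2 Hs H. unfold dist2 in H.
    pose proof (pow2_ge_0 (x1 - y1)). pose proof (pow2_ge_0 (x2 - y2)).
    assert (A1 : Rabs (x1 - y1) <= s) by (apply pow2_le_abs; lra).
    assert (A2 : Rabs (x2 - y2) <= s) by (apply pow2_le_abs; lra).
    apply Rabs_le_between in A1, A2. lra. }
  assert (Hrr : rho ^ 2 < r ^ 2) by nra.
  destruct (compact_min (fun x1 x2 => dist2 y1 y2 x1 x2 <= rho ^ 2) w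
     (y1 - rho) (y1 + rho) (y2 - rho) (y2 + rho)) as [m1 [m2 [Hm Hmin]]].
  { intros x1 x2 H; apply box; auto; lra. }
  { intros x1 x2 H. destruct (continuity_2d_gt _ x1 x2 (rho ^ 2) (dist2_cont y1 y2 x1 x2))
      as [d [Hd0 Hd1]]; [lra|]. exists d; split; auto.
    intros x' y' H1 H2. specialize (Hd1 x' y' H1 H2). lra. }
  { exists y1, y2. unfold dist2. nra. }
  { intros x1 x2 H. eapply cont_in_subset; [|apply Hc; lra]. simpl; intros; lra. }
  set (de := w m1 m2) in *.
  assert (Hde : 0 < de) by (apply Hpos; auto).
  set (al := (M + 2) / rho ^ 2 + 1).
  assert (Hr2 : 0 < rho ^ 2) by nra.
  assert (Hal : M + 2 < al * rho ^ 2).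
  { unfold al. replace (((M + 2) / rho ^ 2 + 1) * rho ^ 2) with (M + 2 + rho ^ 2) by (field; lra). lra. }
  assert (Hal1 : 1 <= al).
  { unfold al. assert (0 <= (M + 2) / rho ^ 2) by (apply Rdiv_le_0_compat; lra). lra. }
  set (h := fun x1 x2 => de * (exp (- al * dist2 y1 y2 x1 x2) - exp (- al * r ^ 2))).
  assert (Hh : forall x1 x2, dist2 y1 y2 x1 x2 <= r ^ 2 -> h x1 x2 <= w x1 x2).
  { destruct (compact_min (fun x1 x2 => rho ^ 2 <= dist2 y1 y2 x1 x2 <= r ^ 2)
       (fun x1 x2 => w x1 x2 - h x1 x2)
       (y1 - r) (y1 + r) (y2 - r) (y2 + r)) as [z1 [z2 [Hz Hzmin]]].
    { intros x1 x2 [_ H]; apply box; auto; lra. }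
    { intros x1 x2 H.
      destruct (Rlt_le_dec (r ^ 2) (dist2 y1 y2 x1 x2)) as [H'|H'].
      - destruct (continuity_2d_gt _ x1 x2 (r ^ 2) (dist2_cont y1 y2 x1 x2))
        as [d [Hd0 Hd1]]; [lra|]. exists d; split; auto.
        intros x' y' H1 H2 H3. specialize (Hd1 x' y' H1 H2). lra.
      - destruct (continuity_2d_lt _ x1 x2 (rho ^ 2) (dist2_cont y1 y2 x1 x2))
        as [d [Hd0 Hd1]]; [lra|]. exists d; split; auto.
        intros x' y' H1 H2 H3. specialize (Hd1 x' y' H1 H2). lra. }
    { exists (y1 + r), y2. unfold dist2. split; nra. }
    { intros x1 x2 H. apply cont_in_minus.
      - eapply cont_in_subset; [|apply Hc; lra]. simpl; intros; lra.
      - apply continuity_2d_cont_in. unfold h.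
        apply continuity_2d_pt_mult; [apply continuity_2d_pt_const|].
        apply continuity_2d_pt_minus; [|apply continuity_2d_pt_const].
        apply (continuity_1d_2d_pt_comp exp).
        + apply derivable_continuous_pt, derivable_pt_exp.
        + apply continuity_2d_pt_mult; [apply continuity_2d_pt_const|apply dist2_cont]. }
    assert (Hzz : 0 <= w z1 z2 - h z1 z2).
    (* A negative minimum of [w - h] cannot lie on the inner circle, where [h <= de <= w], nor on
       the outer one, where [h = 0 <= w]. In the open ring the second derivative test gives
       [Lap h <= Lap w <= M w], against [w < h]. *)
    { destruct (Rle_lt_dec 0 (w z1 z2 - h z1 z2)) as [|Hneg]; [assumption|exfalso].
      assert (Hz1 : rho ^ 2 < dist2 y1 y2 z1 z2).
      { destruct (Req_dec (dist2 y1 y2 z1 z2) (rho ^ 2)) as [Heq|]; [|lra].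
        assert (de <= w z1 z2) by (apply Hmin; lra).
        unfold h in Hneg.
        assert (exp (- al * dist2 y1 y2 z1 z2) <= 1).
        { apply exp_le_1. pose proof (dist2_ge0 y1 y2 z1 z2). nra. }
        pose proof (exp_pos (- al * r ^ 2)). nra. }
      assert (Hz2 : dist2 y1 y2 z1 z2 < r ^ 2).
      { destruct (Req_dec (dist2 y1 y2 z1 z2) (r ^ 2)) as [Heq|]; [|lra].
        unfold h in Hneg. rewrite Heq in Hneg.
        specialize (Hnn z1 z2 ltac:(lra)). lra. }
      destruct (continuity_2d_lt _ z1 z2 (r ^ 2) (dist2_cont y1 y2 z1 z2) Hz2) as [e1 [He1 Hn1]].
      destruct (continuity_2d_gt _ z1 z2 (rho ^ 2) (dist2_cont y1 y2 z1 z2) Hz1) as [e2 [He2 Hn2]].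
      pose proof (Rmin_l e1 e2) as Hl. pose proof (Rmin_r e1 e2) as Hr.
      assert (He : 0 < Rmin e1 e2) by (apply Rmin_glb_lt; auto).
      set (e := Rmin e1 e2) in *.
      destruct (Hd z1 z2 Hz2) as [_ [_ [H11 [H22 Hlap]]]].
      set (E := exp (- al * dist2 y1 y2 z1 z2)) in *.
      assert (HE : 0 < E) by apply exp_pos.
      assert (T1 : 0 <= w11 z1 z2 - de * ((- 2 * al + 4 * al ^ 2 * (z1 - y1) ^ 2) * E)).
      { apply (second_derivative_test (fun t => w t z2 - h t z2)
          (fun t => w1 t z2 - de * (- 2 * al * (t - y1) * exp (- al * dist2 y1 y2 t z2))) z1 _ e He).
        - intros t Ht. destruct (Hd t z2) as [H1 _].
          { apply Hn1; [lra|]. rewrite Rminus_diag, Rabs_R0; lra. }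
          apply (is_derive_minus (V := R_NormedModule)); [exact H1|].
          unfold h, dist2. auto_derive; auto. unfold Rminus; simpl pow; ring.
        - apply (is_derive_minus (V := R_NormedModule)); [exact H11|].
          unfold E, dist2. auto_derive; auto. unfold Rminus; simpl pow; ring.
        - intros t Ht. apply Hzmin.
          specialize (Hn1 t z2 ltac:(lra) ltac:(rewrite Rminus_diag, Rabs_R0; lra)).
          specialize (Hn2 t z2 ltac:(lra) ltac:(rewrite Rminus_diag, Rabs_R0; lra)). lra. }
      assert (T2 : 0 <= w22 z1 z2 - de * ((- 2 * al + 4 * al ^ 2 * (z2 - y2) ^ 2) * E)).
      { apply (second_derivative_test (fun t => w z1 t - h z1 t)
          (fun t => w2 z1 t - de * (- 2 * al * (t - y2) * exp (- al * dist2 y1 y2 z1 t))) z2 _ e He).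
        - intros t Ht. destruct (Hd z1 t) as [_ [H1 _]].
          { apply Hn1; [|lra]. rewrite Rminus_diag, Rabs_R0; lra. }
          apply (is_derive_minus (V := R_NormedModule)); [exact H1|].
          unfold h, dist2. auto_derive; auto. unfold Rminus; simpl pow; ring.
        - apply (is_derive_minus (V := R_NormedModule)); [exact H22|].
          unfold E, dist2. auto_derive; auto. unfold Rminus; simpl pow; ring.
        - intros t Ht. apply Hzmin.
          specialize (Hn1 z1 t ltac:(rewrite Rminus_diag, Rabs_R0; lra) ltac:(lra)).
          specialize (Hn2 z1 t ltac:(rewrite Rminus_diag, Rabs_R0; lra) ltac:(lra)). lra. }
      assert (Hhd : h z1 z2 <= de * E).
      { unfold h. fold E. pose proof (exp_pos (- al * r ^ 2)). nra. }
      assert (S : de * ((- 4 * al + 4 * al ^ 2 * dist2 y1 y2 z1 z2) * E) <= M * w z1 z2).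
      { replace (dist2 y1 y2 z1 z2) with ((z1 - y1) ^ 2 + (z2 - y2) ^ 2) by reflexivity. lra. }
      assert (Hfac : M + 1 <= - 4 * al + 4 * al ^ 2 * dist2 y1 y2 z1 z2).
      { assert (al ^ 2 * rho ^ 2 <= al ^ 2 * dist2 y1 y2 z1 z2) by (apply Rmult_le_compat_l; nra).
        nra. }
      assert (0 < de * E) by (apply Rmult_lt_0_compat; auto).
      assert (M * w z1 z2 <= M * (de * E)) by (apply Rmult_le_compat_l; lra).
      assert ((M + 1) * (de * E) <= (- 4 * al + 4 * al ^ 2 * dist2 y1 y2 z1 z2) * (de * E))
        by (apply Rmult_le_compat_r; lra).
      lra. }
    intros x1 x2 Hx. destruct (Rle_lt_dec (rho ^ 2) (dist2 y1 y2 x1 x2)) as [H|H].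
    - specialize (Hzmin x1 x2 (conj H Hx)). simpl in Hzmin. lra.
    - assert (de <= w x1 x2) by (apply Hmin; lra).
      assert (exp (- al * dist2 y1 y2 x1 x2) <= 1).
      { apply exp_le_1. pose proof (dist2_ge0 y1 y2 x1 x2). nra. }
      unfold h. pose proof (exp_pos (- al * r ^ 2)). nra. }
  (* By convexity the exponential lies above its tangent at [- al * r ^ 2]; the slope of this
     tangent gives the constant. *)
  exists (de * (exp (- al * r ^ 2) * al)). split.
  { pose proof (exp_pos (- al * r ^ 2)). apply Rmult_lt_0_compat; nra. }
  intros x1 x2 Hx. eapply Rle_trans; [|apply Hh; auto].
  unfold h. rewrite Rmult_assoc. apply Rmult_le_compat_l; [lra|].
  eapply Rle_trans; [|apply exp_tangent]. right; ring.
Qed.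

(** * Moving planes *)

Definition cont_seg (al be : R) (f : R -> R) : Prop :=
  forall t, al <= t <= be -> forall eps, 0 < eps -> exists d, 0 < d /\
    forall t', al <= t' <= be -> Rabs (t' - t) < d -> Rabs (f t' - f t) < eps.

(** Retraction onto the segment. Composition with it extends a function continuously beyond the
    ends, which is how functions controlled only up to the boundary enter the mean value theorem,
    the intermediate value theorem and integrals. *)
Definition clamp (al be t : R) : R := Rmax al (Rmin be t).

Lemma clamp_in al be t : al <= be -> al <= clamp al be t <= be.
Proof.
  intros H; unfold clamp. split; [apply Rmax_l|].
  apply Rmax_lub; [lra|apply Rmin_l].
Qed.

Lemma clamp_id al be t : al <= t <= be -> clamp al be t = t.
Proof. intros H; unfold clamp. rewrite Rmin_right, Rmax_right; lra. Qed.

Lemma clamp_lip al be s t : al <= be -> Rabs (clamp al be s - clamp al be t) <= Rabs (s - t).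
Proof.
  intros H. unfold clamp, Rmax, Rmin.
  repeat destruct Rle_dec; unfold Rabs; repeat destruct Rcase_abs; lra.
Qed.

Lemma cont_seg_clamp al be f : al <= be -> cont_seg al be f ->
  continuity (fun t => f (clamp al be t)).
Proof.
  intros Hab Hf t eps He.
  destruct (Hf (clamp al be t) (clamp_in al be t Hab) eps He) as [d [Hd H]].
  exists d; split; [exact Hd|]. intros t' [_ Ht']. simpl in *. unfold Rdist in *.
  apply H; [apply clamp_in; auto|].
  eapply Rle_lt_trans; [apply clamp_lip; auto|exact Ht'].
Qed.

Lemma locally_open_interval (al be x : R) : al < x < be -> locally x (fun y => al < y < be).
Proof.
  intros Hx. assert (Hm : 0 < Rmin (x - al) (be - x)) by (apply Rmin_glb_lt; lra).
  exists (mkposreal _ Hm). intros y Hy.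
  change (Rabs (y - x) < Rmin (x - al) (be - x)) in Hy. apply Rabs_lt_between in Hy.
  pose proof (Rmin_l (x - al) (be - x)). pose proof (Rmin_r (x - al) (be - x)). lra.
Qed.

Lemma MVT_seg (f g : R -> R) (al be : R) :
  al < be -> cont_seg al be f ->
  (forall t, al < t < be -> is_derive f t (g t)) ->
  exists c, al < c < be /\ f be - f al = g c * (be - al).
Proof.
  intros Hab Hf Hg.
  assert (Hd : forall c, al < c < be -> derivable_pt_lim (fun t => f (clamp al be t)) c (g c)).
  { intros c Hc. apply is_derive_Reals, (is_derive_ext_loc f); [|apply Hg; auto].
    apply (filter_imp (fun t => al < t < be)); [|apply locally_open_interval; auto].
    intros t Ht. rewrite clamp_id by lra. reflexivity. }
  assert (pr : forall c, al < c < be -> derivable_pt (fun t => f (clamp al be t)) c)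
    by (intros c Hc; exists (g c); exact (Hd c Hc)).
  destruct (MVT (fun t => f (clamp al be t)) id al be pr
    (fun c _ => derivable_pt_id c)) as [c [Hc Heq]]; auto.
  { intros; apply cont_seg_clamp; auto; lra. }
  { intros; apply derivable_continuous_pt, derivable_pt_id. }
  exists c; split; auto.
  rewrite (derive_pt_eq_0 _ c 1 (derivable_pt_id c)) in Heq by apply derivable_pt_lim_id.
  rewrite (derive_pt_eq_0 _ c (g c) (pr c Hc)) in Heq by auto.
  unfold id in Heq. rewrite !clamp_id in Heq by lra. lra.
Qed.

Lemma is_derive_lower_bound (f : R -> R) (x l k r : R) :
  0 < r -> is_derive f x l -> (forall t, 0 <= t <= r -> f x + k * t <= f (x + t)) -> k <= l.
Proof.
  intros Hr Hd Hf. apply is_derive_Reals in Hd.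
  destruct (Rle_lt_dec k l) as [|Hlt]; [assumption|exfalso].
  destruct (Hd (k - l)) as [d Hd']; [lra|].
  pose proof (cond_pos d).
  set (h := Rmin (d / 2) r).
  assert (0 < h) by (apply Rmin_glb_lt; lra).
  assert (h <= d / 2) by apply Rmin_l. assert (h <= r) by apply Rmin_r.
  specialize (Hd' h ltac:(lra) ltac:(rewrite Rabs_pos_eq; lra)).
  specialize (Hf h ltac:(lra)). apply Rabs_lt_between in Hd'.
  assert ((f (x + h) - f x) / h < k) by lra.
  assert (f (x + h) - f x < k * h).
  { replace (f (x + h) - f x) with ((f (x + h) - f x) / h * h) by (field; lra).
    apply Rmult_lt_compat_r; lra. }
  lra.
Qed.

Definition n2 (x y : R) : R := x ^ 2 + y ^ 2.

Lemma n2_cont x y : continuity_2d_pt n2 x y.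
Proof.
  apply (continuity_2d_pt_ext (dist2 0 0)); [|apply dist2_cont].
  intros; unfold n2, dist2; ring.
Qed.

Lemma is_derive_reflect (f : R -> R) (c x l : R) :
  is_derive f (2 * c - x) l -> is_derive (fun t => f (2 * c - t)) x (- l).
Proof.
  intros H. evar_last.
  - apply (is_derive_comp f (fun t => 2 * c - t)); [exact H|].
    auto_derive; [auto|reflexivity].
  - unfold scal; simpl; unfold mult; simpl. ring.
Qed.

Section Moving_planes.

Variables (a b ca cb M : R) (u p q p1 q2 : R -> R -> R).
Let K x y := a ^ 2 <= n2 x y <= b ^ 2.
Let Om x y := a ^ 2 < n2 x y < b ^ 2.
Hypothesis hab : 0 < a < b.
Hypothesis hM : 0 <= M.
Hypothesis hcont : forall x y, K x y -> cont_in K u x y.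
Hypothesis hder : forall x y, Om x y ->
  is_derive (fun t => u t y) x (p x y) /\ is_derive (fun t => u x t) y (q x y) /\
  is_derive (fun t => p t y) x (p1 x y) /\ is_derive (fun t => q x t) y (q2 x y).
Hypothesis hp : forall x y, Om x y -> continuity_2d_pt p x y.
Hypothesis hca : forall x y, n2 x y = a ^ 2 -> u x y = ca.
Hypothesis hcb : forall x y, n2 x y = b ^ 2 -> u x y = cb.
Hypothesis hmid : forall x y, Om x y -> cb < u x y < ca.
Hypothesis hlip : forall x y x' y', Om x y -> Om x' y' ->
  Rabs ((p1 x y + q2 x y) - (p1 x' y' + q2 x' y')) <= M * Rabs (u x y - u x' y').
Hypothesis hbd : forall x y, n2 x y = a ^ 2 \/ n2 x y = b ^ 2 -> 0 < x ->
  exists e, 0 < e /\ forall x' y', Om x' y' -> Rabs (x' - x) < e -> Rabs (y' - y) < e ->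
    p x' y' < 0.

(** The two norm conditions cut out the cap beyond the line [x = l]. For [l > 0] the reflection
    lowers the norm there, so they also place both points in the closed annulus. *)
Let G l := forall x y, l < x -> n2 x y <= b ^ 2 -> a ^ 2 <= n2 (2 * l - x) y ->
  u x y <= u (2 * l - x) y.

Lemma n2_reflect_lt l x y : 0 < l -> l < x -> n2 (2 * l - x) y < n2 x y.
Proof. intros; unfold n2; nra. Qed.

Lemma n2_reflect_le l x y : 0 < l -> l <= x -> n2 (2 * l - x) y <= n2 x y.
Proof. intros; unfold n2; nra. Qed.

Lemma reflected_ball l c1 c2 r : 0 < l -> 0 < r -> G l ->
  (forall x y, dist2 c1 c2 x y <= r ^ 2 ->
     l <= x /\ n2 x y <= b ^ 2 /\ a ^ 2 <= n2 (2 * l - x) y) ->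
  (forall x y, dist2 c1 c2 x y < r ^ 2 ->
     l < x /\ n2 x y < b ^ 2 /\ a ^ 2 < n2 (2 * l - x) y) ->
  u c1 c2 < u (2 * l - c1) c2 ->
  exists k, 0 < k /\ forall x y, dist2 c1 c2 x y <= r ^ 2 ->
    k * (r ^ 2 - dist2 c1 c2 x y) <= u (2 * l - x) y - u x y.
Proof.
  intros Hl Hr HG Hcl Hop Hc.
  assert (Hcont : forall x y, dist2 c1 c2 x y <= r ^ 2 ->
     cont_in (fun x y => dist2 c1 c2 x y <= r ^ 2) (fun x y => u (2 * l - x) y - u x y) x y).
  { intros x y H.
    assert (HK : forall x y, dist2 c1 c2 x y <= r ^ 2 -> K x y /\ K (2 * l - x) y).
    { intros x' y' H'. destruct (Hcl x' y' H') as [H1 [H2 H3]].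
      pose proof (n2_reflect_le l x' y' Hl H1). unfold K. lra. }
    destruct (HK x y H) as [K1 K2].
    apply (cont_in_minus _ (fun x y => u (2 * l - x) y)).
    - intros eps He. destruct (hcont _ _ K2 eps He) as [d [Hd H0]].
      exists d; split; auto. intros x' y' H' Hx Hy. apply H0; auto.
      + apply HK; auto.
      + replace (2 * l - x' - (2 * l - x)) with (- (x' - x)) by ring. rewrite Rabs_Ropp; auto.
    - eapply cont_in_subset; [|apply hcont; auto]. intros; apply HK; auto. }
  assert (Hcc : dist2 c1 c2 c1 c2 <= r ^ 2) by (unfold dist2; nra).
  destruct (Hcont c1 c2 Hcc (u (2 * l - c1) c2 - u c1 c2)) as [d [Hd Hd']]; [lra|].
  set (rho := Rmin (r / 2) (d / 2)).
  assert (Hrho : 0 < rho) by (apply Rmin_glb_lt; lra).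
  assert (Hrho1 : rho <= r / 2) by apply Rmin_l.
  assert (Hrho2 : rho <= d / 2) by apply Rmin_r.
  apply (ball_lower_bound _ (fun x y => - p (2 * l - x) y - p x y)
     (fun x y => q (2 * l - x) y - q x y)
     (fun x y => p1 (2 * l - x) y - p1 x y)
     (fun x y => q2 (2 * l - x) y - q2 x y) c1 c2 r M rho); auto.
  - lra.
  - intros x y H'. destruct (Hop x y H') as [H1 [H2 H3]].
    pose proof (n2_reflect_lt l x y Hl H1).
    assert (O1 : Om x y) by (unfold Om; lra).
    assert (O2 : Om (2 * l - x) y) by (unfold Om; lra).
    destruct (hder x y O1) as [A1 [A2 [A3 A4]]].
    destruct (hder _ _ O2) as [B1 [B2 [B3 B4]]].
    split; [|split; [|split; [|split]]].
    + apply (is_derive_minus (V := R_NormedModule) (fun t => u (2 * l - t) y)); auto.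
      apply (is_derive_reflect (fun t => u t y)); auto.
    + apply (is_derive_minus (V := R_NormedModule)); auto.
    + evar_last.
      * apply (is_derive_minus (V := R_NormedModule) (fun t => - p (2 * l - t) y)); [|exact A3].
        apply (is_derive_opp (V := R_NormedModule) (fun t => p (2 * l - t) y)).
        apply (is_derive_reflect (fun t => p t y)); exact B3.
      * unfold minus, plus, opp; simpl. ring.
    + apply (is_derive_minus (V := R_NormedModule)); auto.
    + specialize (hlip _ _ _ _ O2 O1). specialize (HG x y H1 ltac:(lra) ltac:(lra)).
      rewrite (Rabs_pos_eq (u _ _ - _)) in hlip by lra.
      apply Rabs_le_between in hlip. lra.
  - intros x y H'. destruct (Hcl x y H') as [H1 [H2 H3]].
    destruct (Req_dec l x) as [Heq|Hne].
    + subst x. replace (2 * l - l) with l by ring. lra.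
    + specialize (HG x y ltac:(lra) H2 H3). lra.
  - intros x y H'. unfold dist2 in H'.
    pose proof (pow2_ge_0 (x - c1)). pose proof (pow2_ge_0 (y - c2)).
    assert (A1 : Rabs (x - c1) <= rho) by (apply pow2_le_abs; lra).
    assert (A2 : Rabs (y - c2) <= rho) by (apply pow2_le_abs; lra).
    assert (Hq : dist2 c1 c2 x y <= r ^ 2) by (unfold dist2; nra).
    specialize (Hd' x y Hq ltac:(lra) ltac:(lra)). apply Rabs_lt_between in Hd'. lra.
Qed.

Lemma cap_open l x y : n2 x y < b ^ 2 -> a ^ 2 < n2 (2 * l - x) y ->
  exists d, 0 < d /\ forall x' y', Rabs (x' - x) < d -> Rabs (y' - y) < d ->
    n2 x' y' < b ^ 2 /\ a ^ 2 < n2 (2 * l - x') y'.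
Proof.
  intros H1 H2.
  destruct (continuity_2d_lt _ _ _ _ (n2_cont x y) H1) as [d1 [Hd1 D1]].
  destruct (continuity_2d_gt _ _ _ _ (n2_cont (2 * l - x) y) H2) as [d2 [Hd2 D2]].
  exists (Rmin d1 d2). split; [apply Rmin_glb_lt; auto|].
  pose proof (Rmin_l d1 d2). pose proof (Rmin_r d1 d2).
  intros x' y' Hx Hy. split; [apply D1; lra|].
  apply D2; [|lra].
  replace (2 * l - x' - (2 * l - x)) with (- (x' - x)) by ring. rewrite Rabs_Ropp; lra.
Qed.

Lemma dist2_lt_abs c1 c2 x y r : 0 < r -> dist2 c1 c2 x y <= r ^ 2 ->
  Rabs (x - c1) <= r /\ Rabs (y - c2) <= r.
Proof.
  intros Hr H. unfold dist2 in H.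
  pose proof (pow2_ge_0 (x - c1)). pose proof (pow2_ge_0 (y - c2)).
  split; apply pow2_le_abs; lra.
Qed.

(** The outer circle carries the lowest value and the inner one the highest, and the reflection
    moves every point beyond the line strictly closer to the origin. *)
Lemma curved_boundary_pos l x y : 0 < l -> l < x -> n2 x y <= b ^ 2 ->
  a ^ 2 <= n2 (2 * l - x) y -> n2 x y = b ^ 2 \/ n2 (2 * l - x) y = a ^ 2 ->
  u x y < u (2 * l - x) y.
Proof.
  intros Hl Hx H1 H2 H3. pose proof (n2_reflect_lt l x y Hl Hx) as Hr.
  assert (a ^ 2 < b ^ 2) by nra.
  destruct (Req_dec (n2 x y) (b ^ 2)) as [E1|E1];
  destruct (Req_dec (n2 (2 * l - x) y) (a ^ 2)) as [E2|E2].
  - rewrite (hcb _ _ E1), (hca _ _ E2).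
    pose proof (hmid ((a + b) / 2) 0) as Hm. unfold Om, n2 in Hm.
    specialize (Hm ltac:(split; nra)). lra.
  - rewrite (hcb _ _ E1). apply hmid. unfold Om; lra.
  - rewrite (hca _ _ E2). apply hmid. unfold Om; lra.
  - tauto.
Qed.

(** Strong maximum principle: if the difference were positive at distance [t] from its zero, a ball
    of radius [2 * t] about that point would contain the zero in its interior, where the lower bound
    is positive. *)
Lemma zero_propagates l x y : 0 < l -> G l -> l < x -> n2 x y < b ^ 2 ->
  a ^ 2 < n2 (2 * l - x) y -> u x y = u (2 * l - x) y ->
  exists d, 0 < d /\ forall t, 0 <= t < d ->
    n2 (x + t) y < b ^ 2 /\ a ^ 2 < n2 (2 * l - (x + t)) y /\
    u (x + t) y = u (2 * l - (x + t)) y.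
Proof.
  intros Hl HG Hx H1 H2 H3.
  destruct (cap_open l x y H1 H2) as [d [Hd HD]].
  set (e := Rmin d (x - l)).
  assert (He : 0 < e) by (apply Rmin_glb_lt; lra).
  assert (He1 : e <= d) by apply Rmin_l. assert (He2 : e <= x - l) by apply Rmin_r.
  assert (Hy0 : Rabs (y - y) = 0) by (rewrite Rminus_diag; apply Rabs_R0).
  exists (e / 4). split; [lra|]. intros t Ht.
  assert (Hxt : Rabs (x + t - x) < d) by (rewrite Rabs_pos_eq; lra).
  destruct (HD (x + t) y Hxt ltac:(lra)) as [A1 A2].
  split; [exact A1|split; [exact A2|]].
  destruct (Req_dec (u (x + t) y) (u (2 * l - (x + t)) y)) as [|Hne]; [assumption|exfalso].
  assert (u (x + t) y < u (2 * l - (x + t)) y).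
  { specialize (HG (x + t) y ltac:(lra) ltac:(lra) ltac:(lra)). lra. }
  assert (Ht0 : 0 < t).
  { destruct Ht as [[Ht0|Ht0] _]; auto. exfalso; apply Hne.
    rewrite <- Ht0, Rplus_0_r; exact H3. }
  destruct (reflected_ball l (x + t) y (2 * t) Hl ltac:(lra) HG) as [k [Hk Hb]]; auto.
  - intros x' y' H'. apply dist2_lt_abs in H'; [|lra]. destruct H' as [B1 B2].
    destruct (HD x' y') as [D1 D2].
    + apply Rabs_le_between in B1. apply Rabs_lt_between. lra.
    + lra.
    + apply Rabs_le_between in B1. repeat split; lra.
  - intros x' y' H'. apply Rlt_le in H'. apply dist2_lt_abs in H'; [|lra]. destruct H' as [B1 B2].
    destruct (HD x' y') as [D1 D2].
    + apply Rabs_le_between in B1. apply Rabs_lt_between. lra.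
    + lra.
    + apply Rabs_le_between in B1. repeat split; lra.
  - assert (Hd2 : dist2 (x + t) y x y = t ^ 2) by (unfold dist2; ring).
    specialize (Hb x y). rewrite Hd2 in Hb. specialize (Hb ltac:(nra)).
    assert (0 < k * ((2 * t) ^ 2 - t ^ 2)) by (apply Rmult_lt_0_compat; nra). lra.
Qed.

(* The zero set is followed along a horizontal segment up to the curved part of
   the boundary of the cap, which every component of the cap reaches. *)
Lemma cap_strict l x y : 0 < l -> G l -> l < x -> n2 x y < b ^ 2 ->
  a ^ 2 < n2 (2 * l - x) y -> u x y < u (2 * l - x) y.
Proof.
  intros Hl HG Hx H1 H2.
  destruct (Rle_lt_or_eq_dec _ _ (HG x y Hx ltac:(lra) ltac:(lra))) as [|H3]; [assumption|exfalso].
  set (E := fun t => 0 <= t /\ forall s, 0 <= s <= t ->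
     n2 (x + s) y < b ^ 2 /\ a ^ 2 < n2 (2 * l - (x + s)) y /\
     u (x + s) y = u (2 * l - (x + s)) y).
  assert (E0 : E 0).
  { split; [lra|]. intros s Hs. replace s with 0 by lra. rewrite Rplus_0_r. auto. }
  assert (bE : bound E).
  { exists b. intros t [Ht H]. destruct (H t ltac:(lra)) as [H' _].
    unfold n2 in H'. destruct (Rle_lt_dec t b); auto. exfalso. pose proof (pow2_ge_0 y). nra. }
  destruct (completeness E bE (ex_intro _ 0 E0)) as [T [HT1 HT2]].
  assert (HT : 0 <= T) by (apply HT1; exact E0).
  assert (Hlt : forall s, 0 <= s < T -> n2 (x + s) y < b ^ 2 /\ a ^ 2 < n2 (2 * l - (x + s)) y /\
     u (x + s) y = u (2 * l - (x + s)) y).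
  { intros s Hs. apply NNPP; intros Hn.
    assert (T <= s); [|lra]. apply HT2. intros t [Ht Ht'].
    destruct (Rle_lt_dec t s); auto. exfalso; apply Hn, Ht'; lra. }
  (* The vanishing persists at the supremum [T] by continuity, and the end point is still inside the
     cap, since the difference is positive on the curved boundary. *)
  assert (HTe : n2 (x + T) y < b ^ 2 /\ a ^ 2 < n2 (2 * l - (x + T)) y /\
     u (x + T) y = u (2 * l - (x + T)) y).
  { destruct (Req_dec T 0) as [->|HTne].
    { rewrite Rplus_0_r; auto. }
    assert (Hnear : forall d, 0 < d -> exists s, 0 <= s < T /\ T - s < d).
    { intros d Hd. exists (T - Rmin (T / 2) (d / 2)).
      assert (0 < Rmin (T / 2) (d / 2)) by (apply Rmin_glb_lt; lra).
      pose proof (Rmin_l (T / 2) (d / 2)). pose proof (Rmin_r (T / 2) (d / 2)). lra. }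
    assert (Hy0 : Rabs (y - y) = 0) by (rewrite Rminus_diag; apply Rabs_R0).
    assert (C1 : n2 (x + T) y <= b ^ 2).
    { destruct (Rle_lt_dec (n2 (x + T) y) (b ^ 2)) as [|Hgt]; [assumption|exfalso].
      destruct (continuity_2d_gt _ _ _ _ (n2_cont (x + T) y) Hgt) as [d [Hd HD]].
      destruct (Hnear d Hd) as [s [Hs1 Hs2]].
      specialize (HD (x + s) y ltac:(apply Rabs_lt_between; lra) ltac:(lra)).
      specialize (Hlt s Hs1). lra. }
    assert (C2 : a ^ 2 <= n2 (2 * l - (x + T)) y).
    { destruct (Rle_lt_dec (a ^ 2) (n2 (2 * l - (x + T)) y)) as [|Hgt]; [assumption|exfalso].
      destruct (continuity_2d_lt _ _ _ _ (n2_cont (2 * l - (x + T)) y) Hgt) as [d [Hd HD]].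
      destruct (Hnear d Hd) as [s [Hs1 Hs2]].
      specialize (HD (2 * l - (x + s)) y ltac:(apply Rabs_lt_between; lra) ltac:(lra)).
      specialize (Hlt s Hs1). lra. }
    pose proof (n2_reflect_lt l (x + T) y Hl ltac:(lra)) as Hr.
    assert (C3 : ~ u (x + T) y < u (2 * l - (x + T)) y).
    { intros Hw.
      assert (K1 : K (x + T) y) by (unfold K; lra).
      assert (K2 : K (2 * l - (x + T)) y) by (unfold K; lra).
      set (g := (u (2 * l - (x + T)) y - u (x + T) y) / 2).
      destruct (hcont _ _ K1 g) as [d1 [Hd1 D1]]; [unfold g; lra|].
      destruct (hcont _ _ K2 g) as [d2 [Hd2 D2]]; [unfold g; lra|].
      destruct (Hnear (Rmin d1 d2)) as [s [Hs1 Hs2]]; [apply Rmin_glb_lt; auto|].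
      pose proof (Rmin_l d1 d2). pose proof (Rmin_r d1 d2).
      destruct (Hlt s Hs1) as [F1 [F2 F3]].
      pose proof (n2_reflect_lt l (x + s) y Hl ltac:(lra)) as Hr'.
      specialize (D1 (x + s) y ltac:(unfold K; lra) ltac:(apply Rabs_lt_between; lra) ltac:(lra)).
      specialize (D2 (2 * l - (x + s)) y ltac:(unfold K; lra) ltac:(apply Rabs_lt_between; lra) ltac:(lra)).
      apply Rabs_lt_between in D1, D2. unfold g in *. lra. }
    assert (n2 (x + T) y <> b ^ 2).
    { intros He; apply C3, curved_boundary_pos; auto; lra. }
    assert (n2 (2 * l - (x + T)) y <> a ^ 2).
    { intros He; apply C3, curved_boundary_pos; auto; lra. }
    repeat split; try lra.
    specialize (HG (x + T) y ltac:(lra) C1 C2). lra. }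
  destruct HTe as [F1 [F2 F3]].
  destruct (zero_propagates l (x + T) y Hl HG ltac:(lra) F1 F2 F3) as [d [Hd HD]].
  assert (E (T + d / 2)).
  { split; [lra|]. intros s Hs. destruct (Rlt_le_dec s T) as [Hs'|Hs'].
    - apply Hlt; lra.
    - replace (x + s) with (x + T + (s - T)) by ring. apply HD; lra. }
  specialize (HT1 _ H). lra.
Qed.

(** Hopf lemma on the moving line: the ball of radius [r] about [(l + r, y)] touches the line at
    [(l, y)], where the difference vanishes and has normal derivative [- 2 p]. As
    [r ^ 2 - (t - r) ^ 2 >= r t] for [0 <= t <= r], the difference grows at least like [k r t]. *)
Lemma plane_derivative_neg l y : 0 < l -> G l -> Om l y -> p l y < 0.
Proof.
  intros Hl HG HO.
  assert (Hll : 2 * l - l = l) by ring.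
  destruct (cap_open l l y) as [d [Hd HD]]; [apply HO|rewrite Hll; apply HO|].
  set (r := d / 4).
  assert (Hr : 0 < r) by (unfold r; lra).
  assert (Hin : forall x' y', dist2 (l + r) y x' y' <= r ^ 2 ->
     n2 x' y' < b ^ 2 /\ a ^ 2 < n2 (2 * l - x') y').
  { intros x' y' H'. apply dist2_lt_abs in H'; [|lra]. destruct H' as [B1 B2].
    apply Rabs_le_between in B1. apply HD; [apply Rabs_lt_between|]; unfold r in *; lra. }
  destruct (reflected_ball l (l + r) y r Hl Hr HG) as [k [Hk Hb]].
  - intros x' y' H'. destruct (Hin x' y' H').
    apply dist2_lt_abs in H'; [|lra]. destruct H' as [B1 B2].
    apply Rabs_le_between in B1. lra.
  - intros x' y' H'. destruct (Hin x' y'); [lra|]. repeat split; auto.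
    unfold dist2 in H'. pose proof (pow2_ge_0 (y' - y)). nra.
  - destruct (Hin (l + r) y); [unfold dist2; nra|]. apply cap_strict; auto; lra.
  - assert (Hd0 : is_derive (fun t => u (2 * l - t) y - u t y) l (- p l y - p l y)).
    { destruct (hder l y HO) as [A _].
      apply (is_derive_minus (V := R_NormedModule) (fun t => u (2 * l - t) y)); auto.
      apply (is_derive_reflect (fun t => u t y)). rewrite Hll; exact A. }
    apply (is_derive_lower_bound _ _ _ (k * r) r Hr) in Hd0.
    + assert (0 < k * r) by (apply Rmult_lt_0_compat; auto). lra.
    + intros t Ht. rewrite Hll.
      assert (Hdt : dist2 (l + r) y (l + t) y = (t - r) ^ 2) by (unfold dist2; ring).
      specialize (Hb (l + t) y). rewrite Hdt in Hb. specialize (Hb ltac:(nra)).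
      assert (k * (r * t) <= k * (r ^ 2 - (t - r) ^ 2)) by (apply Rmult_le_compat_l; nra).
      lra.
Qed.

(** In the starting position [l = b] the line meets the annulus only at a wall point, covered by
    [hbd]; hence [G l] is asked for [l < b] only. *)
Lemma neg_derivative_near l y : 0 < l -> (l < b -> G l) -> a ^ 2 <= n2 l y <= b ^ 2 ->
  exists e, 0 < e /\ forall x' y', Om x' y' -> Rabs (x' - l) < e -> Rabs (y' - y) < e ->
    p x' y' < 0.
Proof.
  intros Hl HG [H1 H2].
  destruct (Req_dec (n2 l y) (a ^ 2)) as [E1|E1]; [apply hbd; auto|].
  destruct (Req_dec (n2 l y) (b ^ 2)) as [E2|E2]; [apply hbd; auto|].
  assert (HO : Om l y) by (unfold Om; lra).
  assert (Hlb : l < b) by (unfold Om, n2 in HO; nra).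
  destruct (continuity_2d_lt _ _ _ _ (hp l y HO) (plane_derivative_neg l y Hl (HG Hlb) HO))
    as [d [Hd HD]].
  exists d; split; auto.
Qed.

(** As [0 < 2 * l - x], the norm increases along the horizontal segment from the reflected point to
    [(x, y)]. The segment therefore stays in the annulus, and the sign of the derivative can be
    integrated along it. *)
Lemma reflect_le_of_neg l x y : 0 < l -> l < x < 2 * l -> n2 x y <= b ^ 2 ->
  a ^ 2 <= n2 (2 * l - x) y ->
  (forall s, 2 * l - x < s < x -> Om s y -> p s y < 0) -> u x y <= u (2 * l - x) y.
Proof.
  intros Hl Hx H1 H2 Hneg.
  assert (HO : forall s, 2 * l - x < s < x -> Om s y).
  { intros s Hs. unfold Om, n2 in *. split; nra. }
  assert (HK : forall s, 2 * l - x <= s <= x -> K s y).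
  { intros s Hs. unfold K, n2 in *. split; nra. }
  destruct (MVT_seg (fun s => u s y) (fun s => p s y) (2 * l - x) x) as [c [Hc Heq]].
  - lra.
  - intros s Hs eps He. destruct (hcont s y (HK s Hs) eps He) as [d [Hd HD]].
    exists d; split; auto. intros s' Hs' Hss. apply HD; auto.
    rewrite Rminus_diag, Rabs_R0; auto.
  - intros s Hs. apply hder; auto.
  - specialize (Hneg c Hc (HO c Hc)). nra.
Qed.

Lemma plane_closed l : 0 < l -> (forall m, l < m < b -> G m) -> l < b -> G l.
Proof.
  intros Hl HG Hlb x y Hx H1 H2.
  pose proof (n2_reflect_lt l x y Hl Hx) as Hr.
  (* If the reflected point is on the inner circle, a shift of the line may push it into the hole;
     the strict inequality on the curved boundary then replaces the limit. *)
  destruct (Req_dec (n2 (2 * l - x) y) (a ^ 2)) as [E|E].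
  { left. apply curved_boundary_pos; auto. }
  destruct (Rle_lt_dec (u x y) (u (2 * l - x) y)) as [|Hlt]; [assumption|exfalso].
  assert (Hy0 : Rabs (y - y) = 0) by (rewrite Rminus_diag; apply Rabs_R0).
  assert (K2 : K (2 * l - x) y) by (unfold K; lra).
  destruct (hcont _ _ K2 (u x y - u (2 * l - x) y)) as [d1 [Hd1 D1]]; [lra|].
  destruct (continuity_2d_gt _ _ _ (a ^ 2) (n2_cont (2 * l - x) y)) as [d2 [Hd2 D2]]; [lra|].
  set (e := Rmin (Rmin d1 d2 / 4) (Rmin (x - l) (b - l) / 2)).
  pose proof (Rmin_l d1 d2). pose proof (Rmin_r d1 d2).
  pose proof (Rmin_l (x - l) (b - l)). pose proof (Rmin_r (x - l) (b - l)).
  assert (0 < Rmin d1 d2) by (apply Rmin_glb_lt; auto).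
  assert (0 < Rmin (x - l) (b - l)) by (apply Rmin_glb_lt; lra).
  assert (He : 0 < e) by (apply Rmin_glb_lt; lra).
  assert (e <= Rmin d1 d2 / 4) by apply Rmin_l.
  assert (e <= Rmin (x - l) (b - l) / 2) by apply Rmin_r.
  assert (Ha : a ^ 2 < n2 (2 * (l + e) - x) y).
  { apply D2; [|lra]. apply Rabs_lt_between; lra. }
  specialize (HG (l + e) ltac:(lra) x y ltac:(lra) H1 ltac:(lra)).
  pose proof (n2_reflect_lt (l + e) x y ltac:(lra) ltac:(lra)).
  specialize (D1 (2 * (l + e) - x) y ltac:(unfold K; lra) ltac:(apply Rabs_lt_between; lra) ltac:(lra)).
  apply Rabs_lt_between in D1. lra.
Qed.

(** Around each point of a square containing the disk one of three things holds: the cap conditions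
    fail for all lines close to [l]; the point is on the line and [p < 0] around it; or the
    difference is positive and remains so. Compactness gives a common amount by which the line can
    be moved. *)
Lemma plane_step l : 0 < l <= b -> (forall m, l < m < b -> G m) ->
  exists e, 0 < e /\ forall m, l - e < m <= l -> 0 < m -> G m.
Proof.
  intros Hl Hm.
  assert (HG : l < b -> G l) by (apply plane_closed; auto; lra).
  destruct (local_to_uniform (fun x y e => forall m, l - e < m <= l -> 0 < m ->
     m < x -> n2 x y <= b ^ 2 -> a ^ 2 <= n2 (2 * m - x) y -> u x y <= u (2 * m - x) y)
     (- b) b (- b) b) as [e [He H]].
  - intros x y e e' He H m Hm1. apply H; lra.
  - intros x y _ _.
    destruct (Rlt_le_dec x l) as [Hxl|Hxl].
    { exists ((l - x) / 2). split; [lra|]. intros x' y' _ _ Hx' _ m Hm1 _ Hmx.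
      apply Rabs_lt_between in Hx'. lra. }
    destruct (Rlt_le_dec (b ^ 2) (n2 x y)) as [Hb|Hb].
    { destruct (continuity_2d_gt _ _ _ _ (n2_cont x y) Hb) as [d [Hd HD]].
      exists d; split; auto. intros x' y' _ _ Hx' Hy' m _ _ _ H'.
      specialize (HD x' y' Hx' Hy'). lra. }
    destruct (Rlt_le_dec (n2 (2 * l - x) y) (a ^ 2)) as [Ha|Ha].
    { destruct (continuity_2d_lt _ _ _ _ (n2_cont _ _) Ha) as [d [Hd HD]].
      exists (d / 3); split; [lra|]. intros x' y' _ _ Hx' Hy' m Hm1 _ _ _ H'.
      apply Rabs_lt_between in Hx'.
      specialize (HD (2 * m - x') y' ltac:(apply Rabs_lt_between; lra) ltac:(lra)). lra. }
    destruct (Req_dec x l) as [->|Hne].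
    { replace (2 * l - l) with l in Ha by ring.
      destruct (neg_derivative_near l y (proj1 Hl) HG (conj Ha Hb)) as [d [Hd HD]].
      set (e := Rmin (d / 3) (l / 4)).
      assert (He0 : 0 < e) by (apply Rmin_glb_lt; lra).
      assert (He1 : e <= d / 3) by apply Rmin_l. assert (He2 : e <= l / 4) by apply Rmin_r.
      exists e; split; auto. intros x' y' _ _ Hx' Hy' m Hm1 Hm0 Hmx H1 H2.
      apply Rabs_lt_between in Hx'.
      apply reflect_le_of_neg; auto; try lra.
      intros s Hs HO. apply HD; auto; [|lra]. apply Rabs_lt_between; lra. }
    assert (Hlx : l < x) by lra.
    assert (Hxb : x <= b) by (unfold n2 in Hb; nra).
    pose proof (n2_reflect_lt l x y ltac:(lra) Hlx) as Hr.
    assert (Hw : u x y < u (2 * l - x) y).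
    { destruct (Req_dec (n2 x y) (b ^ 2)); [apply curved_boundary_pos; auto; lra|].
      destruct (Req_dec (n2 (2 * l - x) y) (a ^ 2)); [apply curved_boundary_pos; auto; lra|].
      apply cap_strict; auto; try lra. apply HG; lra. }
    assert (K1 : K x y) by (unfold K; lra).
    assert (K2 : K (2 * l - x) y) by (unfold K; lra).
    set (g := (u (2 * l - x) y - u x y) / 2).
    destruct (hcont _ _ K1 g) as [d1 [Hd1 D1]]; [unfold g; lra|].
    destruct (hcont _ _ K2 g) as [d2 [Hd2 D2]]; [unfold g; lra|].
    pose proof (Rmin_l d1 d2) as Hm1. pose proof (Rmin_r d1 d2) as Hm2.
    assert (Hm3 : 0 < Rmin d1 d2) by (apply Rmin_glb_lt; auto).
    exists (Rmin d1 d2 / 3); split; [lra|]. intros x' y' _ _ Hx' Hy' m Hml Hm0 Hmx H1 H2.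
    pose proof (n2_reflect_lt m x' y' Hm0 Hmx).
    specialize (D1 x' y' ltac:(unfold K; lra) ltac:(lra) ltac:(lra)).
    apply Rabs_lt_between in Hx'.
    specialize (D2 (2 * m - x') y' ltac:(unfold K; lra) ltac:(apply Rabs_lt_between; lra) ltac:(lra)).
    apply Rabs_lt_between in D1, D2. unfold g in *. lra.
  - exists e; split; auto. intros m Hm1 Hm0 x y Hx H1 H2.
    assert (Rabs x <= b /\ Rabs y <= b) as [X Y].
    { unfold n2 in H1. pose proof (pow2_ge_0 x). pose proof (pow2_ge_0 y).
      split; apply pow2_le_abs; lra. }
    apply Rabs_le_between in X, Y. apply H; auto.
Qed.

Lemma all_planes l : 0 < l < b -> G l.
Proof.
  intros Hl.
  (* [m] is the distance travelled by the line from its starting position [l = b], beyond which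
     there is no cap. For [T = 0] the next step has a vacuous hypothesis; the sign of [p] near the
     wall makes the line move. *)
  set (E := fun m => 0 <= m < b /\ forall k, b - m < k < b -> G k).
  assert (E0 : E 0) by (split; [lra|]; intros; lra).
  assert (bE : bound E) by (exists b; intros m [Hm _]; lra).
  destruct (completeness E bE (ex_intro _ 0 E0)) as [T [HT1 HT2]].
  assert (HT : 0 <= T) by (apply HT1; exact E0).
  assert (HTb : T <= b) by (apply HT2; intros m [Hm _]; lra).
  assert (HG : forall k, b - T < k < b -> G k).
  { intros k Hk. apply NNPP; intros Hn. assert (T <= b - k); [|lra].
    apply HT2. intros m [Hm Hm']. destruct (Rle_lt_dec m (b - k)); auto.
    exfalso; apply Hn, Hm'; lra. }
  destruct (Req_dec T b) as [->|HTne]; [apply HG; lra|].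
  destruct (plane_step (b - T) ltac:(lra) HG) as [e [He HGe]].
  set (d := Rmin (e / 2) ((b - T) / 2)).
  assert (0 < d) by (apply Rmin_glb_lt; lra).
  assert (d <= e / 2) by apply Rmin_l. assert (d <= (b - T) / 2) by apply Rmin_r.
  assert (E (T + d)); [|specialize (HT1 _ H2); lra].
  split; [lra|]. intros k Hk. destruct (Rlt_le_dec (b - T) k).
  - apply HG; lra.
  - apply HGe; lra.
Qed.

(** Limit of the planes as [l] decreases to 0. The point is interior, so its reflections across the
    lines with small [l] stay in the annulus. *)
Lemma moving_planes x y : Om x y -> 0 < x -> u x y <= u (- x) y.
Proof.
  intros HO Hx.
  destruct (Rle_lt_dec (u x y) (u (- x) y)) as [|Hlt]; [assumption|exfalso].
  assert (Hn : n2 (- x) y = n2 x y) by (unfold n2; ring).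
  assert (KO : K (- x) y) by (unfold K, Om in *; rewrite Hn; lra).
  destruct (hcont _ _ KO (u x y - u (- x) y)) as [d1 [Hd1 D1]]; [lra|].
  destruct (continuity_2d_gt _ (- x) y (a ^ 2) (n2_cont _ _)) as [d2 [Hd2 D2]];
    [rewrite Hn; apply HO|].
  pose proof (Rmin_l d1 d2). pose proof (Rmin_r d1 d2).
  assert (0 < Rmin d1 d2) by (apply Rmin_glb_lt; auto).
  set (l := Rmin (Rmin d1 d2 / 4) (x / 2)).
  assert (0 < l) by (apply Rmin_glb_lt; lra).
  assert (l <= Rmin d1 d2 / 4) by apply Rmin_l. assert (l <= x / 2) by apply Rmin_r.
  assert (Hy0 : Rabs (y - y) = 0) by (rewrite Rminus_diag; apply Rabs_R0).
  assert (Hxb : x < b) by (unfold Om, n2 in HO; nra).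
  specialize (D2 (2 * l - x) y ltac:(apply Rabs_lt_between; lra) ltac:(lra)).
  pose proof (n2_reflect_lt l x y ltac:(lra) ltac:(lra)) as Hr.
  assert (HGl := all_planes l ltac:(lra) x y ltac:(lra) ltac:(unfold Om in HO; lra) ltac:(lra)).
  specialize (D1 (2 * l - x) y ltac:(unfold K, Om in *; lra) ltac:(apply Rabs_lt_between; lra) ltac:(lra)).
  apply Rabs_lt_between in D1. lra.
Qed.

End Moving_planes.

(** * Level sets of the stream function *)

Lemma IVT_seg (f : R -> R) (al be s : R) : al <= be -> cont_seg al be f ->
  (f al <= s <= f be \/ f be <= s <= f al) -> exists t, al <= t <= be /\ f t = s.
Proof.
  intros Hab Hf Hs.
  destruct (IVT_gen (fun t => f (clamp al be t)) al be s) as [t [Ht Heq]].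
  - apply cont_seg_clamp; auto.
  - rewrite !clamp_id by lra. unfold Rmin, Rmax; repeat destruct Rle_dec; lra.
  - rewrite Rmin_left, Rmax_right in Ht by lra. exists t; split; auto.
    rewrite clamp_id in Heq; auto.
Qed.

Lemma derive_cont_seg (f g : R -> R) (al be : R) :
  (forall t, al <= t <= be -> is_derive f t (g t)) -> cont_seg al be f.
Proof.
  intros H t Ht eps He.
  assert (C : continuity_pt f t).
  { apply derivable_continuous_pt. exists (g t). apply is_derive_Reals, H, Ht. }
  destruct (C eps He) as [d [Hd HD]]. exists d; split; [exact Hd|].
  intros t' _ Ht'. destruct (Req_dec t' t) as [->|Hne].
  - rewrite Rminus_diag, Rabs_R0; exact He.
  - apply (HD t'). split; [|exact Ht']. split; [exact I|auto].
Qed.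

Lemma slope_lower_bound (f g : R -> R) (al be m : R) :
  al <= be -> cont_seg al be f -> (forall t, al < t < be -> is_derive f t (g t)) ->
  (forall t, al < t < be -> m <= g t) -> m * (be - al) <= f be - f al.
Proof.
  intros Hab Hc Hd Hm. destruct Hab as [Hab| ->]; [|lra].
  destruct (MVT_seg f g al be Hab Hc Hd) as [c [Hcc ->]].
  apply Rmult_le_compat_r; [lra|auto].
Qed.

Lemma slope_abs_bound (f g : R -> R) (x y m : R) :
  cont_seg (Rmin x y) (Rmax x y) f ->
  (forall t, Rmin x y < t < Rmax x y -> is_derive f t (g t)) ->
  (forall t, Rmin x y < t < Rmax x y -> Rabs (g t) <= m) ->
  Rabs (f y - f x) <= m * Rabs (y - x).
Proof.
  assert (key : forall x y, x < y -> cont_seg x y f ->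
    (forall t, x < t < y -> is_derive f t (g t)) ->
    (forall t, x < t < y -> Rabs (g t) <= m) -> Rabs (f y - f x) <= m * Rabs (y - x)).
  { clear x y. intros x y Hxy Hc Hd Hm.
    destruct (MVT_seg f g x y Hxy Hc Hd) as [c [Hcc ->]].
    rewrite Rabs_mult. apply Rmult_le_compat_r; [apply Rabs_pos|auto]. }
  intros Hc Hd Hm.
  destruct (Rtotal_order x y) as [H|[->|H]].
  - rewrite Rmin_left, Rmax_right in Hc, Hd, Hm by lra. auto.
  - rewrite !Rminus_diag, Rabs_R0. lra.
  - rewrite Rmin_right, Rmax_left in Hc, Hd, Hm by lra.
    rewrite (Rabs_minus_sym (f y)), (Rabs_minus_sym y). auto.
Qed.

Lemma differentiable_is_derive (f : R -> R -> R) (x y lx ly : R) :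
  differentiable_pt_lim f x y lx ly ->
  is_derive (fun t => f t y) x lx /\ is_derive (fun t => f x t) y ly.
Proof.
  intros H. split; apply is_derive_Reals.
  - replace lx with (lx * 1 + ly * 0) by ring.
    apply (derivable_pt_lim_comp_2d f (fun t => t) (fun _ => y)); auto.
    + apply derivable_pt_lim_id.
    + apply derivable_pt_lim_const.
  - replace ly with (lx * 0 + ly * 1) by ring.
    apply (derivable_pt_lim_comp_2d f (fun _ => x) (fun t => t)); auto.
    + apply derivable_pt_lim_const.
    + apply derivable_pt_lim_id.
Qed.

Lemma differentiable_swap (f : R -> R -> R) (x y lx ly : R) :
  differentiable_pt_lim f x y lx ly ->
  differentiable_pt_lim (fun u v => f v u) y x ly lx.
Proof.
  intros H eps. destruct (H eps) as [d Hd]. exists d. intros u v Hu Hv.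
  specialize (Hd v u Hv Hu). rewrite Rmax_comm.
  rewrite (Rplus_comm (ly * _)). exact Hd.
Qed.

Lemma differentiable_opp (f : R -> R -> R) (x y lx ly : R) :
  differentiable_pt_lim f x y lx ly ->
  differentiable_pt_lim (fun u v => - f u v) x y (- lx) (- ly).
Proof.
  intros H eps. destruct (H eps) as [d Hd]. exists d. intros u v Hu Hv.
  specialize (Hd u v Hu Hv).
  replace (- f u v - - f x y - (- lx * (u - x) + - ly * (v - y)))
    with (- (f u v - f x y - (lx * (u - x) + ly * (v - y)))) by ring.
  rewrite Rabs_Ropp. exact Hd.
Qed.

(* Two points are chained if, for every d > 0, they are joined inside a level set
   of [G] in [D] by finitely many steps of size < d. *)
Definition chained (D : R -> R -> Prop) (G : R -> R -> R) (x y x' y' : R) : Prop :=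
  forall Rel : R -> R -> R -> R -> Prop,
    (forall x y, Rel x y x y) ->
    (forall x y x1 y1 x2 y2, Rel x y x1 y1 -> Rel x1 y1 x2 y2 -> Rel x y x2 y2) ->
    (exists d, 0 < d /\ forall x y x' y', D x y -> D x' y' -> G x y = G x' y' ->
       Rabs (x' - x) < d -> Rabs (y' - y) < d -> Rel x y x' y') ->
    Rel x y x' y'.

Lemma chained_trans D G x y x1 y1 x2 y2 :
  chained D G x y x1 y1 -> chained D G x1 y1 x2 y2 -> chained D G x y x2 y2.
Proof.
  intros H1 H2 Rel Hr Ht Hs. apply Ht with x1 y1; [apply H1|apply H2]; auto.
Qed.

Lemma chained_opp D G x y x' y' :
  chained D (fun u v => - G u v) x y x' y' -> chained D G x y x' y'.
Proof.
  intros H Rel Hr Ht [d [Hd Hs]]. apply H; auto.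
  exists d; split; auto. intros; apply Hs; auto; lra.
Qed.

Lemma chained_swap D G x y x' y' :
  chained (fun u v => D v u) (fun u v => G v u) y x y' x' -> chained D G x y x' y'.
Proof.
  intros H Rel Hr Ht [d [Hd Hs]].
  apply (H (fun u v u' v' => Rel v u v' u')); auto.
  - intros; eapply Ht; eauto.
  - exists d; split; auto.
Qed.

(** The slope bound [m] in [x] makes the level a graph [x = f y], and the bound [L] in [y] makes [f]
    Lipschitz. Bisection of the range of [y] gives chains with arbitrarily small steps. Along the
    graph [G] does not change and the gradient of [W] is a multiple of that of [G], so [W] has
    derivative zero. The slope bounds are stated apart from differentiability in [D] so that the box
    may reach a wall, which is outside [D]. *)
Lemma graph_connected (D : R -> R -> Prop) (G W Gx Gy Wx Wy : R -> R -> R)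
    (x1 x2 y1 y2 s m L : R) :
  0 < m -> 0 <= L ->
  (forall x x' y, x1 <= x <= x2 -> x1 <= x' <= x2 -> x <= x' -> y1 <= y <= y2 ->
     m * (x' - x) <= G x' y - G x y) ->
  (forall x y y', x1 <= x <= x2 -> y1 <= y <= y2 -> y1 <= y' <= y2 ->
     Rabs (G x y' - G x y) <= L * Rabs (y' - y)) ->
  (forall y, y1 <= y <= y2 -> exists x, x1 <= x <= x2 /\ G x y = s) ->
  (forall x y, x1 <= x <= x2 -> y1 <= y <= y2 -> G x y = s -> D x y) ->
  (forall x y, x1 <= x <= x2 -> y1 <= y <= y2 -> D x y ->
     differentiable_pt_lim G x y (Gx x y) (Gy x y) /\
     differentiable_pt_lim W x y (Wx x y) (Wy x y) /\
     Wx x y * Gy x y = Wy x y * Gx x y /\ Gx x y <> 0) ->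
  forall x y x' y', x1 <= x <= x2 -> y1 <= y <= y2 -> x1 <= x' <= x2 -> y1 <= y' <= y2 ->
    G x y = s -> G x' y' = s -> chained D G x y x' y' /\ W x' y' = W x y.
Proof.
  intros Hm HL Hsl Hlip Hex HD Hdiff.
  assert (H : forall y, exists x, y1 <= y <= y2 -> x1 <= x <= x2 /\ G x y = s).
  { intros y. destruct (classic (y1 <= y <= y2)) as [Hy|Hy].
    - destruct (Hex y Hy) as [x Hx]; exists x; auto.
    - exists 0; tauto. }
  set (f := fun y => proj1_sig (constructive_indefinite_description _ (H y))).
  assert (Hf : forall y, y1 <= y <= y2 -> x1 <= f y <= x2 /\ G (f y) y = s).
  { intros y. unfold f. destruct (constructive_indefinite_description _ (H y)); auto. }
  clearbody f.
  assert (Habs : forall x x' y, x1 <= x <= x2 -> x1 <= x' <= x2 -> y1 <= y <= y2 ->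
     m * Rabs (x' - x) <= Rabs (G x' y - G x y)).
  { intros x x' y Hx Hx' Hy. destruct (Rle_lt_dec x x').
    - specialize (Hsl x x' y Hx Hx' r Hy). rewrite Rabs_pos_eq by lra.
      eapply Rle_trans; [exact Hsl|apply Rle_abs].
    - specialize (Hsl x' x y Hx' Hx ltac:(lra) Hy).
      rewrite Rabs_minus_sym, (Rabs_minus_sym (G x' y)), Rabs_pos_eq by lra.
      eapply Rle_trans; [exact Hsl|apply Rle_abs]. }
  assert (Huniq : forall x y, x1 <= x <= x2 -> y1 <= y <= y2 -> G x y = s -> x = f y).
  { intros x y Hx Hy Hs. destruct (Hf y Hy) as [F1 F2].
    specialize (Habs x (f y) y Hx F1 Hy). rewrite Hs, F2, Rminus_diag, Rabs_R0 in Habs.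
    pose proof (Rabs_pos (f y - x)).
    assert (Rabs (f y - x) = 0) by nra.
    destruct (Req_dec x (f y)); auto. exfalso.
    apply (Rabs_no_R0 (f y - x)); auto. lra. }
  (* The summand 1 gives [C >= 1], so that [C * Rabs (y' - y)] bounds the displacement in [y] as
     well. *)
  set (C := L / m + 1).
  assert (HC1 : 0 <= L / m) by (apply Rdiv_le_0_compat; lra).
  assert (HC : 1 <= C) by (unfold C; lra).
  assert (HfL : forall y y', y1 <= y <= y2 -> y1 <= y' <= y2 ->
     Rabs (f y' - f y) <= C * Rabs (y' - y)).
  { intros y y' Hy Hy'. destruct (Hf y Hy) as [F1 F2]. destruct (Hf y' Hy') as [F3 F4].
    specialize (Habs (f y) (f y') y F1 F3 Hy). specialize (Hlip (f y') y y' F3 Hy Hy').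
    rewrite F2, <- F4 in Habs. rewrite (Rabs_minus_sym (G (f y') y)) in Habs.
    assert (Rabs (f y' - f y) <= L / m * Rabs (y' - y)).
    { apply Rmult_le_reg_l with m; auto.
      replace (m * (L / m * Rabs (y' - y))) with (L * Rabs (y' - y)) by (field; lra). lra. }
    unfold C. pose proof (Rabs_pos (y' - y)). lra. }
  assert (Hchain : forall y y', y1 <= y <= y2 -> y1 <= y' <= y2 ->
     chained D G (f y) y (f y') y').
  { intros y0 y0' Hy0 Hy0' Rel Hr Ht [d [Hd Hs]].
    assert (Hind : forall n y y', y1 <= y <= y2 -> y1 <= y' <= y2 ->
       Rabs (y' - y) < d / C * 2 ^ n -> Rel (f y) y (f y') y').
    { induction n; intros y y' Hy Hy' Hlt.
      - simpl in Hlt. rewrite Rmult_1_r in Hlt.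
        destruct (Hf y Hy) as [F1 F2]. destruct (Hf y' Hy') as [F3 F4].
        assert (C * Rabs (y' - y) < d).
        { replace d with (C * (d / C)) by (field; lra). apply Rmult_lt_compat_l; lra. }
        apply Hs; auto.
        + rewrite F2, F4; auto.
        + specialize (HfL y y' Hy Hy'). lra.
        + pose proof (Rabs_pos (y' - y)). nra.
      - simpl in Hlt.
        apply Ht with (f ((y + y') / 2)) ((y + y') / 2); apply IHn; try lra.
        + replace ((y + y') / 2 - y) with (/ 2 * (y' - y)) by field.
          rewrite Rabs_mult, (Rabs_pos_eq (/ 2)) by lra. lra.
        + replace (y' - (y + y') / 2) with (/ 2 * (y' - y)) by field.
          rewrite Rabs_mult, (Rabs_pos_eq (/ 2)) by lra. lra. }
    destruct (Pow_x_infinity 2 ltac:(rewrite Rabs_pos_eq; lra) (Rabs (y0' - y0) / (d / C) + 1))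
      as [N HN].
    specialize (HN N (le_n _)).
    rewrite Rabs_pos_eq in HN by (apply pow_le; lra).
    apply (Hind N); auto.
    assert (HdC : 0 < d / C) by (apply Rdiv_lt_0_compat; lra).
    replace (Rabs (y0' - y0)) with (d / C * (Rabs (y0' - y0) / (d / C))) by (field; split; lra).
    apply Rmult_lt_compat_l; lra. }
  assert (Hsmall : forall y, y1 <= y <= y2 -> forall eps, 0 < eps -> exists d, 0 < d /\
     forall y', y1 <= y' <= y2 -> Rabs (y' - y) < d ->
       Rabs (W (f y') y' - W (f y) y) <= eps * Rabs (y' - y)).
  { intros y Hy eps He. destruct (Hf y Hy) as [F1 F2].
    destruct (Hdiff (f y) y F1 Hy (HD _ _ F1 Hy F2)) as [DG [DW [Hpar Hnz]]].
    (* The gradient of [W] is [mu] times that of [G]. The increment of [G] along the level is zero,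
       so its linear part [A] is itself an error term, and so is the linear part [mu * A] of the
       increment of [W]. *)
    set (mu := Wx (f y) y / Gx (f y) y).
    assert (Hmu1 : Wx (f y) y = mu * Gx (f y) y) by (unfold mu; field; auto).
    assert (Hmu2 : Wy (f y) y = mu * Gy (f y) y).
    { apply Rmult_eq_reg_r with (Gx (f y) y); auto. rewrite <- Hpar, Hmu1. ring. }
    assert (Hmu : 0 < 1 + Rabs mu) by (pose proof (Rabs_pos mu); lra).
    set (e := eps / (C * (1 + Rabs mu))).
    assert (He' : 0 < e) by (apply Rdiv_lt_0_compat; auto; apply Rmult_lt_0_compat; lra).
    destruct (DG (mkposreal e He')) as [d1 D1]. destruct (DW (mkposreal e He')) as [d2 D2].
    simpl in D1, D2.
    set (d := Rmin d1 d2 / C).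
    assert (Hm12 : 0 < Rmin d1 d2) by (apply Rmin_glb_lt; apply cond_pos).
    exists d. split; [apply Rdiv_lt_0_compat; lra|].
    intros y' Hy' Hlt. destruct (Hf y' Hy') as [F3 F4].
    pose proof (Rmin_l d1 d2). pose proof (Rmin_r d1 d2).
    specialize (HfL y y' Hy Hy').
    pose proof (Rabs_pos (y' - y)) as Hp.
    assert (Hlt' : C * Rabs (y' - y) < Rmin d1 d2).
    { replace (Rmin d1 d2) with (C * d) by (unfold d; field; lra).
      apply Rmult_lt_compat_l; lra. }
    assert (Hq : Rabs (y' - y) <= C * Rabs (y' - y)) by nra.
    specialize (D1 (f y') y' ltac:(lra) ltac:(lra)).
    specialize (D2 (f y') y' ltac:(lra) ltac:(lra)).
    assert (Hmax : e * Rmax (Rabs (f y' - f y)) (Rabs (y' - y)) <= e * (C * Rabs (y' - y))).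
    { apply Rmult_le_compat_l; [lra|]. apply Rmax_lub; lra. }
    rewrite F2, F4, Rminus_diag in D1. rewrite Hmu1, Hmu2 in D2.
    set (A := Gx (f y) y * (f y' - f y) + Gy (f y) y * (y' - y)) in *.
    replace (mu * Gx (f y) y * (f y' - f y) + mu * Gy (f y) y * (y' - y)) with (mu * A) in D2
      by (unfold A; ring).
    replace (0 - A) with (- A) in D1 by ring. rewrite Rabs_Ropp in D1.
    replace (W (f y') y' - W (f y) y) with (W (f y') y' - W (f y) y - mu * A + mu * A) by ring.
    eapply Rle_trans; [apply Rabs_triang|]. rewrite (Rabs_mult mu).
    assert (Rabs mu * Rabs A <= Rabs mu * (e * (C * Rabs (y' - y))))
      by (apply Rmult_le_compat_l; [apply Rabs_pos|lra]).
    replace (eps * Rabs (y' - y)) with (e * (C * Rabs (y' - y)) * (1 + Rabs mu))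
      by (unfold e; field; split; lra).
    lra. }
  assert (HWlt : forall y y', y1 <= y <= y2 -> y1 <= y' <= y2 -> y < y' ->
     W (f y') y' = W (f y) y).
  { intros y y' Hy Hy' Hlt.
    destruct (MVT_seg (fun t => W (f t) t) (fun _ => 0) y y' Hlt) as [c [_ Hc]].
    - intros t Ht eps He. destruct (Hsmall t ltac:(lra) 1 Rlt_0_1) as [d [Hd HDd]].
      exists (Rmin d eps); split; [apply Rmin_glb_lt; auto|].
      intros t' Ht' Htt. pose proof (Rmin_l d eps). pose proof (Rmin_r d eps).
      specialize (HDd t' ltac:(lra) ltac:(lra)). lra.
    - intros t Ht. apply is_derive_Reals. intros eps He.
      destruct (Hsmall t ltac:(lra) (eps / 2) ltac:(lra)) as [d [Hd HDd]].
      set (e := Rmin d (Rmin (t - y) (y' - t))).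
      assert (He0 : 0 < e) by (repeat apply Rmin_glb_lt; lra).
      exists (mkposreal e He0). simpl. intros h Hh Hhlt.
      assert (e <= d) by apply Rmin_l.
      assert (He1 : e <= Rmin (t - y) (y' - t)) by apply Rmin_r.
      pose proof (Rmin_l (t - y) (y' - t)). pose proof (Rmin_r (t - y) (y' - t)).
      assert (Hhr := Hhlt). apply Rabs_lt_between in Hhr.
      specialize (HDd (t + h) ltac:(lra)).
      replace (t + h - t) with h in HDd by ring. specialize (HDd ltac:(lra)).
      rewrite Rminus_0_r. unfold Rdiv. rewrite Rabs_mult, Rabs_inv.
      assert (0 < Rabs h) by (apply Rabs_pos_lt; auto).
      apply Rle_lt_trans with (eps / 2 * Rabs h * / Rabs h).
      + apply Rmult_le_compat_r; [left; apply Rinv_0_lt_compat; auto|auto].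
      + field_simplify; lra.
    - lra. }
  intros x y x' y' Hx Hy Hx' Hy' Hs Hs'.
  rewrite (Huniq x y), (Huniq x' y'); auto.
  split; [apply Hchain; auto|].
  destruct (Rtotal_order y y') as [Hlt|[Heq|Hgt]].
  - apply HWlt; auto.
  - rewrite Heq; auto.
  - symmetry; apply HWlt; auto.
Qed.

(** Quantitative form of a nonzero gradient at scale [e]: nearby points of the level are chained
    with equal [W], and every nearby value is taken at a distance, and with a change of [W],
    proportional to the change of value. One number serves as size of the box and, inverted, as
    Lipschitz constant, which makes the property monotone in [e], as compactness requires. *)
Definition flat (D : R -> R -> Prop) (G W : R -> R -> R) (x y e : R) : Prop :=
  (forall x' y', D x' y' -> Rabs (x' - x) < e -> Rabs (y' - y) < e -> G x' y' = G x y ->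
     chained D G x y x' y' /\ W x' y' = W x y) /\
  (forall t, Rabs (t - G x y) < e -> exists x' y', D x' y' /\ G x' y' = t /\
     Rabs (x' - x) <= Rabs (t - G x y) / e /\ Rabs (y' - y) <= Rabs (t - G x y) / e /\
     Rabs (W x' y' - W x y) <= Rabs (t - G x y) / e).

Lemma flat_mono D G W x y e e' : 0 < e' <= e -> flat D G W x y e -> flat D G W x y e'.
Proof.
  intros He [H1 H2]. split.
  - intros x' y' HD Hx Hy. apply H1; auto; lra.
  - intros t Ht. destruct (H2 t ltac:(lra)) as [x' [y' [A [B [C1 [C2 C3]]]]]].
    assert (Rabs (t - G x y) / e <= Rabs (t - G x y) / e').
    { apply Rmult_le_compat_l; [apply Rabs_pos|]. apply Rinv_le_contravar; lra. }
    exists x', y'. repeat split; auto; lra.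
Qed.

(** Together with the exchange of coordinates, this reduces a nonzero gradient to the case of a
    positive first partial derivative. *)
Lemma flat_opp D G W x y e : flat D (fun u v => - G u v) W x y e -> flat D G W x y e.
Proof.
  intros [H1 H2]. split.
  - intros x' y' HD Hx Hy Hs. destruct (H1 x' y' HD Hx Hy) as [A B]; [lra|].
    split; auto. apply chained_opp; auto.
  - intros t Ht.
    assert (Habs : Rabs (- t - - G x y) = Rabs (t - G x y)).
    { replace (- t - - G x y) with (- (t - G x y)) by ring. apply Rabs_Ropp. }
    destruct (H2 (- t)) as [x' [y' [A [B C]]]]; [lra|].
    rewrite Habs in C. exists x', y'. repeat split; try apply C; auto; lra.
Qed.

Lemma flat_swap D G W x y e :
  flat (fun u v => D v u) (fun u v => G v u) (fun u v => W v u) y x e -> flat D G W x y e.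
Proof.
  intros [H1 H2]. split.
  - intros x' y' HD Hx Hy Hs. destruct (H1 y' x' HD Hy Hx Hs) as [A B].
    split; auto. apply chained_swap; auto.
  - intros t Ht. destruct (H2 t Ht) as [x' [y' [A [B [C1 [C2 C3]]]]]].
    exists y', x'. auto.
Qed.

Lemma flat_near (D : R -> R -> Prop) (G W Gx Gy Wx Wy : R -> R -> R) (x0 y0 LW : R) :
  (exists d, 0 < d /\ forall x y, Rabs (x - x0) < d -> Rabs (y - y0) < d -> D x y) ->
  (forall x y, D x y ->
     differentiable_pt_lim G x y (Gx x y) (Gy x y) /\
     differentiable_pt_lim W x y (Wx x y) (Wy x y) /\
     Wx x y * Gy x y = Wy x y * Gx x y /\ Rabs (Wx x y) <= LW) ->
  continuity_2d_pt Gx x0 y0 -> continuity_2d_pt Gy x0 y0 -> 0 < Gx x0 y0 ->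
  exists e, 0 < e /\ forall x y, Rabs (x - x0) < e -> Rabs (y - y0) < e -> flat D G W x y e.
Proof.
  intros [d [Hd HD]] Hdiff Cx Cy Hpos.
  set (m := Gx x0 y0 / 2). set (L := Rabs (Gy x0 y0) + 1).
  assert (Hm : 0 < m) by (unfold m; lra).
  assert (HL : 1 <= L) by (unfold L; pose proof (Rabs_pos (Gy x0 y0)); lra).
  destruct (continuity_2d_gt _ _ _ m Cx) as [d1 [Hd1 D1]]; [unfold m; lra|].
  destruct (Cy (mkposreal 1 Rlt_0_1)) as [d2 D2]; simpl in D2.
  pose proof (cond_pos d2) as Hd2.
  set (rho := Rmin d (Rmin d1 d2)).
  assert (Hrho : 0 < rho) by (repeat apply Rmin_glb_lt; auto).
  assert (R1 : rho <= d) by apply Rmin_l.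
  assert (R2 : rho <= Rmin d1 d2) by apply Rmin_r.
  pose proof (Rmin_l d1 d2). pose proof (Rmin_r d1 d2).
  assert (HLW : 0 <= LW).
  { destruct (Hdiff x0 y0) as [_ [_ [_ B]]].
    { apply HD; rewrite Rminus_diag, Rabs_R0; auto. }
    pose proof (Rabs_pos (Wx x0 y0)); lra. }
  assert (Hbox : forall x y, Rabs (x - x0) < rho -> Rabs (y - y0) < rho ->
    D x y /\ m < Gx x y /\ Rabs (Gy x y) <= L).
  { intros x y Hx Hy. split; [apply HD; lra|split; [apply D1; lra|]].
    specialize (D2 x y ltac:(lra) ltac:(lra)).
    replace (Gy x y) with (Gy x y - Gy x0 y0 + Gy x0 y0) by ring.
    eapply Rle_trans; [apply Rabs_triang|]. unfold L; lra. }
  set (x1 := x0 - rho / 2). set (x2 := x0 + rho / 2).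
  assert (Hin : forall x, x1 <= x <= x2 -> Rabs (x - x0) < rho).
  { unfold x1, x2; intros; apply Rabs_lt_between; lra. }
  assert (Hdx : forall x y, x1 <= x <= x2 -> Rabs (y - y0) < rho ->
     is_derive (fun t => G t y) x (Gx x y) /\ is_derive (fun t => W t y) x (Wx x y)).
  { intros x y Hx Hy. destruct (Hbox x y (Hin x Hx) Hy) as [B _].
    destruct (Hdiff x y B) as [A1 [A2 _]].
    split; [apply (differentiable_is_derive G x y _ (Gy x y))|
      apply (differentiable_is_derive W x y _ (Wy x y))]; auto. }
  assert (Hcx : forall y al be, Rabs (y - y0) < rho -> x1 <= al -> be <= x2 ->
     cont_seg al be (fun t => G t y)).
  { intros y al be Hy Ha Hb. apply derive_cont_seg with (fun t => Gx t y).
    intros t Ht. apply Hdx; auto; lra. }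
  assert (Hsl : forall x x' y, x1 <= x <= x2 -> x1 <= x' <= x2 -> x <= x' -> Rabs (y - y0) < rho ->
     m * (x' - x) <= G x' y - G x y).
  { intros x x' y Hx Hx' Hxx Hy.
    apply (slope_lower_bound (fun t => G t y) (fun t => Gx t y)); auto.
    - apply Hcx; auto; lra.
    - intros; apply Hdx; auto; lra.
    - intros t Ht. left. apply Hbox; auto. apply Hin; lra. }
  assert (Hlip : forall x y y', x1 <= x <= x2 -> Rabs (y - y0) < rho -> Rabs (y' - y0) < rho ->
     Rabs (G x y' - G x y) <= L * Rabs (y' - y)).
  { intros x y y' Hx Hy Hy'. apply Rabs_lt_between in Hy, Hy'.
    assert (Hb : forall t, Rmin y y' <= t <= Rmax y y' -> Rabs (t - y0) < rho).
    { intros t Ht. apply Rabs_lt_between.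
      revert Ht. unfold Rmin, Rmax; repeat destruct Rle_dec; lra. }
    assert (Hdy : forall t, Rmin y y' <= t <= Rmax y y' -> is_derive (fun t => G x t) t (Gy x t)).
    { intros t Ht. destruct (Hbox x t (Hin x Hx) (Hb t Ht)) as [B _].
      apply (differentiable_is_derive G x t (Gx x t)), Hdiff, B. }
    apply (slope_abs_bound (fun t => G x t) (fun t => Gy x t)).
    - apply derive_cont_seg with (fun t => Gy x t); auto.
    - intros; apply Hdy; lra.
    - intros t Ht. apply Hbox; auto. apply Hb; lra. }
  (* [rho / 8] leaves a width of at least [3 * rho / 8] on both sides of [x]. The bound with [m + L]
     makes the values at [x1] and [x2] straddle the level for every ordinate of the box, and
     [m * rho / 4] does so for every value within [e]. Finally [m] and [m / (LW + 1)] give the two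
     proportionality bounds, for the displacement and for [W]. *)
  set (e := Rmin (Rmin (rho / 8) (m * rho / (8 * (m + L)))) (Rmin (m * rho / 4) (Rmin m (m / (LW + 1))))).
  assert (He : 0 < e).
  { repeat apply Rmin_glb_lt; try lra; try (apply Rdiv_lt_0_compat; nra). }
  assert (E12 : e <= Rmin (rho / 8) (m * rho / (8 * (m + L)))) by apply Rmin_l.
  assert (E1 : e <= rho / 8) by (eapply Rle_trans; [exact E12|apply Rmin_l]).
  assert (E2 : e <= m * rho / (8 * (m + L))) by (eapply Rle_trans; [exact E12|apply Rmin_r]).
  assert (E345 : e <= Rmin (m * rho / 4) (Rmin m (m / (LW + 1)))) by apply Rmin_r.
  assert (E3 : e <= m * rho / 4) by (eapply Rle_trans; [exact E345|apply Rmin_l]).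
  assert (E45 : e <= Rmin m (m / (LW + 1))) by (eapply Rle_trans; [exact E345|apply Rmin_r]).
  assert (E4 : e <= m) by (eapply Rle_trans; [exact E45|apply Rmin_l]).
  assert (E5 : e <= m / (LW + 1)) by (eapply Rle_trans; [exact E45|apply Rmin_r]).
  clear E12 E345 E45. clearbody e.
  assert (E2' : (m + L) * e <= m * rho / 8).
  { replace (m * rho / 8) with ((m + L) * (m * rho / (8 * (m + L)))) by (field; lra).
    apply Rmult_le_compat_l; lra. }
  exists e; split; auto. intros x y Hx Hy.
  assert (Hy' := Hy). assert (Hx' := Hx). apply Rabs_lt_between in Hx', Hy'.
  assert (Hxin : x1 <= x <= x2) by (unfold x1, x2; lra).
  split.
  - intros x' y' HD' Hxx Hyy Hs.
    assert (Hyy' := Hyy). assert (Hxx' := Hxx). apply Rabs_lt_between in Hxx', Hyy'.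
    assert (Hyb : forall t, Rmin y y' <= t <= Rmax y y' -> Rabs (t - y0) < rho /\ Rabs (t - y) < e).
    { intros t Ht. split; apply Rabs_lt_between;
      revert Ht; unfold Rmin, Rmax; repeat destruct Rle_dec; lra. }
    apply (graph_connected D G W Gx Gy Wx Wy x1 x2 (Rmin y y') (Rmax y y') (G x y) m L); auto.
    + lra.
    + intros; apply Hsl; auto; apply Hyb; auto.
    + intros; apply Hlip; auto; apply Hyb; auto.
    + intros t Ht. destruct (Hyb t Ht) as [T1 T2].
      apply (IVT_seg (fun r => G r t)); [unfold x1, x2; lra|apply Hcx; auto; lra|].
      left.
      assert (L * Rabs (t - y) <= L * e) by (apply Rmult_le_compat_l; lra).
      assert (Q1 := Hlip x1 y t ltac:(unfold x1, x2; lra) ltac:(lra) T1).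
      assert (Q2 := Hlip x2 y t ltac:(unfold x1, x2; lra) ltac:(lra) T1).
      assert (Q3 := Hsl x1 x y ltac:(unfold x1, x2; lra) Hxin ltac:(lra) ltac:(lra)).
      assert (Q4 := Hsl x x2 y Hxin ltac:(unfold x1, x2; lra) ltac:(lra) ltac:(lra)).
      apply Rabs_le_between in Q1, Q2.
      assert (m * (3 * rho / 8) <= m * (x - x1))
        by (apply Rmult_le_compat_l; unfold x1; lra).
      assert (m * (3 * rho / 8) <= m * (x2 - x))
        by (apply Rmult_le_compat_l; unfold x2; lra).
      assert (0 < m * e) by (apply Rmult_lt_0_compat; auto).
      lra.
    + intros r t Hr Ht _. apply Hbox; [apply Hin; auto|apply Hyb; auto].
    + intros r t Hr Ht HDr. destruct (Hdiff r t HDr) as [A1 [A2 [A3 _]]].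
      destruct (Hbox r t (Hin r Hr) (proj1 (Hyb t Ht))) as [_ [B _]].
      repeat split; auto. lra.
    + split; [apply Rmin_l|apply Rmax_l].
    + unfold x1, x2; lra.
    + split; [apply Rmin_r|apply Rmax_r].
  - intros t Ht.
    assert (Hyr : Rabs (y - y0) < rho) by lra.
    assert (Q3 := Hsl x1 x y ltac:(unfold x1, x2; lra) Hxin ltac:(lra) Hyr).
    assert (Q4 := Hsl x x2 y Hxin ltac:(unfold x1, x2; lra) ltac:(lra) Hyr).
    assert (m * (3 * rho / 8) <= m * (x - x1))
      by (apply Rmult_le_compat_l; unfold x1; lra).
    assert (m * (3 * rho / 8) <= m * (x2 - x))
      by (apply Rmult_le_compat_l; unfold x2; lra).
    assert (Ht' := Ht). apply Rabs_lt_between in Ht'.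
    destruct (IVT_seg (fun r => G r y) x1 x2 t) as [x' [Hx1 Hx2]].
    + unfold x1, x2; lra.
    + apply Hcx; auto; lra.
    + left. nra.
    + assert (Hmx : m * Rabs (x' - x) <= Rabs (t - G x y)).
      { rewrite <- Hx2. destruct (Rle_lt_dec x x').
        - specialize (Hsl x x' y Hxin Hx1 r Hyr). rewrite Rabs_pos_eq by lra.
          eapply Rle_trans; [exact Hsl|apply Rle_abs].
        - specialize (Hsl x' x y Hx1 Hxin ltac:(lra) Hyr).
          rewrite Rabs_minus_sym, (Rabs_minus_sym (G x' y)), Rabs_pos_eq by lra.
          eapply Rle_trans; [exact Hsl|apply Rle_abs]. }
      assert (HWx : Rabs (W x' y - W x y) <= LW * Rabs (x' - x)).
      { assert (Hb : forall t, Rmin x x' <= t <= Rmax x x' -> x1 <= t <= x2).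
        { intros r. unfold Rmin, Rmax; repeat destruct Rle_dec; lra. }
        apply (slope_abs_bound (fun t => W t y) (fun t => Wx t y)).
        - apply derive_cont_seg with (fun t => Wx t y). intros; apply Hdx; auto.
        - intros; apply Hdx; auto; apply Hb; lra.
        - intros r Hr. apply Hdiff, Hbox; auto. apply Hin, Hb; lra. }
      pose proof (Rabs_pos (x' - x)) as Hp. pose proof (Rabs_pos (t - G x y)) as Hp2.
      assert (Hxe : Rabs (x' - x) <= Rabs (t - G x y) / e).
      { apply Rmult_le_reg_r with e; auto. unfold Rdiv.
        rewrite Rmult_assoc, Rinv_l, Rmult_1_r by lra. nra. }
      exists x', y. repeat split; auto.
      * apply Hbox; auto.
      * rewrite Rminus_diag, Rabs_R0. apply Rdiv_le_0_compat; auto.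
      * apply Rmult_le_reg_r with e; auto. unfold Rdiv.
        rewrite Rmult_assoc, Rinv_l, Rmult_1_r by lra.
        assert (E6 : (LW + 1) * e <= m).
        { apply Rle_trans with ((LW + 1) * (m / (LW + 1)));
            [apply Rmult_le_compat_l; lra|right; field; lra]. }
        assert (LW * e * Rabs (x' - x) <= m * Rabs (x' - x))
          by (apply Rmult_le_compat_r; nra).
        assert (Rabs (W x' y - W x y) * e <= LW * Rabs (x' - x) * e)
          by (apply Rmult_le_compat_r; lra).
        lra.
Qed.

Lemma periodic_all (T : R) (Q : R -> Prop) : 0 < T ->
  (forall t, 0 <= t <= T -> Q t) -> (forall t, Q t -> Q (t + T)) ->
  (forall t, Q t -> Q (t - T)) -> forall t, Q t.
Proof.
  intros HT H0 Hp Hm.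
  assert (Hn : forall n t, - (INR n * T) <= t <= INR n * T + T -> Q t).
  { induction n; intros t Ht.
    - apply H0. simpl in Ht. lra.
    - rewrite S_INR in Ht.
      destruct (Rlt_le_dec t (- (INR n * T))).
      + replace t with (t + T - T) by ring. apply Hm, IHn.
        pose proof (pos_INR n). split; [lra|]. nra.
      + destruct (Rlt_le_dec (INR n * T + T) t).
        * replace t with (t - T + T) by ring. apply Hp, IHn.
          pose proof (pos_INR n). split; [nra|lra].
        * apply IHn; lra. }
  intros t. destruct (INR_unbounded (Rabs t / T)) as [n Hlt].
  apply (Hn n).
  assert (H : Rabs t < INR n * T).
  { replace (Rabs t) with (Rabs t / T * T) by (field; lra). apply Rmult_lt_compat_r; lra. }
  apply Rabs_lt_between in H. lra.
Qed.

(** * Flows in the covering strip of polar coordinates *)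

Definition strip (a b : R) : R -> R -> Prop := fun r _ => a <= r <= b.

Lemma strip_cont_seg a b f t r1 r2 : (forall r t, a <= r <= b -> cont_in (strip a b) f r t) ->
  a <= r1 -> r2 <= b -> cont_seg r1 r2 (fun r => f r t).
Proof.
  intros H H1 H2 r Hr eps He. destruct (H r t ltac:(lra) eps He) as [d [Hd HD]].
  exists d; split; auto. intros r' Hr' Hrr. apply HD; auto.
  - unfold strip; lra.
  - rewrite Rminus_diag, Rabs_R0; auto.
Qed.

Lemma strip_bounded (a b T : R) (f : R -> R -> R) : 0 < T ->
  (forall r t, a <= r <= b -> cont_in (strip a b) f r t) ->
  (forall r t, f r (t + T) = f r t) ->
  exists B, 0 <= B /\ forall r t, a <= r <= b -> Rabs (f r t) <= B.
Proof.
  intros HT Hc Hper.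
  destruct (local_to_uniform (fun r t e => Rabs (f r t) <= / e) a b 0 T) as [e [He H]].
  - intros r t e e' [He Hee] H. eapply Rle_trans; [exact H|apply Rinv_le_contravar; lra].
  - intros r t Hr _. destruct (Hc r t Hr 1 Rlt_0_1) as [d [Hd HD]].
    set (A := Rabs (f r t) + 1).
    assert (HA : 0 < A) by (unfold A; pose proof (Rabs_pos (f r t)); lra).
    pose proof (Rinv_0_lt_compat _ HA).
    exists (Rmin d (/ A)). split; [apply Rmin_glb_lt; auto|].
    intros r' t' Hr' _ H1 H2.
    pose proof (Rmin_l d (/ A)). pose proof (Rmin_r d (/ A)).
    specialize (HD r' t' Hr' ltac:(lra) ltac:(lra)).
    assert (A <= / Rmin d (/ A)).
    { rewrite <- (Rinv_inv A) at 1. apply Rinv_le_contravar; [apply Rmin_glb_lt; auto|auto]. }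
    replace (f r' t') with (f r' t' - f r t + f r t) by ring.
    eapply Rle_trans; [apply Rabs_triang|]. unfold A in *. lra.
  - exists (/ e). split; [left; apply Rinv_0_lt_compat; auto|].
    intros r t Hr. revert t. apply (periodic_all T); auto.
    + intros t Ht. rewrite Hper; auto.
    + intros t Ht. rewrite <- (Hper r (t - T)). replace (t - T + T) with t by ring. auto.
Qed.

Lemma cont_in_strip_interior a b f r t : a < r < b ->
  cont_in (strip a b) f r t -> continuity_2d_pt f r t.
Proof.
  intros Hr H eps. destruct (H eps (cond_pos eps)) as [d [Hd HD]].
  assert (Hm : 0 < Rmin d (Rmin (r - a) (b - r))) by (repeat apply Rmin_glb_lt; lra).
  exists (mkposreal _ Hm). simpl. intros u v Hu Hv.
  pose proof (Rmin_l d (Rmin (r - a) (b - r))). pose proof (Rmin_r d (Rmin (r - a) (b - r))).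
  pose proof (Rmin_l (r - a) (b - r)). pose proof (Rmin_r (r - a) (b - r)).
  apply HD; try lra. apply Rabs_lt_between in Hu. unfold strip; lra.
Qed.

Lemma flat_shift (D : R -> R -> Prop) G W c x y e :
  (forall x y, D x (y + c) <-> D x y) ->
  (forall x y, G x (y + c) = G x y) -> (forall x y, W x (y + c) = W x y) ->
  flat D G W x y e -> flat D G W x (y + c) e.
Proof.
  intros HD HG HW [H1 H2]. split.
  - intros x' y' HD' Hx Hy Hs.
    destruct (H1 x' (y' - c)) as [A B]; auto.
    + apply HD. replace (y' - c + c) with y' by ring. auto.
    + replace (y' - c - y) with (y' - (y + c)) by ring. auto.
    + rewrite <- HG. replace (y' - c + c) with y' by ring. rewrite Hs, HG; auto.
    + split.
      * intros Rel Hr Ht [d [Hd Hst]].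
        assert (Hq := A (fun u v u' v' => Rel u (v + c) u' (v' + c))). simpl in Hq.
        replace (y' - c + c) with y' in Hq by ring. apply Hq; auto.
        { intros; eapply Ht; eauto. }
        exists d; split; auto. intros u v u' v' Du Du' Hg Hu Hv.
        apply Hst; auto; try (apply HD; auto).
        { rewrite !HG; auto. }
        { replace (v' + c - (v + c)) with (v' - v) by ring; auto. }
      * rewrite HW, <- B, <- (HW x' (y' - c)). f_equal; ring.
  - intros t. rewrite HG. intros Ht.
    destruct (H2 t Ht) as [x' [y' [A [B [C1 [C2 C3]]]]]].
    exists x', (y' + c). rewrite HG, !HW. repeat split; auto.
    + apply HD; auto.
    + replace (y' + c - (y + c)) with (y' - y) by ring; auto.
Qed.

Section Strip_flow.

Variables (a b T s0 s1 LW LU B : R) (U Ur Ut W Wr Wt : R -> R -> R).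
Let D : R -> R -> Prop := fun r _ => a < r < b.
Hypothesis hab : a < b.
Hypothesis hT : 0 < T.
Hypothesis hU : forall r t, a <= r <= b -> cont_in (strip a b) U r t.
Hypothesis hUr : forall r t, a <= r <= b -> cont_in (strip a b) Ur r t.
Hypothesis hUt : forall r t, a <= r <= b -> cont_in (strip a b) Ut r t.
Hypothesis hUp : forall r t, U r (t + T) = U r t.
Hypothesis hUrp : forall r t, Ur r (t + T) = Ur r t.
Hypothesis hWp : forall r t, W r (t + T) = W r t.
Hypothesis hdU : forall r t, a < r < b -> differentiable_pt_lim U r t (Ur r t) (Ut r t).
Hypothesis hdW : forall r t, a < r < b -> differentiable_pt_lim W r t (Wr r t) (Wt r t).
Hypothesis hpar : forall r t, a < r < b -> Wr r t * Ut r t = Wt r t * Ur r t.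
Hypothesis hLW : forall r t, a < r < b -> Rabs (Wr r t) <= LW /\ Rabs (Wt r t) <= LW.
Hypothesis hLU : forall r t, a < r < b -> Rabs (Ut r t) <= LU.
Hypothesis hB : forall r t, a < r < b -> Rabs (W r t) <= B.
Hypothesis hUa : forall t, U a t = s1.
Hypothesis hUb : forall t, U b t = s0.
Hypothesis hmid : forall r t, a < r < b -> s0 < U r t < s1.
Hypothesis hcrit : forall r t, a < r < b -> Ur r t <> 0 \/ Ut r t <> 0.
Hypothesis hwall : forall t, Ur b t < 0.
Hypothesis hray : exists t, Ur a t < 0.

Lemma strip_constants : s0 < s1 /\ 0 <= LW /\ 0 <= LU /\ 0 <= B.
Proof.
  assert (H : a < (a + b) / 2 < b) by lra.
  destruct (hLW _ 0 H) as [H1 _]. pose proof (hLU _ 0 H). pose proof (hB _ 0 H).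
  pose proof (hmid _ 0 H).
  pose proof (Rabs_pos (Wr ((a + b) / 2) 0)). pose proof (Rabs_pos (Ut ((a + b) / 2) 0)).
  pose proof (Rabs_pos (W ((a + b) / 2) 0)). lra.
Qed.

Lemma wall_slope : exists rho m, 0 < rho < b - a /\ 0 < m /\
  forall r t, b - rho <= r <= b -> Ur r t <= - m.
Proof.
  destruct (local_to_uniform (fun _ t e => forall r, a <= r <= b -> Rabs (r - b) < e ->
      Ur r t <= - e) b b 0 T) as [e [He H]].
  - intros r t e e' He H r' Hr' Hrr. specialize (H r' Hr' ltac:(lra)). lra.
  - intros r t Hr _. specialize (hwall t).
    destruct (hUr b t ltac:(lra) (- Ur b t / 2) ltac:(lra)) as [d [Hd HD]].
    exists (Rmin d (- Ur b t / 2)). split; [apply Rmin_glb_lt; lra|].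
    pose proof (Rmin_l d (- Ur b t / 2)). pose proof (Rmin_r d (- Ur b t / 2)).
    intros r' t' _ _ _ Ht r'' Hr'' Hrr.
    specialize (HD r'' t' Hr'' ltac:(lra) ltac:(lra)). apply Rabs_lt_between in HD. lra.
  - exists (Rmin (e / 2) ((b - a) / 2)), e.
    pose proof (Rmin_l (e / 2) ((b - a) / 2)). pose proof (Rmin_r (e / 2) ((b - a) / 2)).
    assert (0 < Rmin (e / 2) ((b - a) / 2)) by (apply Rmin_glb_lt; lra).
    split; [lra|split; [auto|]].
    intros r t Hr. revert t. apply (periodic_all T); auto.
    + intros t Ht. apply (H b t); try lra. rewrite Rabs_minus_sym, Rabs_pos_eq; lra.
    + intros t Ht. rewrite hUrp; auto.
    + intros t Ht. rewrite <- (hUrp r (t - T)). replace (t - T + T) with t by ring. auto.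
Qed.

Lemma low_levels_near_wall rho : 0 < rho < b - a ->
  exists sl, s0 < sl < s1 /\ forall r t, a <= r <= b -> U r t <= sl -> b - rho < r.
Proof.
  intros Hrho. destruct strip_constants as [Hs _].
  destruct (local_to_uniform (fun r t e => s0 + e < U r t) a (b - rho) 0 T) as [e [He H]].
  - intros; lra.
  - intros r t Hr _.
    assert (Hlt : s0 < U r t).
    { destruct (Req_dec r a) as [->|]; [rewrite hUa; auto|apply hmid; lra]. }
    destruct (hU r t ltac:(lra) ((U r t - s0) / 2) ltac:(lra)) as [d [Hd HD]].
    exists (Rmin d ((U r t - s0) / 2)). split; [apply Rmin_glb_lt; lra|].
    pose proof (Rmin_l d ((U r t - s0) / 2)). pose proof (Rmin_r d ((U r t - s0) / 2)).
    intros r' t' Hr' _ H1 H2.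
    specialize (HD r' t' ltac:(unfold strip; lra) ltac:(lra) ltac:(lra)).
    apply Rabs_lt_between in HD. lra.
  - exists (s0 + Rmin e ((s1 - s0) / 2)).
    pose proof (Rmin_l e ((s1 - s0) / 2)). pose proof (Rmin_r e ((s1 - s0) / 2)).
    assert (0 < Rmin e ((s1 - s0) / 2)) by (apply Rmin_glb_lt; lra).
    split; [lra|]. intros r t Hr. revert t.
    apply (periodic_all T (fun t => U r t <= _ -> b - rho < r)); auto.
    + intros t Ht HU. destruct (Rlt_le_dec (b - rho) r); auto.
      specialize (H r t ltac:(lra) Ht). cbv beta in H. lra.
    + intros t Ht. rewrite hUp; auto.
    + intros t Ht. rewrite <- (hUp r (t - T)). replace (t - T + T) with t by ring. auto.
Qed.

Definition level_connected (s : R) : Prop :=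
  forall r t r' t', D r t -> D r' t' -> U r t = s -> U r' t' = s -> chained D U r t r' t'.

Definition level_constant (s : R) : Prop :=
  forall r t r' t', D r t -> D r' t' -> U r t = s -> U r' t' = s -> W r' t' = W r t.

Lemma radial_slope t r1 r2 m : a <= r1 -> r2 <= b ->
  (forall r, r1 < r < r2 -> Ur r t <= - m) ->
  forall r r', r1 <= r <= r2 -> r1 <= r' <= r2 -> r <= r' -> m * (r' - r) <= U r t - U r' t.
Proof.
  intros H1 H2 Hm r r' Hr Hr' Hrr.
  assert (m * (r' - r) <= - U r' t - - U r t); [|lra].
  apply (slope_lower_bound (fun r => - U r t) (fun r => - Ur r t)); auto.
  - intros x Hx eps He.
    destruct (strip_cont_seg a b U t r r' hU ltac:(lra) ltac:(lra) x Hx eps He) as [d [Hd HD]].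
    exists d; split; auto. intros x' Hx' Hxx.
    replace (- U x' t - - U x t) with (- (U x' t - U x t)) by ring. rewrite Rabs_Ropp; auto.
  - intros x Hx. apply (is_derive_opp (V := R_NormedModule)).
    apply (differentiable_is_derive U x t _ (Ut x t)), hdU. lra.
  - intros x Hx. specialize (Hm x ltac:(lra)). lra.
Qed.

(** In the collar of width [rho] at the wall [r = b] the radial slope is at most [- m], so a level
    contained in the collar is a graph over the angle. The sign of [U] is changed to have a function
    increasing in [r]. *)
Lemma low_level_graph rho m sl s : 0 < rho < b - a -> 0 < m ->
  (forall r t, b - rho <= r <= b -> Ur r t <= - m) ->
  (forall r t, a <= r <= b -> U r t <= sl -> b - rho < r) -> s0 < s <= sl ->
  level_connected s /\ level_constant s.
Proof.
  intros Hrho Hm Hsl Hlow Hs. destruct strip_constants as [Hss [_ [HLU0 _]]].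
  assert (key : forall r t r' t', D r t -> D r' t' -> U r t = s -> U r' t' = s ->
     chained D U r t r' t' /\ W r' t' = W r t).
  { intros r t r' t' Hr Hr' E E'. unfold D in Hr, Hr'.
    assert (Hr1 := Hlow r t ltac:(lra) ltac:(lra)).
    assert (Hr1' := Hlow r' t' ltac:(lra) ltac:(lra)).
    destruct (graph_connected D (fun u v => - U u v) W (fun u v => - Ur u v) (fun u v => - Ut u v)
      Wr Wt (b - rho) b (Rmin t t') (Rmax t t') (- s) m LU Hm HLU0) with r t r' t' as [A1 A2];
      try lra; try (split; [apply Rmin_l|apply Rmax_l]); try (split; [apply Rmin_r|apply Rmax_r]).
    - intros x x' y Hx Hx' Hxx Hy.
      assert (Q := radial_slope y (b - rho) b m ltac:(lra) ltac:(lra)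
         ltac:(intros; apply Hsl; lra) x x' Hx Hx' Hxx). lra.
    - intros x y y' Hx Hy Hy'.
      replace (- U x y' - - U x y) with (- (U x y' - U x y)) by ring. rewrite Rabs_Ropp.
      (* On the wall [U] is constant, which gives the tangential bound there; [hdU] speaks of the
         open strip only. *)
      destruct (Req_dec x b) as [->|Hne].
      + rewrite !hUb, Rminus_diag, Rabs_R0. apply Rmult_le_pos; auto. apply Rabs_pos.
      + assert (Hd : forall t, is_derive (fun t => U x t) t (Ut x t)).
        { intros z. apply (differentiable_is_derive U x z (Ur x z)), hdU. lra. }
        apply (slope_abs_bound (fun t => U x t) (fun t => Ut x t)); auto.
        * apply derive_cont_seg with (fun t => Ut x t); auto.
        * intros; apply hLU; lra.
    - intros y Hy.
      destruct (IVT_seg (fun x => U x y) (b - rho) b s) as [x [Hx1 Hx2]].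
      + lra.
      + apply (strip_cont_seg a b); auto; lra.
      + right. rewrite hUb. split; [lra|].
        destruct (Rle_lt_dec s (U (b - rho) y)) as [|Hlt]; [lra|].
        specialize (Hlow (b - rho) y ltac:(lra) ltac:(lra)). lra.
      + exists x; split; auto. lra.
    - intros x y Hx Hy Hxy. unfold D. split; [lra|].
      destruct (Req_dec x b) as [->|]; [rewrite hUb in Hxy; lra|lra].
    - intros x y Hx Hy Hxy. split; [|split; [|split]].
      + apply differentiable_opp, hdU; auto.
      + apply hdW; auto.
      + specialize (hpar x y Hxy). lra.
      + specialize (Hsl x y Hx). lra.
    - split; auto. apply chained_opp; auto. }
  split; intros r t r' t' H1 H2 H3 H4; apply key; auto.
Qed.

(** Values between [sl] and [sh] are not taken near the walls, and periodicity leaves a compact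
    rectangle. There the gradient does not vanish, which gives local flatness up to a sign and the
    order of the coordinates. *)
Lemma uniformly_flat sl sh : s0 < sl -> sh < s1 ->
  exists e, 0 < e /\ forall r t, D r t -> sl <= U r t <= sh -> flat D U W r t e.
Proof.
  intros Hsl Hsh.
  destruct (local_to_uniform (fun r t e => D r t -> sl <= U r t <= sh -> flat D U W r t e)
    a b 0 T) as [e [He H]].
  - intros r t e e' He H H1 H2. apply flat_mono with e; auto.
  - intros r t Hr _.
    destruct (Req_dec r a) as [->|Hra].
    { destruct (hU a t ltac:(lra) (s1 - sh) ltac:(lra)) as [d [Hd HD]].
      exists d; split; auto. intros r' t' Hr' _ H1 H2 _ HU.
      specialize (HD r' t' Hr' H1 H2). rewrite hUa in HD. apply Rabs_lt_between in HD. lra. }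
    destruct (Req_dec r b) as [->|Hrb].
    { destruct (hU b t ltac:(lra) (sl - s0) ltac:(lra)) as [d [Hd HD]].
      exists d; split; auto. intros r' t' Hr' _ H1 H2 _ HU.
      specialize (HD r' t' Hr' H1 H2). rewrite hUb in HD. apply Rabs_lt_between in HD. lra. }
    assert (HDr : a < r < b) by lra.
    assert (Cr := cont_in_strip_interior a b Ur r t HDr (hUr r t Hr)).
    assert (Ct := cont_in_strip_interior a b Ut r t HDr (hUt r t Hr)).
    assert (Hm : 0 < Rmin (r - a) (b - r)) by (apply Rmin_glb_lt; lra).
    assert (Hop : forall r', Rabs (r' - r) < Rmin (r - a) (b - r) -> a < r' < b).
    { intros r' H1. pose proof (Rmin_l (r - a) (b - r)). pose proof (Rmin_r (r - a) (b - r)).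
      apply Rabs_lt_between in H1. lra. }
    assert (Hex : exists e, 0 < e /\ forall r' t', Rabs (r' - r) < e -> Rabs (t' - t) < e ->
       flat D U W r' t' e).
    { assert (HopD : exists d, 0 < d /\ forall x y, Rabs (x - r) < d -> Rabs (y - t) < d -> a < x < b)
        by (exists (Rmin (r - a) (b - r)); split; auto).
      assert (HopD' : exists d, 0 < d /\ forall y x, Rabs (y - t) < d -> Rabs (x - r) < d -> a < x < b)
        by (exists (Rmin (r - a) (b - r)); split; auto).
      assert (Cr' : continuity_2d_pt (fun u v => Ur v u) t r)
        by (intros eps; destruct (Cr eps) as [d Hd]; exists d; auto).
      assert (Ct' : continuity_2d_pt (fun u v => Ut v u) t r)
        by (intros eps; destruct (Ct eps) as [d Hd]; exists d; auto).
      destruct (hcrit r t HDr) as [Hne|Hne]; destruct (Rdichotomy _ _ Hne) as [Hp|Hp].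
      - destruct (flat_near D (fun u v => - U u v) W (fun u v => - Ur u v) (fun u v => - Ut u v)
          Wr Wt r t LW) as [e [He Hf]]; auto using continuity_2d_pt_opp.
        + intros x y Hxy. split; [apply differentiable_opp; auto|].
          split; [auto|split; [specialize (hpar x y Hxy); lra|apply hLW; auto]].
        + lra.
        + exists e; split; auto. intros; apply flat_opp; auto.
      - apply (flat_near D U W Ur Ut Wr Wt r t LW); auto.
        intros x y Hxy. split; [auto|split; [auto|split; [auto|apply hLW; auto]]].
      - destruct (flat_near (fun u v => D v u) (fun u v => - U v u) (fun u v => W v u)
          (fun u v => - Ut v u) (fun u v => - Ur v u) (fun u v => Wt v u) (fun u v => Wr v u)
          t r LW) as [e [He Hf]]; auto using continuity_2d_pt_opp.
        + intros y x Hxy.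
          split; [apply (differentiable_swap (fun u v => - U u v)), differentiable_opp; auto|].
          split; [apply differentiable_swap; auto|].
          split; [specialize (hpar x y Hxy); lra|apply hLW; auto].
        + lra.
        + exists e; split; auto. intros; apply flat_opp, flat_swap; auto.
      - destruct (flat_near (fun u v => D v u) (fun u v => U v u) (fun u v => W v u)
          (fun u v => Ut v u) (fun u v => Ur v u) (fun u v => Wt v u) (fun u v => Wr v u)
          t r LW) as [e [He Hf]]; auto.
        + intros y x Hxy. split; [apply differentiable_swap; auto|].
          split; [apply differentiable_swap; auto|].
          split; [specialize (hpar x y Hxy); lra|apply hLW; auto].
        + exists e; split; auto. intros; apply flat_swap; auto. }
    destruct Hex as [e [He Hf]]. exists e; split; auto.
  - exists e; split; auto. intros r t Hr. unfold D in Hr. revert t.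
    apply (periodic_all T (fun t => sl <= U r t <= sh -> flat D U W r t e)); auto.
    + intros t Ht HU. apply H; auto. unfold D in Hr; lra.
    + intros t Ht. rewrite hUp. intros HU. apply flat_shift; auto. unfold D; tauto.
    + intros t Ht HU.
      assert (Hm : forall f : R -> R -> R, (forall x y, f x (y + T) = f x y) ->
         forall x y, f x (y + - T) = f x y).
      { intros f Hf x y. rewrite <- Hf. f_equal; ring. }
      apply (flat_shift D U W (- T)); auto.
      * unfold D; tauto.
      * apply Ht. replace (t - T) with (t + - T) in HU by ring. rewrite (Hm U) in HU; auto.
Qed.

(** A chain on level [s] is shadowed on level [s']: flatness moves points from one level to the
    other by less than [e / 8], thanks to the bound on [Rabs (s' - s)], and two points of one level
    that are closer than [e] are chained. *)
Lemma level_connected_step sl sh e s s' :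
  0 < e -> (forall r t, D r t -> sl <= U r t <= sh -> flat D U W r t e) ->
  sl <= s <= sh -> sl <= s' <= sh -> Rabs (s' - s) < e -> Rabs (s' - s) < e * (e / 8) ->
  level_connected s -> level_connected s'.
Proof.
  intros He Hf Hs Hs' Hd1 Hd2 HC r t r' t' HD HD' E E'.
  assert (Hde : Rabs (s' - s) / e < e / 8).
  { apply Rmult_lt_reg_r with e; auto. unfold Rdiv at 1.
    rewrite Rmult_assoc, Rinv_l, Rmult_1_r by lra. lra. }
  assert (lift : forall z z' r t, sl <= z <= sh -> Rabs (z' - z) = Rabs (s' - s) -> D r t ->
     U r t = z -> exists r' t', D r' t' /\ U r' t' = z' /\
       Rabs (r' - r) < e / 8 /\ Rabs (t' - t) < e / 8).
  { intros z z' x y Hz Hzz HDx Ex.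
    destruct (Hf x y HDx ltac:(lra)) as [_ H2].
    destruct (H2 z') as [x' [y' [A1 [A2 [A3 [A4 _]]]]]].
    - rewrite Ex, Hzz; auto.
    - rewrite Ex, Hzz in A3, A4. exists x', y'. split; [exact A1|split; [exact A2|split; lra]]. }
  destruct (lift s' s r t Hs' (Rabs_minus_sym _ _) HD E) as [p [q [P1 [P2 [P3 P4]]]]].
  destruct (lift s' s r' t' Hs' (Rabs_minus_sym _ _) HD' E') as [p' [q' [P1' [P2' [P3' P4']]]]].
  assert (Hch := HC p q p' q' P1 P1' P2 P2').
  assert (near : forall x y x' y' x1 y1, D x1 y1 -> U x1 y1 = s' -> D x y -> U x y = s' ->
     Rabs (x' - x) < e / 8 -> Rabs (y' - y) < e / 8 ->
     Rabs (x' - x1) < e / 2 -> Rabs (y' - y1) < e / 2 -> chained D U x y x1 y1).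
  { intros x y x' y' x1 y1 A1 A2 A3 A4 B1 B2 B3 B4.
    apply Hf; auto; try lra;
    apply Rabs_lt_between; apply Rabs_lt_between in B1, B2, B3, B4; lra. }
  (* The relation says that points of level [s'] shadowing the two ends are chained on that level.
     It contains the short steps of level [s]; for transitivity, [lift] produces a shadow of the
     middle point. *)
  assert (Hrel := Hch (fun x y x' y' => D x y -> U x y = s -> D x' y' /\ U x' y' = s /\
     forall x1 y1 x2 y2, D x1 y1 -> U x1 y1 = s' -> D x2 y2 -> U x2 y2 = s' ->
       Rabs (x - x1) < e / 8 -> Rabs (y - y1) < e / 8 ->
       Rabs (x' - x2) < e / 8 -> Rabs (y' - y2) < e / 8 -> chained D U x1 y1 x2 y2)).
  simpl in Hrel.
  destruct Hrel as [_ [_ Hfin]]; auto.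
  - intros x y A1 A2. split; [auto|split; [auto|]].
    intros x1 y1 x2 y2 B1 B2 B3 B4 C1 C2 C3 C4. apply (near x1 y1 x y); auto; lra.
  - intros x y x1 y1 x2 y2 R1 R2 A1 A2.
    destruct (R1 A1 A2) as [A3 [A4 K1]]. destruct (R2 A3 A4) as [A5 [A6 K2]].
    split; [auto|split; [auto|]].
    intros z1 w1 z2 w2 B1 B2 B3 B4 C1 C2 C3 C4.
    destruct (lift s s' x1 y1 Hs eq_refl A3 A4) as [z [w [Z1 [Z2 [Z3 Z4]]]]].
    rewrite Rabs_minus_sym in Z3, Z4.
    apply chained_trans with z w; [apply K1|apply K2]; auto.
  - exists (e / 8). split; [lra|].
    intros x y x' y' A1 A2 A3 A4 A5 A6 A7. split; [auto|split; [congruence|]].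
    intros x1 y1 x2 y2 B1 B2 B3 B4 C1 C2 C3 C4. apply (near x1 y1 x y); auto;
    apply Rabs_lt_between; apply Rabs_lt_between in A4, A5, C1, C2, C3, C4; lra.
Qed.

Lemma levels_connected sl sh e : 0 < e -> sl <= sh ->
  (forall r t, D r t -> sl <= U r t <= sh -> flat D U W r t e) ->
  level_connected sl -> forall s, sl <= s <= sh -> level_connected s.
Proof.
  intros He Hlh Hf H0.
  set (k := Rmin (e / 2) (e * (e / 8) / 2)).
  assert (Hk : 0 < k) by (apply Rmin_glb_lt; nra).
  assert (Hk1 : k <= e / 2) by apply Rmin_l.
  assert (Hk2 : k <= e * (e / 8) / 2) by apply Rmin_r.
  assert (Hn : forall n s, sl <= s <= sh -> s <= sl + INR n * k -> level_connected s).
  { induction n; intros s Hs Hsn.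
    - simpl in Hsn. replace s with sl by lra; auto.
    - rewrite S_INR in Hsn.
      destruct (Rle_lt_dec s (sl + INR n * k)); [apply IHn; auto|].
      assert (0 <= INR n * k) by (apply Rmult_le_pos; [apply pos_INR|lra]).
      apply (level_connected_step sl sh e (sl + INR n * k) s); auto; try lra.
      + rewrite Rabs_pos_eq; lra.
      + rewrite Rabs_pos_eq; lra.
      + apply IHn; lra. }
  intros s Hs.
  destruct (INR_unbounded ((s - sl) / k)) as [n Hn'].
  apply (Hn n); auto.
  assert ((s - sl) / k * k <= INR n * k) by (apply Rmult_le_compat_r; lra).
  replace ((s - sl) / k * k) with (s - sl) in H by (field; lra). lra.
Qed.

(** Equality of [W] along a level is reflexive and transitive, and flatness gives it for steps
    shorter than [e]; hence it holds along chains. *)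
Lemma level_connected_constant e s : 0 < e ->
  (forall r t, D r t -> U r t = s -> flat D U W r t e) ->
  level_connected s -> level_constant s.
Proof.
  intros He Hf HC r t r' t' H1 H2 E1 E2.
  assert (Hrel := HC r t r' t' H1 H2 E1 E2
    (fun x y x' y' => D x y -> U x y = s -> D x' y' /\ U x' y' = s /\ W x' y' = W x y)).
  simpl in Hrel. destruct Hrel as [_ [_ Hfin]]; auto.
  - intros x y x1 y1 x2 y2 R1 R2 A1 A2.
    destruct (R1 A1 A2) as [A3 [A4 A5]]. destruct (R2 A3 A4) as [A6 [A7 A8]].
    split; [auto|split; [auto|congruence]].
  - exists e; split; auto. intros x y x' y' A1 A2 A3 A4 A5 A6 A7.
    split; [auto|split; [congruence|]]. apply Hf; auto.
Qed.

Definition lip_on (I : R -> Prop) : Prop :=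
  exists M, 0 <= M /\ forall r t r' t', D r t -> D r' t' -> I (U r t) -> I (U r' t') ->
    Rabs (W r t - W r' t') <= M * Rabs (U r t - U r' t').

Lemma level_nonempty s : s0 < s < s1 -> exists r t, D r t /\ U r t = s.
Proof.
  intros Hs. destruct (IVT_seg (fun r => U r 0) a b s) as [r [Hr E]].
  - lra.
  - apply (strip_cont_seg a b); auto; lra.
  - right. rewrite hUa, hUb. lra.
  - exists r, 0. split; auto. split.
    + destruct (Req_dec r a) as [->|]; [rewrite hUa in E|]; lra.
    + destruct (Req_dec r b) as [->|]; [rewrite hUb in E|]; lra.
Qed.

(** A point of the common level [c] is interposed. As [c] separates the two values of [U], both
    partial differences are bounded by the total one. *)
Lemma lip_on_union (I J : R -> Prop) c : s0 < c < s1 ->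
  (forall s, I s -> s <= c) -> (forall s, J s -> c <= s) -> I c -> J c ->
  lip_on I -> lip_on J -> lip_on (fun s => I s \/ J s).
Proof.
  intros Hc HI HJ Ic Jc [M [HM H]] [N [HN H']].
  destruct (level_nonempty c Hc) as [x [y [Dxy Exy]]].
  assert (mix : forall r t r' t', D r t -> D r' t' -> I (U r t) -> J (U r' t') ->
    Rabs (W r t - W r' t') <= (M + N) * Rabs (U r t - U r' t')).
  { intros r t r' t' D1 D2 I1 J2.
    assert (Q1 := H r t x y D1 Dxy I1 ltac:(rewrite Exy; auto)).
    assert (Q2 := H' x y r' t' Dxy D2 ltac:(rewrite Exy; auto) J2).
    specialize (HI _ I1). specialize (HJ _ J2). rewrite Exy in Q1, Q2.
    rewrite (Rabs_minus_sym (U r t)), (Rabs_pos_eq (c - U r t)) in Q1 by lra.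
    rewrite (Rabs_minus_sym c), (Rabs_pos_eq (U r' t' - c)) in Q2 by lra.
    rewrite (Rabs_minus_sym (U r t)), (Rabs_pos_eq (U r' t' - U r t)) by lra.
    replace (W r t - W r' t') with ((W r t - W x y) + (W x y - W r' t')) by ring.
    eapply Rle_trans; [apply Rabs_triang|].
    assert (M * (c - U r t) <= M * (U r' t' - U r t)) by (apply Rmult_le_compat_l; lra).
    assert (N * (U r' t' - c) <= N * (U r' t' - U r t)) by (apply Rmult_le_compat_l; lra).
    lra. }
  exists (M + N). split; [lra|]. intros r t r' t' D1 D2 [I1|J1] [I2|J2].
  - specialize (H r t r' t' D1 D2 I1 I2). pose proof (Rabs_pos (U r t - U r' t')). nra.
  - auto.
  - rewrite Rabs_minus_sym, (Rabs_minus_sym (U r t)). auto.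
  - specialize (H' r t r' t' D1 D2 J1 J2). pose proof (Rabs_pos (U r t - U r' t')). nra.
Qed.

Lemma lip_on_ray (I : R -> Prop) t0 r1 r2 m : 0 < m -> a <= r1 < r2 -> r2 <= b ->
  (forall r, r1 < r < r2 -> Ur r t0 <= - m) ->
  (forall s, I s -> s0 < s < s1 /\ U r2 t0 <= s <= U r1 t0 /\ level_constant s) ->
  lip_on I.
Proof.
  intros Hm H1 H2 Hsl HI. destruct strip_constants as [_ [HLW0 _]].
  assert (Hpt : forall s, I s -> exists r, r1 <= r <= r2 /\ a < r < b /\ U r t0 = s).
  { intros s Is. destruct (HI s Is) as [Hs1 [Hs2 _]].
    destruct (IVT_seg (fun r => U r t0) r1 r2 s) as [r [Hr E]].
    - lra.
    - apply (strip_cont_seg a b); auto; lra.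
    - right; auto.
    - exists r. split; auto. split; auto. split.
      + destruct (Req_dec r a) as [->|]; [rewrite hUa in E|]; lra.
      + destruct (Req_dec r b) as [->|]; [rewrite hUb in E|]; lra. }
  assert (Hord : forall x x', r1 <= x <= r2 -> r1 <= x' <= r2 -> a < x < b -> a < x' < b ->
     x <= x' -> Rabs (W x t0 - W x' t0) <= LW / m * Rabs (U x t0 - U x' t0)).
  { intros x x' Hx Hx' Dx Dx' Hxx.
    assert (Q := radial_slope t0 r1 r2 m ltac:(lra) H2 Hsl x x' Hx Hx' Hxx).
    assert (Hd : forall r, Rmin x' x <= r <= Rmax x' x -> a < r < b).
    { rewrite Rmin_right, Rmax_left by lra. intros; lra. }
    assert (QW : Rabs (W x t0 - W x' t0) <= LW * Rabs (x - x')).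
    { apply (slope_abs_bound (fun r => W r t0) (fun r => Wr r t0)).
      - apply derive_cont_seg with (fun r => Wr r t0). intros r Hr.
        apply (differentiable_is_derive W r t0 _ (Wt r t0)), hdW, Hd, Hr.
      - intros r Hr. apply (differentiable_is_derive W r t0 _ (Wt r t0)), hdW, Hd; lra.
      - intros r Hr. apply hLW, Hd; lra. }
    rewrite (Rabs_minus_sym x), (Rabs_pos_eq (x' - x)) in QW by lra.
    eapply Rle_trans; [exact QW|]. unfold Rdiv. rewrite Rmult_assoc.
    apply Rmult_le_compat_l; auto. apply Rmult_le_reg_l with m; auto.
    rewrite <- Rmult_assoc, Rinv_r, Rmult_1_l by lra.
    eapply Rle_trans; [exact Q|apply Rle_abs]. }
  exists (LW / m). split; [apply Rdiv_le_0_compat; auto|].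
  intros r t r' t' D1 D2 I1 I2.
  destruct (Hpt _ I1) as [x [X1 [X2 X3]]]. destruct (Hpt _ I2) as [x' [X1' [X2' X3']]].
  rewrite <- (proj2 (proj2 (HI _ I1)) r t x t0 D1 X2 eq_refl X3).
  rewrite <- (proj2 (proj2 (HI _ I2)) r' t' x' t0 D2 X2' eq_refl X3').
  rewrite <- X3, <- X3'.
  destruct (Rle_lt_dec x x').
  - apply Hord; auto.
  - rewrite Rabs_minus_sym, (Rabs_minus_sym (U x t0)). apply Hord; auto; lra.
Qed.

(* Level sets are circles winding once around the annulus: this holds near the
   wall without stagnation points and is transported from level to level. *)
Lemma vorticity_lipschitz : exists M, 0 <= M /\ forall r t r' t', a < r < b -> a < r' < b ->
  Rabs (W r t - W r' t') <= M * Rabs (U r t - U r' t').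
Proof.
  destruct strip_constants as [Hs [HLW0 [HLU0 HB0]]].
  destruct wall_slope as [rho [m [Hrho [Hm Hsl]]]].
  destruct (low_levels_near_wall rho Hrho) as [sl [Hsl1 Hsl2]].
  assert (Hlow := fun s => low_level_graph rho m sl s Hrho Hm Hsl Hsl2).
  assert (Hconst : forall s, s0 < s < s1 -> level_constant s).
  { intros s Hss. destruct (Rle_lt_dec s sl); [apply Hlow; lra|].
    destruct (uniformly_flat sl s ltac:(lra) ltac:(lra)) as [e [He Hf]].
    apply (level_connected_constant e); auto.
    - intros; apply Hf; auto; lra.
    - apply (levels_connected sl s e); auto; try lra. apply Hlow; lra. }
  destruct hray as [t0 Ht0].
  (* The ray leaves the wall at a point that is not a stagnation point. It is cut short enough to
     keep a slope of at most [- mt] and a value above [sl] at its end, so that the three ranges of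
     values fit together. *)
  assert (Htop : exists rt mt, a < rt < b /\ 0 < mt /\ sl < U rt t0 /\
     forall r, a < r < rt -> Ur r t0 <= - mt).
  { destruct (hUr a t0 ltac:(lra) (- Ur a t0 / 2) ltac:(lra)) as [d1 [Hd1 D1]].
    destruct (hU a t0 ltac:(lra) (s1 - sl) ltac:(lra)) as [d2 [Hd2 D2]].
    assert (H0 : Rabs (t0 - t0) = 0) by (rewrite Rminus_diag; apply Rabs_R0).
    set (d := Rmin (Rmin d1 d2) (b - a)).
    assert (0 < d) by (repeat apply Rmin_glb_lt; lra).
    assert (d <= Rmin d1 d2) by apply Rmin_l. assert (d <= b - a) by apply Rmin_r.
    pose proof (Rmin_l d1 d2). pose proof (Rmin_r d1 d2).
    exists (a + d / 2), (- Ur a t0 / 2). split; [lra|split; [lra|split]].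
    - specialize (D2 (a + d / 2) t0 ltac:(unfold strip; lra)
        ltac:(apply Rabs_lt_between; lra) ltac:(lra)).
      rewrite hUa in D2. apply Rabs_lt_between in D2. lra.
    - intros r Hr. specialize (D1 r t0 ltac:(unfold strip; lra)
        ltac:(apply Rabs_lt_between; lra) ltac:(lra)).
      apply Rabs_lt_between in D1. lra. }
  destruct Htop as [rt [mt [Hrt [Hmt [Hrtl Hslt]]]]].
  set (sh := U rt t0) in *.
  assert (Hsh : s0 < sh < s1) by (apply hmid; auto).
  assert (L1 : lip_on (fun s => s0 < s <= sl)).
  { apply (lip_on_ray _ 0 (b - rho) b m); auto; try lra.
    - intros; apply Hsl; lra.
    - intros s Hss. split; [lra|split; [|apply Hconst; lra]]. rewrite hUb. split; [lra|].
      destruct (Rle_lt_dec s (U (b - rho) 0)); auto.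
      specialize (Hsl2 (b - rho) 0 ltac:(lra) ltac:(lra)). lra. }
  assert (L2 : lip_on (fun s => sl <= s <= sh)).
  { destruct (uniformly_flat sl sh ltac:(lra) ltac:(lra)) as [e [He Hf]].
    (* The first term serves values closer than [e], by flatness; the second serves the others,
       since [W] varies by at most [2 * B]. *)
    exists (/ e + 2 * B / e). split.
    { assert (0 < / e) by (apply Rinv_0_lt_compat; auto).
      assert (0 <= 2 * B / e) by (apply Rdiv_le_0_compat; lra). lra. }
    intros r t r' t' D1 D2 I1 I2.
    assert (0 <= Rabs (U r t - U r' t')) by apply Rabs_pos.
    assert (0 < / e) by (apply Rinv_0_lt_compat; auto).
    assert (0 <= 2 * B / e) by (apply Rdiv_le_0_compat; lra).
    destruct (Rlt_le_dec (Rabs (U r t - U r' t')) e) as [Hlt|Hge].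
    - destruct (Hf r' t' D2 I2) as [_ Hl].
      destruct (Hl (U r t) Hlt) as [x [y [A1 [A2 [_ [_ A3]]]]]].
      rewrite <- (Hconst (U r t) ltac:(lra) r t x y D1 A1 eq_refl A2).
      assert (0 <= 2 * B / e * Rabs (U r t - U r' t')) by (apply Rmult_le_pos; auto).
      unfold Rdiv in *. lra.
    - pose proof (hB r t D1) as B1. pose proof (hB r' t' D2) as B2.
      apply Rle_trans with (2 * B).
      + unfold Rminus. eapply Rle_trans; [apply Rabs_triang|]. rewrite Rabs_Ropp. lra.
      + apply Rle_trans with (2 * B / e * Rabs (U r t - U r' t')).
        * apply Rle_trans with (2 * B / e * e); [right; field; lra|].
          apply Rmult_le_compat_l; auto.
        * apply Rmult_le_compat_r; lra. }
  assert (L3 : lip_on (fun s => sh <= s < s1)).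
  { apply (lip_on_ray _ t0 a rt mt); auto; try lra.
    intros s Hss. rewrite hUa. split; [lra|split; [unfold sh in Hss; lra|apply Hconst; lra]]. }
  assert (L12 : lip_on (fun s => s0 < s <= sl \/ sl <= s <= sh)).
  { apply (lip_on_union (fun s => s0 < s <= sl) (fun s => sl <= s <= sh) sl); auto;
      intros; lra. }
  assert (L123 : lip_on (fun s => (s0 < s <= sl \/ sl <= s <= sh) \/ sh <= s < s1)).
  { apply (lip_on_union (fun s => s0 < s <= sl \/ sl <= s <= sh) (fun s => sh <= s < s1) sh);
      auto; intros; lra. }
  destruct L123 as [M [HM HH]].
  assert (Hcases : forall s, s0 < s < s1 -> (s0 < s <= sl \/ sl <= s <= sh) \/ sh <= s < s1).
  { intros s Hss. destruct (Rle_lt_dec s sl); [left; left; lra|].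
    destruct (Rle_lt_dec s sh); [left; right; lra|right; lra]. }
  exists M; split; auto.
Qed.

End Strip_flow.

(** * Polar coordinates *)

Lemma cont_in_comp2 K (F f g : R -> R -> R) x y :
  continuity_2d_pt F (f x y) (g x y) -> cont_in K f x y -> cont_in K g x y ->
  cont_in K (fun u v => F (f u v) (g u v)) x y.
Proof.
  intros HF Hf Hg eps He. destruct (HF (mkposreal eps He)) as [d Hd]. simpl in Hd.
  destruct (Hf d (cond_pos d)) as [d1 [Hd1 D1]]. destruct (Hg d (cond_pos d)) as [d2 [Hd2 D2]].
  exists (Rmin d1 d2). split; [apply Rmin_glb_lt; auto|].
  intros x' y' HK Hx Hy. pose proof (Rmin_l d1 d2). pose proof (Rmin_r d1 d2).
  apply Hd; [apply D1|apply D2]; auto; lra.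
Qed.

Lemma cont_in_const K c x y : cont_in K (fun _ _ => c) x y.
Proof.
  intros eps He. exists 1. split; [lra|]. intros. rewrite Rminus_diag, Rabs_R0; auto.
Qed.

Lemma cont_in_plus K f g x y :
  cont_in K f x y -> cont_in K g x y -> cont_in K (fun u v => f u v + g u v) x y.
Proof.
  apply (cont_in_comp2 K (fun u v => u + v)).
  apply continuity_2d_pt_plus; [apply continuity_2d_pt_id1|apply continuity_2d_pt_id2].
Qed.

Lemma cont_in_mult K f g x y :
  cont_in K f x y -> cont_in K g x y -> cont_in K (fun u v => f u v * g u v) x y.
Proof.
  apply (cont_in_comp2 K (fun u v => u * v)).
  apply continuity_2d_pt_mult; [apply continuity_2d_pt_id1|apply continuity_2d_pt_id2].
Qed.

Lemma cont_in_opp K f x y : cont_in K f x y -> cont_in K (fun u v => - f u v) x y.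
Proof.
  intros H. apply (cont_in_comp2 K (fun u v => - u) f f); auto.
  apply continuity_2d_pt_opp, continuity_2d_pt_id1.
Qed.

Lemma cont_in_id1 K x y : cont_in K (fun u _ => u) x y.
Proof. apply continuity_2d_cont_in, continuity_2d_pt_id1. Qed.

Lemma cont_in_id2 K x y : cont_in K (fun _ v => v) x y.
Proof. apply continuity_2d_cont_in, continuity_2d_pt_id2. Qed.

Lemma continuity_2d_cos x y : continuity_2d_pt (fun _ t => cos t) x y.
Proof.
  apply (continuity_1d_2d_pt_comp cos (fun _ t => t)).
  - apply continuity_cos.
  - apply continuity_2d_pt_id2.
Qed.

Lemma continuity_2d_sin x y : continuity_2d_pt (fun _ t => sin t) x y.
Proof.
  apply (continuity_1d_2d_pt_comp sin (fun _ t => t)).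
  - apply continuity_sin.
  - apply continuity_2d_pt_id2.
Qed.

Lemma cont_in_cos K x y : cont_in K (fun _ t => cos t) x y.
Proof. apply continuity_2d_cont_in, continuity_2d_cos. Qed.

Lemma cont_in_sin K x y : cont_in K (fun _ t => sin t) x y.
Proof. apply continuity_2d_cont_in, continuity_2d_sin. Qed.

Ltac contin := repeat first
  [ apply cont_in_const | apply cont_in_id1 | apply cont_in_id2 | apply cont_in_cos
  | apply cont_in_sin | assumption | apply cont_in_plus | apply cont_in_minus
  | apply cont_in_mult | apply cont_in_opp ].

Definition ann (a b x y : R) : Prop := a ^ 2 < n2 x y < b ^ 2.

Definition cann (a b x y : R) : Prop := a ^ 2 <= n2 x y <= b ^ 2.

Lemma ann_open a b x y : ann a b x y ->
  exists d, 0 < d /\ forall x' y', Rabs (x' - x) < d -> Rabs (y' - y) < d -> ann a b x' y'.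
Proof.
  intros [H1 H2].
  destruct (continuity_2d_gt _ _ _ _ (n2_cont x y) H1) as [d1 [Hd1 D1]].
  destruct (continuity_2d_lt _ _ _ _ (n2_cont x y) H2) as [d2 [Hd2 D2]].
  exists (Rmin d1 d2). split; [apply Rmin_glb_lt; auto|].
  pose proof (Rmin_l d1 d2). pose proof (Rmin_r d1 d2).
  intros x' y' Hx Hy. split; [apply D1|apply D2]; lra.
Qed.

Lemma ann_cann a b x y : ann a b x y -> cann a b x y.
Proof. unfold ann, cann; lra. Qed.

Definition C1_ann (a b : R) (f f1 f2 : R -> R -> R) : Prop :=
  (forall x y, cann a b x y ->
     cont_in (cann a b) f x y /\ cont_in (cann a b) f1 x y /\ cont_in (cann a b) f2 x y) /\
  (forall x y, ann a b x y ->
     is_derive (fun t => f t y) x (f1 x y) /\ is_derive (fun t => f x t) y (f2 x y)).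

Lemma C1_ann_opp a b f f1 f2 : C1_ann a b f f1 f2 ->
  C1_ann a b (fun x y => - f x y) (fun x y => - f1 x y) (fun x y => - f2 x y).
Proof.
  intros [C D]. split.
  - intros x y H. destruct (C x y H) as [C1 [C2 C3]]. split; [|split]; contin.
  - intros x y H. destruct (D x y H) as [D1 D2].
    split; apply (is_derive_opp (V := R_NormedModule)); auto.
Qed.

Lemma cont_ann_interior a b f x y : ann a b x y -> cont_in (cann a b) f x y ->
  continuity_2d_pt f x y.
Proof.
  intros HA H eps. destruct (H eps (cond_pos eps)) as [d [Hd HD]].
  destruct (ann_open a b x y HA) as [d' [Hd' HD']].
  assert (Hm : 0 < Rmin d d') by (apply Rmin_glb_lt; auto).
  pose proof (Rmin_l d d'). pose proof (Rmin_r d d').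
  exists (mkposreal _ Hm). simpl. intros u v Hu Hv.
  apply HD; try lra. apply ann_cann, HD'; lra.
Qed.

Lemma differentiable_of_partials (f f1 f2 : R -> R -> R) x y :
  (exists d, 0 < d /\ forall x' y', Rabs (x' - x) < d -> Rabs (y' - y) < d ->
     is_derive (fun t => f t y') x' (f1 x' y')) ->
  is_derive (fun t => f x t) y (f2 x y) -> continuity_2d_pt f1 x y ->
  differentiable_pt_lim f x y (f1 x y) (f2 x y).
Proof.
  intros [d [Hd HD]] H2 Hc.
  apply filterdiff_differentiable_pt_lim.
  assert (H := is_derive_filterdiff f x y f1 (f2 x y)).
  apply H; auto.
  - apply (locally_2d_locally (fun u v => is_derive (fun z => f z v) u (f1 u v))).
    exists (mkposreal d Hd). auto.
  - apply continuity_2d_pt_filterlim in Hc. exact Hc.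
Qed.

Lemma C1_ann_differentiable a b f f1 f2 x y : C1_ann a b f f1 f2 -> ann a b x y ->
  differentiable_pt_lim f x y (f1 x y) (f2 x y).
Proof.
  intros [Hc Hd] HA. apply differentiable_of_partials.
  - destruct (ann_open a b x y HA) as [d [Hd0 HD]]. exists d; split; auto.
    intros; apply Hd, HD; auto.
  - apply Hd; auto.
  - apply (cont_ann_interior a b); auto. apply Hc, ann_cann; auto.
Qed.

Lemma schwarz_partials (f f1 f2 f12 f21 : R -> R -> R) x y :
  (exists d, 0 < d /\ forall x' y', Rabs (x' - x) < d -> Rabs (y' - y) < d ->
     is_derive (fun t => f t y') x' (f1 x' y') /\ is_derive (fun t => f x' t) y' (f2 x' y') /\
     is_derive (fun t => f1 x' t) y' (f12 x' y') /\ is_derive (fun t => f2 t y') x' (f21 x' y')) ->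
  continuity_2d_pt f12 x y -> continuity_2d_pt f21 x y -> f12 x y = f21 x y.
Proof.
  intros [d [Hd HD]] C12 C21.
  assert (near : forall c z, Rabs (z - c) < d -> locally z (fun z' => Rabs (z' - c) < d)).
  { intros c z Hz. exists (mkposreal (d - Rabs (z - c)) ltac:(lra)).
    intros z' Hz'. unfold ball in Hz'; simpl in Hz'.
    unfold AbsRing_ball, abs, minus, plus, opp in Hz'; simpl in Hz'.
    replace (z' - c) with (z' + - z + (z - c)) by ring.
    eapply Rle_lt_trans; [apply Rabs_triang|]. lra. }
  assert (E1 : forall u v, Rabs (u - x) < d -> Rabs (v - y) < d ->
     is_derive (fun z => Derive (fun t => f t z) u) v (f12 u v)).
  { intros u v Hu Hv. apply (is_derive_ext_loc (fun z => f1 u z)); [|apply HD; auto].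
    apply (filter_imp (fun z => Rabs (z - y) < d)); [|apply near; auto].
    intros z Hz. symmetry. apply is_derive_unique, HD; auto. }
  assert (E2 : forall u v, Rabs (u - x) < d -> Rabs (v - y) < d ->
     is_derive (fun z => Derive (fun t => f z t) v) u (f21 u v)).
  { intros u v Hu Hv. apply (is_derive_ext_loc (fun z => f2 z v)); [|apply HD; auto].
    apply (filter_imp (fun z => Rabs (z - x) < d)); [|apply near; auto].
    intros z Hz. symmetry. apply is_derive_unique, HD; auto. }
  assert (Hx : Rabs (x - x) < d) by (rewrite Rminus_diag, Rabs_R0; auto).
  assert (Hy : Rabs (y - y) < d) by (rewrite Rminus_diag, Rabs_R0; auto).
  rewrite <- (is_derive_unique _ _ _ (E1 x y Hx Hy)), <- (is_derive_unique _ _ _ (E2 x y Hx Hy)).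
  symmetry. apply Schwarz.
  - exists (mkposreal d Hd). simpl. intros u v Hu Hv.
    destruct (HD u v Hu Hv) as [A1 [A2 [A3 A4]]].
    repeat split; eexists; eauto.
  - apply (continuity_2d_pt_ext_loc f21); auto.
    exists (mkposreal d Hd). simpl. intros u v Hu Hv.
    symmetry. apply is_derive_unique; auto.
  - apply (continuity_2d_pt_ext_loc f12); auto.
    exists (mkposreal d Hd). simpl. intros u v Hu Hv.
    symmetry. apply is_derive_unique; auto.
Qed.

Definition pol (f : R -> R -> R) (r t : R) : R := f (r * cos t) (r * sin t).

Lemma n2_pol r t : n2 (r * cos t) (r * sin t) = r ^ 2.
Proof. unfold n2. pose proof (sin2_cos2 t) as H. unfold Rsqr in H. nra. Qed.

Lemma pol_ann a b r t : 0 < a -> a < r < b -> ann a b (r * cos t) (r * sin t).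
Proof. intros. unfold ann. rewrite n2_pol. nra. Qed.

Lemma pol_cann a b r t : 0 < a -> a <= r <= b -> cann a b (r * cos t) (r * sin t).
Proof. intros. unfold cann. rewrite n2_pol. nra. Qed.

Lemma polar_exists x y : exists t, x = sqrt (n2 x y) * cos t /\ y = sqrt (n2 x y) * sin t.
Proof.
  set (r := sqrt (n2 x y)).
  assert (Hn : 0 <= n2 x y) by (unfold n2; nra).
  assert (Hr : 0 <= r) by apply sqrt_pos.
  assert (Hrr : r * r = n2 x y) by (apply sqrt_sqrt; auto).
  destruct (Req_dec r 0) as [H0|H0].
  { exists 0. rewrite H0 in *. unfold n2 in Hrr. split; nra. }
  assert (Hx : -1 <= x / r <= 1).
  { assert (Rabs x <= r) by (apply pow2_le_abs; auto; unfold n2 in Hrr; nra).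
    apply Rabs_le_between in H.
    split; apply Rmult_le_reg_r with r; try lra; unfold Rdiv; rewrite Rmult_assoc, Rinv_l; lra. }
  assert (Hs : r * sin (acos (x / r)) = Rabs y).
  { rewrite sin_acos by auto. apply Rsqr_inj; [|apply Rabs_pos|].
    - apply Rmult_le_pos; auto. apply sqrt_pos.
    - rewrite Rsqr_mult, Rsqr_sqrt, <- Rsqr_abs.
      + unfold Rsqr. field_simplify; auto. unfold n2 in Hrr. lra.
      + unfold Rsqr. nra. }
  destruct (Rle_lt_dec 0 y) as [Hy|Hy].
  - exists (acos (x / r)). rewrite cos_acos, Hs, Rabs_pos_eq by auto. split; auto. field; auto.
  - exists (- acos (x / r)). rewrite cos_neg, sin_neg, cos_acos by auto.
    split; [field; auto|]. replace (r * - sin (acos (x / r))) with (- (r * sin (acos (x / r)))) by ring.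
    rewrite Hs, Rabs_left; lra.
Qed.

Lemma ann_polar a b x y : 0 < a < b -> ann a b x y ->
  exists r t, a < r < b /\ x = r * cos t /\ y = r * sin t.
Proof.
  intros Hab [H1 H2]. destruct (polar_exists x y) as [t [Hx Hy]].
  exists (sqrt (n2 x y)), t. split; auto.
  rewrite <- (sqrt_pow2 a), <- (sqrt_pow2 b) at 1 by lra.
  split; apply sqrt_lt_1; nra.
Qed.

Lemma cann_polar a b x y : 0 < a < b -> cann a b x y ->
  exists r t, a <= r <= b /\ x = r * cos t /\ y = r * sin t.
Proof.
  intros Hab [H1 H2]. destruct (polar_exists x y) as [t [Hx Hy]].
  exists (sqrt (n2 x y)), t. split; auto.
  rewrite <- (sqrt_pow2 a), <- (sqrt_pow2 b) at 1 by lra.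
  split; apply sqrt_le_1; nra.
Qed.

(* The branch of the polar angle that is continuous near the ray of angle [t0]. *)
Definition angle (t0 x y : R) : R :=
  t0 + atan ((y * cos t0 - x * sin t0) / (x * cos t0 + y * sin t0)).

Lemma angle_spec t0 x y : 0 < x * cos t0 + y * sin t0 ->
  x = sqrt (n2 x y) * cos (angle t0 x y) /\ y = sqrt (n2 x y) * sin (angle t0 x y).
Proof.
  (* [P] and [Q] are the coordinates of the point in the frame turned by [t0], so [atan (Q / P)] is
     its angle in that frame. *)
  intros HP. set (P := x * cos t0 + y * sin t0) in *. set (Q := y * cos t0 - x * sin t0).
  pose proof (sin2_cos2 t0) as Hsc. unfold Rsqr in Hsc.
  assert (HPQ : n2 x y = P ^ 2 + Q ^ 2).
  { unfold n2, P, Q.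
    replace ((x * cos t0 + y * sin t0) ^ 2 + (y * cos t0 - x * sin t0) ^ 2)
      with ((x ^ 2 + y ^ 2) * (sin t0 * sin t0 + cos t0 * cos t0)) by ring.
    rewrite Hsc; ring. }
  set (r := sqrt (n2 x y)).
  assert (Hn : 0 < n2 x y) by nra.
  assert (Hr : 0 < r) by (apply sqrt_lt_R0; auto).
  assert (Hs : sqrt (1 + (Q / P)²) = r / P).
  { replace (1 + (Q / P)²) with (n2 x y / (P * P)) by (rewrite HPQ; unfold Rsqr; field; lra).
    rewrite sqrt_div_alt by nra. rewrite sqrt_square by lra. reflexivity. }
  assert (Hc : r * cos (atan (Q / P)) = P) by (rewrite cos_atan, Hs; field; lra).
  assert (Hsn : r * sin (atan (Q / P)) = Q) by (rewrite sin_atan, Hs; field; lra).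
  unfold angle. fold P Q. rewrite cos_plus, sin_plus. split.
  - replace (r * (cos t0 * cos (atan (Q / P)) - sin t0 * sin (atan (Q / P))))
      with (cos t0 * (r * cos (atan (Q / P))) - sin t0 * (r * sin (atan (Q / P)))) by ring.
    rewrite Hc, Hsn. unfold P, Q.
    transitivity (x * (sin t0 * sin t0 + cos t0 * cos t0)); [rewrite Hsc; ring|ring].
  - replace (r * (sin t0 * cos (atan (Q / P)) + cos t0 * sin (atan (Q / P))))
      with (sin t0 * (r * cos (atan (Q / P))) + cos t0 * (r * sin (atan (Q / P)))) by ring.
    rewrite Hc, Hsn. unfold P, Q.
    transitivity (y * (sin t0 * sin t0 + cos t0 * cos t0)); [rewrite Hsc; ring|ring].
Qed.

Lemma polar_pairing r t : r * cos t * cos t + r * sin t * sin t = r.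
Proof.
  pose proof (sin2_cos2 t) as H. unfold Rsqr in H.
  transitivity (r * (sin t * sin t + cos t * cos t)); [ring|rewrite H; ring].
Qed.

Lemma angle_pol r t : angle t (r * cos t) (r * sin t) = t.
Proof.
  unfold angle. replace (r * sin t * cos t - r * cos t * sin t) with 0 by ring.
  unfold Rdiv. rewrite Rmult_0_l, atan_0. ring.
Qed.

Lemma linear_form_cont c s x y : continuity_2d_pt (fun u v => u * c + v * s) x y.
Proof.
  apply continuity_2d_pt_plus; apply continuity_2d_pt_mult;
  first [apply continuity_2d_pt_id1|apply continuity_2d_pt_id2|apply continuity_2d_pt_const].
Qed.

(** Continuity of a local inverse of polar coordinates; it carries continuity from the closed strip
    back to the closed annulus. *)
Lemma local_polar r t e : 0 < r -> 0 < e ->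
  exists d, 0 < d /\ forall x y, Rabs (x - r * cos t) < d -> Rabs (y - r * sin t) < d ->
    exists r' t', 0 < r' /\ Rabs (r' - r) < e /\ Rabs (t' - t) < e /\
      x = r' * cos t' /\ y = r' * sin t'.
Proof.
  intros Hr He. set (x0 := r * cos t). set (y0 := r * sin t).
  assert (Hpos : 0 < x0 * cos t + y0 * sin t) by (unfold x0, y0; rewrite polar_pairing; auto).
  destruct (continuity_2d_gt (fun u v => u * cos t + v * sin t) x0 y0 0) as [d1 [Hd1 D1]];
    [apply linear_form_cont|auto|].
  assert (C2 : continuity_2d_pt (fun u v => sqrt (n2 u v)) x0 y0).
  { apply (continuity_1d_2d_pt_comp sqrt); [|apply n2_cont].
    apply continuity_pt_sqrt. unfold n2; nra. }
  assert (C3 : continuity_2d_pt (angle t) x0 y0).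
  { unfold angle. apply continuity_2d_pt_plus; [apply continuity_2d_pt_const|].
    apply (continuity_1d_2d_pt_comp atan).
    - apply derivable_continuous_pt. eexists. apply derivable_pt_lim_atan.
    - apply continuity_2d_pt_mult.
      + apply continuity_2d_pt_minus; apply continuity_2d_pt_mult;
        first [apply continuity_2d_pt_id1|apply continuity_2d_pt_id2|apply continuity_2d_pt_const].
      + apply continuity_2d_pt_inv; [apply linear_form_cont|lra]. }
  destruct (C2 (mkposreal e He)) as [d2 D2]. destruct (C3 (mkposreal e He)) as [d3 D3].
  simpl in D2, D3.
  assert (E2 : sqrt (n2 x0 y0) = r) by (unfold x0, y0; rewrite n2_pol, sqrt_pow2; lra).
  assert (E3 : angle t x0 y0 = t) by apply angle_pol.
  rewrite E2 in D2. rewrite E3 in D3.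
  exists (Rmin d1 (Rmin d2 d3)).
  split; [repeat apply Rmin_glb_lt; auto; apply cond_pos|].
  pose proof (Rmin_l d1 (Rmin d2 d3)). pose proof (Rmin_r d1 (Rmin d2 d3)).
  pose proof (Rmin_l d2 d3). pose proof (Rmin_r d2 d3).
  intros x y Hx Hy.
  assert (HP := D1 x y ltac:(lra) ltac:(lra)). simpl in HP.
  destruct (angle_spec t x y HP) as [F1 F2].
  exists (sqrt (n2 x y)), (angle t x y). split; [|split; [apply D2; lra|split; [apply D3; lra|auto]]].
  apply sqrt_lt_R0. unfold n2.
  destruct (Req_dec x 0) as [->|]; destruct (Req_dec y 0) as [->|]; nra.
Qed.

Lemma pol_continuous r t : continuity_2d_pt (fun r t => r * cos t) r t /\
  continuity_2d_pt (fun r t => r * sin t) r t.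
Proof.
  split; apply continuity_2d_pt_mult;
  first [apply continuity_2d_pt_id1|apply continuity_2d_cos|apply continuity_2d_sin].
Qed.

Lemma pol_cont_in a b f : 0 < a < b -> (forall x y, cann a b x y -> cont_in (cann a b) f x y) ->
  forall r t, a <= r <= b -> cont_in (strip a b) (pol f) r t.
Proof.
  intros [Ha _] Hf r t Hr eps He.
  destruct (Hf _ _ (pol_cann a b r t Ha Hr) eps He) as [d [Hd HD]].
  destruct (pol_continuous r t) as [C1 C2].
  destruct (C1 (mkposreal d Hd)) as [d1 D1]. destruct (C2 (mkposreal d Hd)) as [d2 D2].
  simpl in D1, D2.
  exists (Rmin d1 d2). split; [apply Rmin_glb_lt; apply cond_pos|].
  pose proof (Rmin_l d1 d2). pose proof (Rmin_r d1 d2).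
  intros r' t' Hr' H1 H2. apply HD.
  - apply pol_cann; auto.
  - apply D1; lra.
  - apply D2; lra.
Qed.

Lemma cont_in_of_pol a b f x y : 0 < a < b ->
  (forall r t, a <= r <= b -> cont_in (strip a b) (pol f) r t) ->
  cann a b x y -> cont_in (cann a b) f x y.
Proof.
  intros Hab Hf HK eps He.
  destruct (cann_polar a b x y Hab HK) as [r [t [Hr [-> ->]]]].
  destruct (Hf r t Hr eps He) as [d [Hd HD]].
  destruct (local_polar r t d ltac:(lra) Hd) as [d' [Hd' HD']].
  exists d'; split; auto. intros x' y' HK' Hx Hy.
  destruct (HD' x' y' Hx Hy) as [r' [t' [Hr' [H1 [H2 [-> ->]]]]]].
  apply HD; auto. unfold strip. unfold cann in HK'. rewrite n2_pol in HK'. nra.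
Qed.

Lemma pol_differentiable a b f f1 f2 r t : 0 < a -> C1_ann a b f f1 f2 -> a < r < b ->
  differentiable_pt_lim (pol f) r t
    (pol f1 r t * cos t + pol f2 r t * sin t)
    (r * (- sin t * pol f1 r t + cos t * pol f2 r t)).
Proof.
  intros Ha Hf Hr.
  replace (r * (- sin t * pol f1 r t + cos t * pol f2 r t))
    with (pol f1 r t * (- r * sin t) + pol f2 r t * (r * cos t)) by ring.
  apply (differentiable_pt_lim_comp f (fun r t => r * cos t) (fun r t => r * sin t)).
  - exact (C1_ann_differentiable a b f f1 f2 _ _ Hf (pol_ann a b r t Ha Hr)).
  - refine (differentiable_of_partials (fun r t => r * cos t) (fun _ t => cos t) (fun r t => - r * sin t) r t _ _ _).
    + exists 1. split; [lra|]. intros. auto_derive; auto. ring.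
    + auto_derive; auto. ring.
    + apply continuity_2d_cos.
  - refine (differentiable_of_partials (fun r t => r * sin t) (fun _ t => sin t) (fun r t => r * cos t) r t _ _ _).
    + exists 1. split; [lra|]. intros. auto_derive; auto. ring.
    + auto_derive; auto. ring.
    + apply continuity_2d_sin.
Qed.

(** The derivative is given in the open strip only. On a wall the increment in [t] is the limit of
    increments on nearby lines, where the mean value theorem bounds the error by the oscillation of
    [Ft], continuous up to the wall. The Hessian at a stagnation point of a wall relies on this. *)
Lemma strip_tangential_derivative a b (F Ft : R -> R -> R) r t : a < b ->
  (forall r t, a <= r <= b -> cont_in (strip a b) F r t) ->
  (forall r t, a <= r <= b -> cont_in (strip a b) Ft r t) ->
  (forall r t, a < r < b -> is_derive (fun t => F r t) t (Ft r t)) ->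
  a <= r <= b -> is_derive (fun t => F r t) t (Ft r t).
Proof.
  intros Hab HF HFt Hd Hr. apply is_derive_Reals. intros eps He.
  destruct (HFt r t Hr (eps / 2) ltac:(lra)) as [d [Hd0 HD]].
  exists (mkposreal d Hd0). simpl. intros h Hh Hhd.
  assert (Hh0 : 0 < Rabs h) by (apply Rabs_pos_lt; auto).
  (* [s] is the sign of a radial direction that leads into the open strip. *)
  assert (Hint : exists c, 0 < c /\ exists s, forall l, 0 < l < c -> a < r + s * l < b /\ Rabs (s * l) <= l).
  { destruct (Rlt_le_dec r b) as [H|H].
    - exists (b - r). split; [lra|]. exists 1. intros l Hl. rewrite Rmult_1_l, Rabs_pos_eq; lra.
    - exists (b - a). split; [lra|]. exists (-1). intros l Hl.
      replace (-1 * l) with (- l) by ring. rewrite Rabs_Ropp, Rabs_pos_eq; lra. }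
  destruct Hint as [c [Hc [s Hs]]].
  assert (Habs : Rabs (F r (t + h) - F r t - Ft r t * h) <= eps / 2 * Rabs h).
  { apply Rnot_lt_le; intros Hlt.
    set (g := (Rabs (F r (t + h) - F r t - Ft r t * h) - eps / 2 * Rabs h) / 2).
    destruct (HF r t Hr g ltac:(unfold g; lra)) as [d1 [Hd1 D1]].
    destruct (HF r (t + h) Hr g ltac:(unfold g; lra)) as [d2 [Hd2 D2]].
    set (l := Rmin (Rmin d d1) (Rmin d2 c) / 2).
    assert (Hm : 0 < Rmin (Rmin d d1) (Rmin d2 c)) by (repeat apply Rmin_glb_lt; auto).
    pose proof (Rmin_l (Rmin d d1) (Rmin d2 c)). pose proof (Rmin_r (Rmin d d1) (Rmin d2 c)).
    pose proof (Rmin_l d d1). pose proof (Rmin_r d d1).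
    pose proof (Rmin_l d2 c). pose proof (Rmin_r d2 c).
    destruct (Hs l ltac:(unfold l; lra)) as [Hl1 Hl2].
    set (r' := r + s * l) in *.
    assert (Hrr : Rabs (r' - r) <= l) by (unfold r'; replace (r + s * l - r) with (s * l) by ring; auto).
    assert (Hz : forall z, Rabs (z - z) < d1 /\ Rabs (z - z) < d2)
      by (intros; rewrite Rminus_diag, Rabs_R0; auto).
    specialize (D1 r' t ltac:(unfold strip; lra) ltac:(unfold l in *; lra) (proj1 (Hz _))).
    specialize (D2 r' (t + h) ltac:(unfold strip; lra) ltac:(unfold l in *; lra) (proj2 (Hz _))).
    assert (Q : Rabs (F r' (t + h) - F r' t - Ft r t * h) <= eps / 2 * Rabs h).
    { replace (F r' (t + h) - F r' t - Ft r t * h)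
        with ((F r' (t + h) - Ft r t * (t + h)) - (F r' t - Ft r t * t)) by ring.
      replace (Rabs h) with (Rabs (t + h - t)) by (f_equal; ring).
      apply (slope_abs_bound (fun z => F r' z - Ft r t * z) (fun z => Ft r' z - Ft r t)).
      - apply derive_cont_seg with (fun z => Ft r' z - Ft r t). intros z Hz'.
        apply (is_derive_minus (V := R_NormedModule)); [apply Hd; auto|].
        auto_derive; auto. ring.
      - intros z Hz'.
        apply (is_derive_minus (V := R_NormedModule)); [apply Hd; auto|].
        auto_derive; auto. ring.
      - intros z Hz'. left. apply HD; [unfold strip; lra|unfold l in *; lra|].
        apply Rabs_lt_between in Hhd. apply Rabs_lt_between.
        revert Hz'. unfold Rmin, Rmax; repeat destruct Rle_dec; lra. }
    assert (Htri : Rabs (F r (t + h) - F r t - Ft r t * h) <=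
       Rabs (F r' (t + h) - F r' t - Ft r t * h) + (Rabs (F r' (t + h) - F r (t + h)) + Rabs (F r' t - F r t))).
    { unfold Rabs; repeat destruct Rcase_abs; lra. }
    unfold g in *. lra. }
  replace ((F r (t + h) - F r t) / h - Ft r t) with ((F r (t + h) - F r t - Ft r t * h) / h)
    by (field; auto).
  unfold Rdiv at 1. rewrite Rabs_mult, Rabs_inv.
  apply Rle_lt_trans with (eps / 2 * Rabs h * / Rabs h).
  - apply Rmult_le_compat_r; [left; apply Rinv_0_lt_compat; auto|auto].
  - field_simplify; lra.
Qed.

Lemma pol_tangential_derivative a b f f1 f2 r t : 0 < a < b -> C1_ann a b f f1 f2 -> a <= r <= b ->
  is_derive (fun t => pol f r t) t (r * (- sin t * pol f1 r t + cos t * pol f2 r t)).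
Proof.
  intros Hab Hf Hr.
  apply (strip_tangential_derivative a b (pol f)
    (fun r t => r * (- sin t * pol f1 r t + cos t * pol f2 r t)) r t); auto.
  - lra.
  - apply (pol_cont_in a b f Hab), Hf.
  - intros r' t' Hr'.
    assert (cont_in (strip a b) (pol f1) r' t') by (apply pol_cont_in; auto; apply Hf).
    assert (cont_in (strip a b) (pol f2) r' t') by (apply pol_cont_in; auto; apply Hf).
    contin.
  - intros r' t' Hr'. eapply differentiable_is_derive, pol_differentiable; eauto; lra.
Qed.

Lemma pol_periodic f r t : pol f r (t + 2 * PI) = pol f r t.
Proof. unfold pol.
  replace (t + 2 * PI) with (t + 2 * INR 1 * PI) by (simpl; ring).
  rewrite cos_period, sin_period. reflexivity. Qed.

(** * Radial symmetry *)

Lemma derive_at_min (f : R -> R) (x l e : R) : 0 < e -> is_derive f x l ->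
  (forall t, Rabs (t - x) < e -> f x <= f t) -> l = 0.
Proof.
  intros He Hd Hmin. apply is_derive_Reals in Hd.
  assert (pr : derivable_pt f x) by (exists l; exact Hd).
  rewrite <- (derive_pt_eq_0 f x l pr Hd).
  apply (deriv_minimum f (x - e) (x + e)); try lra.
  intros t H1 H2. apply Hmin. apply Rabs_lt_between; lra.
Qed.

Lemma cann_box a b x y : 0 < b -> cann a b x y -> - b <= x <= b /\ - b <= y <= b.
Proof.
  intros Hb [_ H]. unfold n2 in H. pose proof (pow2_ge_0 x). pose proof (pow2_ge_0 y).
  assert (A1 : Rabs x <= b) by (apply pow2_le_abs; lra).
  assert (A2 : Rabs y <= b) by (apply pow2_le_abs; lra).
  apply Rabs_le_between in A1, A2. lra.
Qed.

Lemma cann_closed a b x y : ~ cann a b x y -> exists e, 0 < e /\ forall x' y',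
  Rabs (x' - x) < e -> Rabs (y' - y) < e -> ~ cann a b x' y'.
Proof.
  intros H. unfold cann in *.
  destruct (Rlt_le_dec (n2 x y) (a ^ 2)) as [H1|H1].
  - destruct (continuity_2d_lt _ _ _ _ (n2_cont x y) H1) as [d [Hd HD]].
    exists d; split; auto. intros x' y' Hx Hy. specialize (HD x' y' Hx Hy). lra.
  - destruct (Rlt_le_dec (b ^ 2) (n2 x y)) as [H2|H2]; [|tauto].
    destruct (continuity_2d_gt _ _ _ _ (n2_cont x y) H2) as [d [Hd HD]].
    exists d; split; auto. intros x' y' Hx Hy. specialize (HD x' y' Hx Hy). lra.
Qed.

(** Without critical points inside, the minimum over the closed annulus is reached on the walls
    only. Applied to a function and to its opposite, this confines the interior values strictly
    between those of the walls. *)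
Lemma lower_value_on_wall a b f f1 f2 x y : 0 < a < b -> C1_ann a b f f1 f2 ->
  (forall x y, ann a b x y -> f1 x y <> 0 \/ f2 x y <> 0) -> ann a b x y ->
  exists x' y', (n2 x' y' = a ^ 2 \/ n2 x' y' = b ^ 2) /\ f x' y' < f x y.
Proof.
  intros Hab [Hc Hd] Hcrit HA.
  destruct (compact_min (cann a b) f (- b) b (- b) b) as [x0 [y0 [HK Hmin]]].
  - intros; apply (cann_box a); auto; lra.
  - apply cann_closed.
  - exists x, y. apply ann_cann; auto.
  - intros; apply Hc; auto.
  - assert (Hno : forall x y, ann a b x y -> f x y <> f x0 y0).
    { intros x1 y1 H1 E. destruct (ann_open a b x1 y1 H1) as [d [Hd0 HD]].
      assert (Hz : forall z, Rabs (z - z) < d) by (intros; rewrite Rminus_diag, Rabs_R0; auto).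
      destruct (Hd x1 y1 H1) as [D1 D2].
      apply (derive_at_min (fun t => f t y1) x1 _ d) in D1; auto.
      apply (derive_at_min (fun t => f x1 t) y1 _ d) in D2; auto.
      - destruct (Hcrit x1 y1 H1); auto.
      - intros t Ht. rewrite E. apply Hmin, ann_cann, HD; auto.
      - intros t Ht. rewrite E. apply Hmin, ann_cann, HD; auto. }
    exists x0, y0. split.
    + destruct (Req_dec (n2 x0 y0) (a ^ 2)); auto.
      destruct (Req_dec (n2 x0 y0) (b ^ 2)); auto.
      exfalso. apply (Hno x0 y0); auto. unfold ann, cann in *; lra.
    + specialize (Hmin x y (ann_cann _ _ _ _ HA)). specialize (Hno x y HA). lra.
Qed.

Lemma C1_ann_lin a b al be f f1 f2 g g1 g2 : C1_ann a b f f1 f2 -> C1_ann a b g g1 g2 ->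
  C1_ann a b (fun x y => al * f x y + be * g x y) (fun x y => al * f1 x y + be * g1 x y)
    (fun x y => al * f2 x y + be * g2 x y).
Proof.
  intros [Cf Df] [Cg Dg]. split.
  - intros x y H. destruct (Cf x y H) as [F1 [F2 F3]]. destruct (Cg x y H) as [G1 [G2 G3]].
    split; [|split]; contin.
  - intros x y H. destruct (Df x y H) as [F1 F2]. destruct (Dg x y H) as [G1 G2].
    split; apply (is_derive_plus (V := R_NormedModule));
      apply is_derive_scal; auto.
Qed.

(** The reflection argument is written for vertical lines; for the rotated function it becomes the
    one for lines normal to [(cos al, sin al)]. *)
Definition rot (al : R) (f : R -> R -> R) (x y : R) : R :=
  f (x * cos al - y * sin al) (x * sin al + y * cos al).

Lemma n2_rot al x y : n2 (x * cos al - y * sin al) (x * sin al + y * cos al) = n2 x y.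
Proof.
  unfold n2. pose proof (sin2_cos2 al) as H. unfold Rsqr in H.
  transitivity ((x ^ 2 + y ^ 2) * (sin al * sin al + cos al * cos al)); [ring|rewrite H; ring].
Qed.

Lemma rot_close al x y x' y' d : 0 < d -> Rabs (x' - x) < d / 2 -> Rabs (y' - y) < d / 2 ->
  Rabs (x' * cos al - y' * sin al - (x * cos al - y * sin al)) < d /\
  Rabs (x' * sin al + y' * cos al - (x * sin al + y * cos al)) < d.
Proof.
  intros Hd Hx Hy.
  assert (Hc : Rabs (cos al) <= 1) by (apply Rabs_le, COS_bound).
  assert (Hs : Rabs (sin al) <= 1) by (apply Rabs_le, SIN_bound).
  assert (B : forall z k, Rabs z < d / 2 -> Rabs k <= 1 -> Rabs (z * k) < d / 2).
  { intros z k Hz Hk. rewrite Rabs_mult. pose proof (Rabs_pos z). pose proof (Rabs_pos k). nra. }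
  pose proof (B _ _ Hx Hc). pose proof (B _ _ Hx Hs).
  pose proof (B _ _ Hy Hc). pose proof (B _ _ Hy Hs).
  split; apply Rabs_lt_between;
  apply Rabs_lt_between in H, H0, H1, H2; lra.
Qed.

Lemma rot_cont_in a b al f x y : (forall x y, cann a b x y -> cont_in (cann a b) f x y) ->
  cann a b x y -> cont_in (cann a b) (rot al f) x y.
Proof.
  intros Hf HK eps He.
  assert (Hr : forall x y, cann a b x y -> cann a b (x * cos al - y * sin al) (x * sin al + y * cos al))
    by (intros; unfold cann; rewrite n2_rot; auto).
  destruct (Hf _ _ (Hr x y HK) eps He) as [d [Hd HD]].
  exists (d / 2). split; [lra|]. intros x' y' HK' Hx Hy.
  destruct (rot_close al x y x' y' d Hd Hx Hy). apply HD; auto.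
Qed.

Lemma C1_ann_rot a b al f f1 f2 : C1_ann a b f f1 f2 ->
  C1_ann a b (rot al f) (rot al (fun x y => cos al * f1 x y + sin al * f2 x y))
    (rot al (fun x y => - sin al * f1 x y + cos al * f2 x y)).
Proof.
  intros Hf. split.
  - intros x y HK. split; [|split]; apply rot_cont_in; auto; intros u v Huv;
    destruct (proj1 Hf u v Huv) as [F1 [F2 F3]]; contin.
  - intros x y HA.
    assert (HA' : ann a b (x * cos al - y * sin al) (x * sin al + y * cos al))
      by (unfold ann; rewrite n2_rot; auto).
    assert (HD := C1_ann_differentiable a b f f1 f2 _ _ Hf HA').
    unfold rot. split; apply is_derive_Reals.
    + replace (cos al * f1 (x * cos al - y * sin al) (x * sin al + y * cos al) +
        sin al * f2 (x * cos al - y * sin al) (x * sin al + y * cos al))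
      with (f1 (x * cos al - y * sin al) (x * sin al + y * cos al) * cos al +
        f2 (x * cos al - y * sin al) (x * sin al + y * cos al) * sin al) by ring.
      apply (derivable_pt_lim_comp_2d f (fun t => t * cos al - y * sin al)
        (fun t => t * sin al + y * cos al)); auto; apply is_derive_Reals; auto_derive; auto; ring.
    + replace (- sin al * f1 (x * cos al - y * sin al) (x * sin al + y * cos al) +
        cos al * f2 (x * cos al - y * sin al) (x * sin al + y * cos al))
      with (f1 (x * cos al - y * sin al) (x * sin al + y * cos al) * - sin al +
        f2 (x * cos al - y * sin al) (x * sin al + y * cos al) * cos al) by ring.
      apply (derivable_pt_lim_comp_2d f (fun t => x * cos al - t * sin al)
        (fun t => x * sin al + t * cos al)); auto; apply is_derive_Reals; auto_derive; auto; ring.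
Qed.

Lemma cont_in_flip a b f r t : (forall r t, a <= r <= b -> cont_in (strip a b) f r t) ->
  a <= r <= b -> cont_in (strip a b) (fun r t => f (a + b - r) t) r t.
Proof.
  intros Hf Hr eps He. destruct (Hf (a + b - r) t ltac:(lra) eps He) as [d [Hd HD]].
  exists d; split; auto. intros r' t' Hr' H1 H2. apply HD; auto.
  - unfold strip in *; lra.
  - replace (a + b - r' - (a + b - r)) with (- (r' - r)) by ring. rewrite Rabs_Ropp; auto.
Qed.

Lemma differentiable_flip c f r t l m : differentiable_pt_lim f (c - r) t l m ->
  differentiable_pt_lim (fun r t => f (c - r) t) r t (- l) m.
Proof.
  intros H eps. destruct (H eps) as [d Hd]. exists d. intros r' t' Hr Ht.
  specialize (Hd (c - r') t').
  replace (c - r' - (c - r)) with (- (r' - r)) in Hd by ring. rewrite Rabs_Ropp in Hd.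
  replace (- l * (r' - r)) with (l * - (r' - r)) by ring. auto.
Qed.

Lemma dist2_polar_bounds c t r x y : 0 <= r <= c ->
  dist2 (c * cos t) (c * sin t) x y <= r ^ 2 -> (c - r) ^ 2 <= n2 x y <= (c + r) ^ 2.
Proof.
  intros Hr Hd. set (s := sqrt (n2 x y)).
  assert (Hn : 0 <= n2 x y) by (unfold n2; nra).
  assert (Hs : 0 <= s) by apply sqrt_pos.
  assert (Hss : s * s = n2 x y) by (apply sqrt_sqrt; auto).
  pose proof (sin2_cos2 t) as Hsc. unfold Rsqr in Hsc.
  assert (Hcs : x * cos t + y * sin t <= s).
  { eapply Rle_trans; [apply Rle_abs|]. apply pow2_le_abs; auto.
    replace (s ^ 2) with (n2 x y * (sin t * sin t + cos t * cos t)) by (rewrite Hsc; lra).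
    unfold n2. assert (0 <= (x * sin t - y * cos t) ^ 2) by apply pow2_ge_0. lra. }
  assert (Hsr : (s - c) ^ 2 <= r ^ 2).
  { eapply Rle_trans; [|exact Hd]. unfold dist2.
    replace ((x - c * cos t) ^ 2 + (y - c * sin t) ^ 2)
      with (n2 x y - 2 * c * (x * cos t + y * sin t) + c ^ 2 * (sin t * sin t + cos t * cos t))
      by (unfold n2; ring).
    rewrite Hsc, <- Hss. nra. }
  apply pow2_le_abs in Hsr; [|lra]. apply Rabs_le_between in Hsr.
  rewrite <- Hss. split; nra.
Qed.

Lemma dist2_polar_strict c t r x y : 0 <= r <= c ->
  dist2 (c * cos t) (c * sin t) x y < r ^ 2 -> (c - r) ^ 2 < n2 x y < (c + r) ^ 2.
Proof.
  intros Hr Hd. set (d := sqrt (dist2 (c * cos t) (c * sin t) x y)).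
  assert (H0 := dist2_ge0 (c * cos t) (c * sin t) x y).
  assert (Hd0 : 0 <= d) by apply sqrt_pos.
  assert (Hdd : d * d = dist2 (c * cos t) (c * sin t) x y) by (apply sqrt_sqrt; auto).
  assert (d < r) by nra.
  destruct (dist2_polar_bounds c t d x y) as [H1 H2]; [lra|lra|].
  split; nra.
Qed.

(** The ball about the point with polar coordinates [c] and [t] may touch a wall at an end of its
    radial diameter. There the lower bound vanishes to first order only, which controls the radial
    derivative on the wall. *)
Lemma radial_hopf a b f f1 f2 f11 f22 M t c r : 0 < a < b -> 0 <= M ->
  (forall x y, cann a b x y -> cont_in (cann a b) f x y) ->
  (forall x y, ann a b x y -> is_derive (fun t => f t y) x (f1 x y) /\
     is_derive (fun t => f x t) y (f2 x y) /\ is_derive (fun t => f1 t y) x (f11 x y) /\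
     is_derive (fun t => f2 x t) y (f22 x y) /\ f11 x y + f22 x y <= M * f x y) ->
  (forall x y, cann a b x y -> 0 <= f x y) -> (forall x y, ann a b x y -> 0 < f x y) ->
  0 < r -> a <= c - r -> c + r <= b ->
  exists k, 0 < k /\ forall s, c - r <= s <= c + r -> k * (r ^ 2 - (s - c) ^ 2) <= pol f s t.
Proof.
  intros Hab HM Hc Hd Hnn Hpos Hr H1 H2.
  assert (B1 : forall x y, dist2 (c * cos t) (c * sin t) x y <= r ^ 2 -> cann a b x y).
  { intros x y H. apply dist2_polar_bounds in H; [|lra]. unfold cann. split; nra. }
  assert (B2 : forall x y, dist2 (c * cos t) (c * sin t) x y < r ^ 2 -> ann a b x y).
  { intros x y H. apply dist2_polar_strict in H; [|lra]. unfold ann. split; nra. }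
  destruct (ball_lower_bound f f1 f2 f11 f22 (c * cos t) (c * sin t) r M (r / 2)) as [k [Hk H]]; auto.
  - lra.
  - intros x y H. eapply cont_in_subset; [|apply Hc; auto]. auto.
  - intros x y H. apply Hpos, B2. nra.
  - exists k. split; auto. intros s Hs.
    assert (E : dist2 (c * cos t) (c * sin t) (s * cos t) (s * sin t) = (s - c) ^ 2).
    { unfold dist2. pose proof (sin2_cos2 t) as Hsc. unfold Rsqr in Hsc.
      transitivity ((s - c) ^ 2 * (sin t * sin t + cos t * cos t)); [ring|rewrite Hsc; ring]. }
    rewrite <- E. apply H. rewrite E. nra.
Qed.

Lemma interior_near a b r d : a < b -> a <= r <= b -> 0 < d -> exists r', a < r' < b /\ Rabs (r' - r) < d.
Proof.
  intros Hab Hr Hd. destruct (Rlt_le_dec r b) as [H|H].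
  - assert (0 < Rmin (d / 2) ((b - r) / 2)) by (apply Rmin_glb_lt; lra).
    pose proof (Rmin_l (d / 2) ((b - r) / 2)). pose proof (Rmin_r (d / 2) ((b - r) / 2)).
    exists (r + Rmin (d / 2) ((b - r) / 2)). split; [lra|]. apply Rabs_lt_between; lra.
  - assert (0 < Rmin (d / 2) ((b - a) / 2)) by (apply Rmin_glb_lt; lra).
    pose proof (Rmin_l (d / 2) ((b - a) / 2)). pose proof (Rmin_r (d / 2) ((b - a) / 2)).
    exists (r - Rmin (d / 2) ((b - a) / 2)). split; [lra|]. apply Rabs_lt_between; lra.
Qed.

Section Radial_symmetry.

Variables (a b ca cb : R) (u p q p1 p2 q1 q2 w1 w2 : R -> R -> R).
Let w x y := p1 x y + q2 x y.
Hypothesis hab : 0 < a < b.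
Hypothesis hu : C1_ann a b u p q.
Hypothesis hp : C1_ann a b p p1 p2.
Hypothesis hq : C1_ann a b q q1 q2.
Hypothesis hw : C1_ann a b w w1 w2.
Hypothesis hsym : forall x y, cann a b x y -> p2 x y = q1 x y.
Hypothesis htr : forall x y, ann a b x y -> w1 x y * q x y = w2 x y * p x y.
Hypothesis hca : forall x y, n2 x y = a ^ 2 -> u x y = ca.
Hypothesis hcb : forall x y, n2 x y = b ^ 2 -> u x y = cb.
Hypothesis htan : forall x y, n2 x y = a ^ 2 \/ n2 x y = b ^ 2 -> x * q x y = y * p x y.
Hypothesis hcrit : forall x y, ann a b x y -> p x y <> 0 \/ q x y <> 0.
Hypothesis hstag :
  ((forall x y, n2 x y = b ^ 2 -> p x y <> 0 \/ q x y <> 0) /\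
   (exists x y, n2 x y = a ^ 2 /\ (p x y <> 0 \/ q x y <> 0))) \/
  ((forall x y, n2 x y = a ^ 2 -> p x y <> 0 \/ q x y <> 0) /\
   (exists x y, n2 x y = b ^ 2 /\ (p x y <> 0 \/ q x y <> 0))).
Hypothesis hord : cb < ca.

Let U := pol u.
Let Ur r t := pol p r t * cos t + pol q r t * sin t.
Let Ut r t := r * (- sin t * pol p r t + cos t * pol q r t).

Lemma u_between x y : ann a b x y -> cb < u x y < ca.
Proof.
  intros HA. split.
  - destruct (lower_value_on_wall a b u p q x y hab hu hcrit HA) as [x' [y' [[H|H] Hlt]]].
    + rewrite (hca _ _ H) in Hlt; lra.
    + rewrite (hcb _ _ H) in Hlt; lra.
  - destruct (lower_value_on_wall a b (fun x y => - u x y) (fun x y => - p x y)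
      (fun x y => - q x y) x y hab) as [x' [y' [[H|H] Hlt]]]; auto.
    + apply C1_ann_opp; auto.
    + intros x' y' H. destruct (hcrit x' y' H); lra.
    + rewrite (hca _ _ H) in Hlt; lra.
    + rewrite (hcb _ _ H) in Hlt; lra.
Qed.

Lemma U_between r t : a < r < b -> cb < U r t < ca.
Proof. intros. apply u_between, pol_ann; lra. Qed.

Lemma U_a t : U a t = ca.
Proof. apply hca, n2_pol. Qed.

Lemma U_b t : U b t = cb.
Proof. apply hcb, n2_pol. Qed.

Lemma cont_p r t : a <= r <= b -> cont_in (strip a b) (pol p) r t.
Proof. apply (pol_cont_in a b _ hab). apply hp. Qed.

Lemma cont_q r t : a <= r <= b -> cont_in (strip a b) (pol q) r t.
Proof. apply (pol_cont_in a b _ hab). apply hq. Qed.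

Lemma cont_U r t : a <= r <= b -> cont_in (strip a b) U r t.
Proof. apply (pol_cont_in a b _ hab). apply hu. Qed.

Lemma cont_Ur r t : a <= r <= b -> cont_in (strip a b) Ur r t.
Proof.
  intros H. assert (H1 := cont_p r t H). assert (H2 := cont_q r t H). unfold Ur. contin.
Qed.

Lemma cont_Ut r t : a <= r <= b -> cont_in (strip a b) Ut r t.
Proof.
  intros H. assert (H1 := cont_p r t H). assert (H2 := cont_q r t H). unfold Ut. contin.
Qed.

Lemma diff_U r t : a < r < b -> differentiable_pt_lim U r t (Ur r t) (Ut r t).
Proof. apply (pol_differentiable a b); auto; lra. Qed.

Lemma gradient_of_polar r t : Ur r t = 0 -> Ut r t = 0 -> r <> 0 -> pol p r t = 0 /\ pol q r t = 0.
Proof.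
  unfold Ur, Ut. intros H1 H2 Hr. apply Rmult_integral in H2. destruct H2 as [|H2]; [contradiction|].
  pose proof (sin2_cos2 t) as H. unfold Rsqr in H.
  set (P := pol p r t) in *. set (Q := pol q r t) in *. set (c := cos t) in *. set (s := sin t) in *.
  split.
  - transitivity (P * (s * s + c * c)); [rewrite H; ring|].
    transitivity (c * (P * c + Q * s) - s * (- s * P + c * Q)); [ring|rewrite H1, H2; ring].
  - transitivity (Q * (s * s + c * c)); [rewrite H; ring|].
    transitivity (s * (P * c + Q * s) + c * (- s * P + c * Q)); [ring|rewrite H1, H2; ring].
Qed.

Lemma tangential_zero r t : r = a \/ r = b -> - sin t * pol p r t + cos t * pol q r t = 0.
Proof.
  intros Hr. assert (H := htan (r * cos t) (r * sin t)).
  rewrite n2_pol in H. specialize (H ltac:(destruct Hr; subst; auto)).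
  fold (pol p r t) in H. fold (pol q r t) in H.
  apply Rmult_eq_reg_l with r; [|destruct Hr; lra]. lra.
Qed.

Lemma gradient_on_wall r t : r = a \/ r = b ->
  pol p r t = Ur r t * cos t /\ pol q r t = Ur r t * sin t.
Proof.
  intros Hr. assert (H := tangential_zero r t Hr). unfold Ur.
  pose proof (sin2_cos2 t) as Hs. unfold Rsqr in Hs.
  set (P := pol p r t) in *. set (Q := pol q r t) in *. set (c := cos t) in *. set (s := sin t) in *.
  split.
  - transitivity (P * (s * s + c * c)); [rewrite Hs; ring|].
    transitivity ((P * c + Q * s) * c - s * (- s * P + c * Q)); [ring|rewrite H; ring].
  - transitivity (Q * (s * s + c * c)); [rewrite Hs; ring|].
    transitivity ((P * c + Q * s) * s + c * (- s * P + c * Q)); [ring|rewrite H; ring].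
Qed.

Lemma radial_MVT r1 r2 t : a <= r1 -> r1 < r2 -> r2 <= b ->
  exists c, r1 < c < r2 /\ U r2 t - U r1 t = Ur c t * (r2 - r1).
Proof.
  intros H1 H2 H3. apply (MVT_seg (fun r => U r t) (fun r => Ur r t)); auto.
  - apply (strip_cont_seg a b); auto. apply cont_U.
  - intros r Hr. apply (differentiable_is_derive U r t _ (Ut r t)), diff_U. lra.
Qed.

Lemma Ur_wall r t : r = a \/ r = b -> Ur r t <= 0.
Proof.
  intros Hr. apply Rnot_lt_le; intros Hpos.
  destruct (cont_Ur r t ltac:(destruct Hr; lra) (Ur r t) Hpos) as [d [Hd HD]].
  set (e := Rmin (d / 2) ((b - a) / 2)).
  assert (He : 0 < e) by (apply Rmin_glb_lt; lra).
  assert (He1 : e <= d / 2) by apply Rmin_l. assert (He2 : e <= (b - a) / 2) by apply Rmin_r.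
  assert (Ht : Rabs (t - t) < d) by (rewrite Rminus_diag, Rabs_R0; auto).
  destruct Hr as [-> | ->].
  - destruct (radial_MVT a (a + e) t) as [c [Hc E]]; try lra.
    rewrite U_a in E. destruct (U_between (a + e) t); [lra|].
    specialize (HD c t ltac:(unfold strip; lra) ltac:(apply Rabs_lt_between; lra) Ht).
    apply Rabs_lt_between in HD. nra.
  - destruct (radial_MVT (b - e) b t) as [c [Hc E]]; try lra.
    rewrite U_b in E. destruct (U_between (b - e) t); [lra|].
    specialize (HD c t ltac:(unfold strip; lra) ltac:(apply Rabs_lt_between; lra) Ht).
    apply Rabs_lt_between in HD. nra.
Qed.

Lemma Ur_wall_neg r t : r = a \/ r = b -> pol p r t <> 0 \/ pol q r t <> 0 -> Ur r t < 0.
Proof.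
  intros Hr Hne. destruct (Rle_lt_or_eq_dec _ _ (Ur_wall r t Hr)) as [|E]; auto. exfalso.
  destruct (gradient_on_wall r t Hr) as [E1 E2]. rewrite E in E1, E2. lra.
Qed.

Lemma polar_vorticity_lipschitz : exists M, 0 <= M /\ forall r t r' t', a < r < b -> a < r' < b ->
  Rabs (pol w r t - pol w r' t') <= M * Rabs (U r t - U r' t').
Proof.
  set (Wr := fun r t => pol w1 r t * cos t + pol w2 r t * sin t).
  set (Wt := fun r t => r * (- sin t * pol w1 r t + cos t * pol w2 r t)).
  assert (T0 : 0 < 2 * PI) by (pose proof PI_RGT_0; lra).
  assert (Hcs : forall t, cos (t + 2 * PI) = cos t /\ sin (t + 2 * PI) = sin t).
  { intros t. replace (t + 2 * PI) with (t + 2 * INR 1 * PI) by (simpl; ring).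
    rewrite cos_period, sin_period; auto. }
  assert (Cw1 : forall r t, a <= r <= b -> cont_in (strip a b) (pol w1) r t)
    by (apply (pol_cont_in a b _ hab); apply hw).
  assert (Cw2 : forall r t, a <= r <= b -> cont_in (strip a b) (pol w2) r t)
    by (apply (pol_cont_in a b _ hab); apply hw).
  assert (CWr : forall r t, a <= r <= b -> cont_in (strip a b) Wr r t).
  { intros r t H. specialize (Cw1 r t H). specialize (Cw2 r t H). unfold Wr. contin. }
  assert (CWt : forall r t, a <= r <= b -> cont_in (strip a b) Wt r t).
  { intros r t H. specialize (Cw1 r t H). specialize (Cw2 r t H). unfold Wt. contin. }
  assert (CW : forall r t, a <= r <= b -> cont_in (strip a b) (pol w) r t)
    by (apply (pol_cont_in a b _ hab); apply hw).
  assert (PWr : forall r t, Wr r (t + 2 * PI) = Wr r t).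
  { intros; unfold Wr. rewrite !pol_periodic. destruct (Hcs t) as [-> ->]; auto. }
  assert (PWt : forall r t, Wt r (t + 2 * PI) = Wt r t).
  { intros; unfold Wt. rewrite !pol_periodic. destruct (Hcs t) as [-> ->]; auto. }
  assert (PUr : forall r t, Ur r (t + 2 * PI) = Ur r t).
  { intros; unfold Ur. rewrite !pol_periodic. destruct (Hcs t) as [-> ->]; auto. }
  assert (PUt : forall r t, Ut r (t + 2 * PI) = Ut r t).
  { intros; unfold Ut. rewrite !pol_periodic. destruct (Hcs t) as [-> ->]; auto. }
  destruct (strip_bounded a b _ Wr T0 CWr PWr) as [B1 [HB1 HB1']].
  destruct (strip_bounded a b _ Wt T0 CWt PWt) as [B2 [HB2 HB2']].
  destruct (strip_bounded a b _ Ut T0 cont_Ut PUt) as [B3 [HB3 HB3']].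
  destruct (strip_bounded a b _ (pol w) T0 CW (pol_periodic w)) as [B4 [HB4 HB4']].
  assert (DW : forall r t, a < r < b -> differentiable_pt_lim (pol w) r t (Wr r t) (Wt r t))
    by (intros; apply (pol_differentiable a b); auto; lra).
  assert (Hpar : forall r t, a < r < b -> Wr r t * Ut r t = Wt r t * Ur r t).
  { intros r t Hr. assert (H := htr _ _ (pol_ann a b r t ltac:(lra) Hr)).
    fold (pol w1 r t) in H. fold (pol w2 r t) in H. fold (pol p r t) in H. fold (pol q r t) in H.
    unfold Wr, Ut, Wt, Ur.
    apply Rminus_diag_uniq.
    transitivity (r * (sin t * sin t + cos t * cos t) *
      (pol w1 r t * pol q r t - pol w2 r t * pol p r t)); [ring|rewrite H; ring]. }
  assert (BW : forall r t, a < r < b -> Rabs (Wr r t) <= B1 + B2 /\ Rabs (Wt r t) <= B1 + B2).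
  { intros r t Hr. specialize (HB1' r t ltac:(lra)). specialize (HB2' r t ltac:(lra)). lra. }
  assert (Hnc : forall r t, a < r < b -> Ur r t <> 0 \/ Ut r t <> 0).
  { intros r t Hr. destruct (Req_dec (Ur r t) 0) as [E1|]; auto.
    destruct (Req_dec (Ut r t) 0) as [E2|]; auto. exfalso.
    destruct (gradient_of_polar r t E1 E2 ltac:(lra)) as [F1 F2].
    destruct (hcrit _ _ (pol_ann a b r t ltac:(lra) Hr)); auto. }
  destruct hstag as [[Hw [x [y [Hn Hne]]]]|[Hw [x [y [Hn Hne]]]]].
  - apply (vorticity_lipschitz a b (2 * PI) cb ca (B1 + B2) B3 B4 U Ur Ut (pol w) Wr Wt);
      auto using cont_U, cont_Ur, cont_Ut, pol_periodic, diff_U, U_a, U_b, U_between; try lra.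
    + intros; apply pol_periodic.
    + intros; apply HB3'; lra.
    + intros; apply HB4'; lra.
    + intros t. apply Ur_wall_neg; auto. apply Hw, n2_pol.
    + destruct (polar_exists x y) as [t [Ex Ey]].
      rewrite Hn, sqrt_pow2 in Ex, Ey by lra.
      exists t. apply Ur_wall_neg; auto. unfold pol. rewrite <- Ex, <- Ey. auto.
  (* When the inner wall is the one free of stagnation points, the walls are exchanged by
     [r -> a + b - r] and the sign of [U] is changed, so that the free wall again carries the lowest
     value. *)
  - destruct (vorticity_lipschitz a b (2 * PI) (- ca) (- cb) (B1 + B2) B3 B4
      (fun r t => - U (a + b - r) t) (fun r t => Ur (a + b - r) t) (fun r t => - Ut (a + b - r) t)
      (fun r t => pol w (a + b - r) t) (fun r t => - Wr (a + b - r) t) (fun r t => Wt (a + b - r) t))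
      as [M [HM H]].
    + lra.
    + auto.
    + intros r t Hr. apply cont_in_opp, cont_in_flip; auto. apply cont_U.
    + intros r t Hr. apply cont_in_flip; auto. apply cont_Ur.
    + intros r t Hr. apply cont_in_opp, cont_in_flip; auto. apply cont_Ut.
    + intros. f_equal. apply pol_periodic.
    + auto.
    + intros. apply pol_periodic.
    + intros r t Hr.
      replace (Ur (a + b - r) t) with (- - Ur (a + b - r) t) by ring.
      apply differentiable_opp, differentiable_flip, diff_U. lra.
    + intros r t Hr. apply differentiable_flip, DW. lra.
    + intros r t Hr. specialize (Hpar (a + b - r) t ltac:(lra)). lra.
    + intros r t Hr. rewrite Rabs_Ropp. apply BW. lra.
    + intros r t Hr. rewrite Rabs_Ropp. apply HB3'. lra.
    + intros r t Hr. apply HB4'. lra.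
    + intros t. replace (a + b - a) with b by ring. rewrite U_b; auto.
    + intros t. replace (a + b - b) with a by ring. rewrite U_a; auto.
    + intros r t Hr. destruct (U_between (a + b - r) t); lra.
    + intros r t Hr. destruct (Hnc (a + b - r) t); auto; [lra|right; lra].
    + intros t. replace (a + b - b) with a by ring. apply Ur_wall_neg; auto. apply Hw, n2_pol.
    + destruct (polar_exists x y) as [t [Ex Ey]].
      rewrite Hn, sqrt_pow2 in Ex, Ey by lra.
      exists t. replace (a + b - a) with b by ring.
      apply Ur_wall_neg; auto. unfold pol. rewrite <- Ex, <- Ey. auto.
    + exists M. split; auto. intros r t r' t' Hr Hr'.
      specialize (H (a + b - r) t (a + b - r') t' ltac:(lra) ltac:(lra)). simpl in H.
      replace (a + b - (a + b - r)) with r in H by ring.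
      replace (a + b - (a + b - r')) with r' in H by ring.
      replace (- U r t - - U r' t') with (- (U r t - U r' t')) in H by ring.
      rewrite Rabs_Ropp in H. exact H.
Qed.

(** By continuity one of the two points may lie on a wall, so that the vorticity inside can be
    compared with its value at a stagnation point. *)
Lemma closed_vorticity_lipschitz : exists M, 0 <= M /\ forall x y r t, ann a b x y -> a <= r <= b ->
  Rabs (w x y - pol w r t) <= M * Rabs (u x y - U r t).
Proof.
  destruct polar_vorticity_lipschitz as [M [HM H]]. exists M. split; auto.
  intros x y r t HA Hr. destruct (ann_polar a b x y hab HA) as [s [z [Hs [-> ->]]]].
  fold (pol w s z). fold (pol u s z). fold U.
  apply Rnot_lt_le; intros Hlt.
  (* The excess divided by [2 * (1 + M)]: an error [g] in the vorticity and an error [M * g] through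
     [U] together stay below the excess. *)
  set (g := (Rabs (pol w s z - pol w r t) - M * Rabs (U s z - U r t)) / (2 * (1 + M))).
  assert (Hg : 0 < g) by (apply Rdiv_lt_0_compat; lra).
  assert (Eg : Rabs (pol w s z - pol w r t) = M * Rabs (U s z - U r t) + 2 * (1 + M) * g)
    by (unfold g; field; lra).
  destruct (pol_cont_in a b w hab (fun x y HK => proj1 (proj1 hw x y HK)) r t Hr g Hg) as [d1 [Hd1 D1]].
  destruct (cont_U r t Hr g Hg) as [d2 [Hd2 D2]].
  destruct (interior_near a b r (Rmin d1 d2) (proj2 hab) Hr) as [r' [Hr' Hrr]]; [apply Rmin_glb_lt; auto|].
  pose proof (Rmin_l d1 d2). pose proof (Rmin_r d1 d2).
  specialize (D1 r' t ltac:(unfold strip; lra) ltac:(lra) ltac:(rewrite Rminus_diag, Rabs_R0; auto)).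
  specialize (D2 r' t ltac:(unfold strip; lra) ltac:(lra) ltac:(rewrite Rminus_diag, Rabs_R0; auto)).
  specialize (H s z r' t Hs Hr').
  assert (T1 : Rabs (pol w s z - pol w r t) <=
    Rabs (pol w s z - pol w r' t) + Rabs (pol w r' t - pol w r t)).
  { replace (pol w s z - pol w r t) with ((pol w s z - pol w r' t) + (pol w r' t - pol w r t)) by ring.
    apply Rabs_triang. }
  assert (T2 : Rabs (U s z - U r' t) <= Rabs (U s z - U r t) + Rabs (U r' t - U r t)).
  { rewrite (Rabs_minus_sym (U r' t)).
    replace (U s z - U r' t) with ((U s z - U r t) + (U r t - U r' t)) by ring.
    apply Rabs_triang. }
  assert (M * Rabs (U s z - U r' t) <= M * (Rabs (U s z - U r t) + g))
    by (apply Rmult_le_compat_l; lra).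
  nra.
Qed.

Lemma u_closed x y : cann a b x y -> cb <= u x y <= ca.
Proof.
  intros HK. destruct (Req_dec (n2 x y) (a ^ 2)) as [E|E]; [rewrite (hca _ _ E); lra|].
  destruct (Req_dec (n2 x y) (b ^ 2)) as [E'|E']; [rewrite (hcb _ _ E'); lra|].
  destruct (u_between x y); [unfold ann, cann in *; lra|lra].
Qed.

(** If the vorticity at the wall point were at most 0, comparison with that point would give
    [Lap (u - cb) <= M (u - cb)] in the annulus, and the Hopf lemma would make the radial derivative
    negative at the point. *)
Lemma stagnation_outer t : Ur b t = 0 -> 0 < pol w b t.
Proof.
  intros H0. apply Rnot_le_lt; intros Hle.
  destruct closed_vorticity_lipschitz as [M [HM Hlip]].
  set (R0 := (b - a) / 2).
  destruct (radial_hopf a b (fun x y => u x y - cb) p q p1 q2 M t (b - R0) R0) as [k [Hk H]];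
    auto; unfold R0 in *; try lra.
  - intros x y HK. destruct (proj1 hu x y HK) as [C _]. contin.
  - intros x y HA. destruct (proj2 hu x y HA). destruct (proj2 hp x y HA).
    destruct (proj2 hq x y HA).
    split; [|split; [|split; [auto|split; [auto|]]]].
    + evar_last; [apply (is_derive_minus (V := R_NormedModule)); [eassumption|apply is_derive_const]|].
      unfold minus, plus, opp, zero; simpl; ring.
    + evar_last; [apply (is_derive_minus (V := R_NormedModule)); [eassumption|apply is_derive_const]|].
      unfold minus, plus, opp, zero; simpl; ring.
    + specialize (Hlip x y b t HA ltac:(lra)). rewrite U_b in Hlip.
      destruct (u_between x y HA). rewrite (Rabs_pos_eq (u x y - cb)) in Hlip by lra.
      apply Rabs_le_between in Hlip. unfold w in *. lra.
  - intros x y HK. destruct (u_closed x y HK). lra.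
  - intros x y HA. destruct (u_between x y HA). lra.
  (* The Hopf bound gives radial slopes of at most [- k * ((b - a) / 2)] at points arbitrarily close
     to the wall; continuity of [Ur] excludes the value 0 on it. *)
  - destruct (cont_Ur b t ltac:(lra) (k * ((b - a) / 2))) as [d [Hd HD]].
    { apply Rmult_lt_0_compat; lra. }
    set (e := Rmin (d / 2) ((b - a) / 2)).
    assert (He : 0 < e) by (apply Rmin_glb_lt; lra).
    assert (He1 : e <= d / 2) by apply Rmin_l. assert (He2 : e <= (b - a) / 2) by apply Rmin_r.
    destruct (radial_MVT (b - e) b t) as [c [Hc E]]; try lra.
    rewrite U_b in E.
    specialize (HD c t ltac:(unfold strip; lra) ltac:(apply Rabs_lt_between; lra)
      ltac:(rewrite Rminus_diag, Rabs_R0; auto)).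
    rewrite H0 in HD. apply Rabs_lt_between in HD.
    specialize (H (b - e) ltac:(lra)). unfold pol in H. fold (pol u (b - e) t) in H. fold U in H.
    replace (b - e - (b - (b - a) / 2)) with ((b - a) / 2 - e) in H by ring.
    assert (k * ((b - a) / 2 * e) <= k * (((b - a) / 2) ^ 2 - ((b - a) / 2 - e) ^ 2))
      by (apply Rmult_le_compat_l; nra).
    nra.
Qed.

(** The Hopf lemma is applied to [ca - u], which vanishes on this wall and whose Laplacian is minus
    the vorticity; hence the opposite sign. *)
Lemma stagnation_inner t : Ur a t = 0 -> pol w a t < 0.
Proof.
  intros H0. apply Rnot_le_lt; intros Hle.
  destruct closed_vorticity_lipschitz as [M [HM Hlip]].
  set (R0 := (b - a) / 2).
  destruct (radial_hopf a b (fun x y => ca - u x y) (fun x y => - p x y) (fun x y => - q x y)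
    (fun x y => - p1 x y) (fun x y => - q2 x y) M t (a + R0) R0) as [k [Hk H]];
    auto; unfold R0 in *; try lra.
  - intros x y HK. destruct (proj1 hu x y HK) as [C _]. contin.
  - intros x y HA. destruct (proj2 hu x y HA). destruct (proj2 hp x y HA).
    destruct (proj2 hq x y HA).
    split; [|split; [|split; [|split]]].
    + evar_last; [apply (is_derive_minus (V := R_NormedModule)); [apply is_derive_const|eassumption]|].
      unfold minus, plus, opp, zero; simpl; ring.
    + evar_last; [apply (is_derive_minus (V := R_NormedModule)); [apply is_derive_const|eassumption]|].
      unfold minus, plus, opp, zero; simpl; ring.
    + apply (is_derive_opp (V := R_NormedModule)); auto.
    + apply (is_derive_opp (V := R_NormedModule)); auto.
    + specialize (Hlip x y a t HA ltac:(lra)). rewrite U_a in Hlip.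
      destruct (u_between x y HA). rewrite (Rabs_minus_sym (u x y)), (Rabs_pos_eq (ca - u x y)) in Hlip by lra.
      apply Rabs_le_between in Hlip. unfold w in *. lra.
  - intros x y HK. destruct (u_closed x y HK). lra.
  - intros x y HA. destruct (u_between x y HA). lra.
  - destruct (cont_Ur a t ltac:(lra) (k * ((b - a) / 2))) as [d [Hd HD]].
    { apply Rmult_lt_0_compat; lra. }
    set (e := Rmin (d / 2) ((b - a) / 2)).
    assert (He : 0 < e) by (apply Rmin_glb_lt; lra).
    assert (He1 : e <= d / 2) by apply Rmin_l. assert (He2 : e <= (b - a) / 2) by apply Rmin_r.
    destruct (radial_MVT a (a + e) t) as [c [Hc E]]; try lra.
    rewrite U_a in E.
    specialize (HD c t ltac:(unfold strip; lra) ltac:(apply Rabs_lt_between; lra)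
      ltac:(rewrite Rminus_diag, Rabs_R0; auto)).
    rewrite H0 in HD. apply Rabs_lt_between in HD.
    specialize (H (a + e) ltac:(lra)). unfold pol in H. fold (pol u (a + e) t) in H. fold U in H.
    replace (a + e - (a + (b - a) / 2)) with (e - (b - a) / 2) in H by ring.
    assert (k * ((b - a) / 2 * e) <= k * (((b - a) / 2) ^ 2 - (e - (b - a) / 2) ^ 2))
      by (apply Rmult_le_compat_l; nra).
    nra.
Qed.

(* At a stagnation point of a wall, [Ur] is maximal along the wall and [Ut] vanishes
   on it, so the tangential derivative of the gradient vanishes; the Hessian is then
   [w (e_r (x) e_r)]. *)
Lemma stagnation_hessian r t al : r = a \/ r = b -> Ur r t = 0 ->
  cos al * (pol p1 r t * cos t + pol p2 r t * sin t) +
  sin al * (pol q1 r t * cos t + pol q2 r t * sin t) = cos (t - al) * pol w r t.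
Proof.
  intros Hr H0. assert (Hrb : a <= r <= b) by (destruct Hr; lra).
  destruct (gradient_on_wall r t Hr) as [Ep Eq]. rewrite H0, Rmult_0_l in Ep, Eq.
  assert (Dp := pol_tangential_derivative a b p p1 p2 r t hab hp Hrb).
  assert (Dq := pol_tangential_derivative a b q q1 q2 r t hab hq Hrb).
  set (dp := r * (- sin t * pol p1 r t + cos t * pol p2 r t)) in *.
  set (dq := r * (- sin t * pol q1 r t + cos t * pol q2 r t)) in *.
  assert (F1 : - sin t * dp + cos t * dq = 0).
  { assert (D : is_derive (fun t => - sin t * pol p r t + cos t * pol q r t) t
       (- sin t * dp + cos t * dq)).
    { evar_last.
      - apply (is_derive_plus (V := R_NormedModule)).
        + apply (is_derive_mult (fun t => - sin t) (fun t => pol p r t)); [|exact Dp|intros; apply Rmult_comm].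
          apply (is_derive_opp (V := R_NormedModule)), is_derive_sin.
        + apply (is_derive_mult cos (fun t => pol q r t)); [|exact Dq|intros; apply Rmult_comm].
          apply is_derive_cos.
      - unfold plus, mult, opp; simpl. rewrite Ep, Eq. ring. }
    assert (D' : is_derive (fun t => - sin t * pol p r t + cos t * pol q r t) t 0).
    { apply (is_derive_ext (fun _ => 0));
        [|exact (is_derive_const (V := R_NormedModule) 0 t)].
      intros z. symmetry. apply tangential_zero; auto. }
    rewrite <- (is_derive_unique _ _ _ D). apply is_derive_unique; auto. }
  assert (F2 : cos t * dp + sin t * dq = 0).
  { assert (D : is_derive (fun t => - Ur r t) t (- (cos t * dp + sin t * dq))).
    { apply (is_derive_opp (V := R_NormedModule)). unfold Ur. evar_last.
      - apply (is_derive_plus (V := R_NormedModule)).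
        + apply (is_derive_mult (fun t => pol p r t) cos); [exact Dp|apply is_derive_cos|intros; apply Rmult_comm].
        + apply (is_derive_mult (fun t => pol q r t) sin); [exact Dq|apply is_derive_sin|intros; apply Rmult_comm].
      - unfold plus, mult; simpl. rewrite Ep, Eq. ring. }
    apply (derive_at_min _ _ _ 1) in D; [lra|lra|].
    intros z _. assert (Hz := Ur_wall r z Hr). lra. }
  pose proof (sin2_cos2 t) as Hs. unfold Rsqr in Hs.
  assert (Hr0 : r <> 0) by (destruct Hr; lra).
  assert (Zp : dp = 0).
  { transitivity (dp * (sin t * sin t + cos t * cos t)); [rewrite Hs; ring|].
    transitivity (cos t * (cos t * dp + sin t * dq) - sin t * (- sin t * dp + cos t * dq));
      [ring|rewrite F1, F2; ring]. }
  assert (Zq : dq = 0).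
  { transitivity (dq * (sin t * sin t + cos t * cos t)); [rewrite Hs; ring|].
    transitivity (sin t * (cos t * dp + sin t * dq) + cos t * (- sin t * dp + cos t * dq));
      [ring|rewrite F1, F2; ring]. }
  unfold dp in Zp. unfold dq in Zq. clear dp dq Dp Dq F1 F2.
  apply Rmult_integral in Zp, Zq. destruct Zp as [|Zp]; [contradiction|].
  destruct Zq as [|Zq]; [contradiction|].
  assert (Hsy : pol p2 r t = pol q1 r t) by (apply hsym, pol_cann; lra).
  rewrite cos_minus. change (pol w r t) with (pol p1 r t + pol q2 r t).
  rewrite Hsy in *.
  set (A := pol p1 r t) in *. set (B := pol q1 r t) in *. set (C := pol q2 r t) in *.
  set (c := cos t) in *. set (s := sin t) in *.
  assert (G1 : A * c + B * s = c * (A + C)).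
  { assert (s * B = c * C) by lra. lra. }
  assert (G2 : B * c + C * s = s * (A + C)).
  { assert (s * A = c * B) by lra. lra. }
  rewrite G1, G2. ring.
Qed.

(** On a wall the derivative in the direction [al] equals [Ur * cos (t - al)], which is at most 0
    near [t0]. Away from stagnation points it is negative, and continuity suffices. At a stagnation
    point its radial derivative is [cos (t0 - al)] times the vorticity, negative on the inner wall
    and positive on the outer one: in both cases the directional derivative decreases on entering
    the annulus. *)
Lemma directional_derivative_wall r0 t0 al : r0 = a \/ r0 = b -> 0 < cos (t0 - al) ->
  exists e, 0 < e /\ forall r t, a < r < b -> Rabs (r - r0) < e -> Rabs (t - t0) < e ->
    cos al * pol p r t + sin al * pol q r t < 0.
Proof.
  intros Hr0 Hcos. assert (Hrb : a <= r0 <= b) by (destruct Hr0; lra).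
  set (pe := fun r t => cos al * pol p r t + sin al * pol q r t).
  assert (Cpe : forall r t, a <= r <= b -> cont_in (strip a b) pe r t).
  { intros r t Hr. assert (H1 := cont_p r t Hr). assert (H2 := cont_q r t Hr). unfold pe. contin. }
  assert (Epe : forall r t, r = a \/ r = b -> pe r t = Ur r t * cos (t - al)).
  { intros r t Hr. destruct (gradient_on_wall r t Hr) as [E1 E2].
    unfold pe. rewrite E1, E2, cos_minus. ring. }
  destruct (Rle_lt_or_eq_dec _ _ (Ur_wall r0 t0 Hr0)) as [Hneg|H0].
  - assert (Hpe : pe r0 t0 < 0) by (rewrite Epe by auto; nra).
    destruct (Cpe r0 t0 Hrb (- pe r0 t0) ltac:(lra)) as [d [Hd HD]].
    exists d; split; auto. intros r t Hr H1 H2.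
    specialize (HD r t ltac:(unfold strip; lra) H1 H2). fold (pe r t).
    apply Rabs_lt_between in HD. lra.
  - set (k := fun r t => cos al * (pol p1 r t * cos t + pol p2 r t * sin t) +
      sin al * (pol q1 r t * cos t + pol q2 r t * sin t)).
    assert (Ck : cont_in (strip a b) k r0 t0).
    { assert (cont_in (strip a b) (pol p1) r0 t0) by (apply (pol_cont_in a b _ hab); auto; apply hp).
      assert (cont_in (strip a b) (pol p2) r0 t0) by (apply (pol_cont_in a b _ hab); auto; apply hp).
      assert (cont_in (strip a b) (pol q1) r0 t0) by (apply (pol_cont_in a b _ hab); auto; apply hq).
      assert (cont_in (strip a b) (pol q2) r0 t0) by (apply (pol_cont_in a b _ hab); auto; apply hq).
      unfold k. contin. }
    assert (Ek : k r0 t0 = cos (t0 - al) * pol w r0 t0) by (apply stagnation_hessian; auto).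
    assert (Dk : forall r t, a < r < b -> is_derive (fun r => pe r t) r (k r t)).
    { intros r t Hr. unfold pe, k.
      destruct (differentiable_is_derive _ _ _ _ _
        (pol_differentiable a b p p1 p2 r t ltac:(lra) hp Hr)) as [D1 _].
      destruct (differentiable_is_derive _ _ _ _ _
        (pol_differentiable a b q q1 q2 r t ltac:(lra) hq Hr)) as [D2 _].
      apply (is_derive_plus (V := R_NormedModule)); apply is_derive_scal; assumption. }
    assert (Cc : forall t r1 r2, a <= r1 -> r2 <= b -> cont_seg r1 r2 (fun r => pe r t))
      by (intros; apply (strip_cont_seg a b); auto).
    assert (Hc : exists e, 0 < e /\ forall t, Rabs (t - t0) < e -> 0 < cos (t - al)).
    { destruct (continuity_2d_gt (fun _ t => cos (t - al)) 0 t0 0) as [e [He HE]]; auto.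
      - apply (continuity_1d_2d_pt_comp cos (fun _ t => t - al)); [apply continuity_cos|].
        apply continuity_2d_pt_minus; [apply continuity_2d_pt_id2|apply continuity_2d_pt_const].
      - exists e; split; auto. intros t Ht. apply (HE 0 t); auto.
        rewrite Rminus_diag, Rabs_R0; auto. }
    destruct Hc as [e1 [He1 Hc]].
    assert (Hk0 : k r0 t0 <> 0).
    { rewrite Ek. destruct Hr0 as [-> | ->].
      - assert (H := stagnation_inner t0 H0). nra.
      - assert (H := stagnation_outer t0 H0). nra. }
    destruct (Ck (Rabs (k r0 t0)) (Rabs_pos_lt _ Hk0)) as [d [Hd HD]].
    exists (Rmin d e1). split; [apply Rmin_glb_lt; auto|].
    pose proof (Rmin_l d e1). pose proof (Rmin_r d e1).
    intros r t Hr Hrr Htt. fold (pe r t).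
    specialize (Hc t ltac:(lra)).
    assert (Hwall : pe r0 t <= 0).
    { rewrite Epe by auto. assert (Hz := Ur_wall r0 t Hr0). nra. }
    destruct Hr0 as [-> | ->].
    + assert (Hsg := stagnation_inner t0 H0).
      assert (Hkn : k a t0 < 0) by (rewrite Ek; nra).
      rewrite Rabs_left in HD by auto.
      destruct (MVT_seg (fun r => pe r t) (fun r => k r t) a r) as [c [Hcc E]].
      * lra.
      * apply Cc; lra.
      * intros; apply Dk; lra.
      * apply Rabs_lt_between in Hrr.
        specialize (HD c t ltac:(unfold strip; lra) ltac:(apply Rabs_lt_between; lra) ltac:(lra)).
        apply Rabs_lt_between in HD. nra.
    + assert (Hsg := stagnation_outer t0 H0).
      assert (Hkn : 0 < k b t0) by (rewrite Ek; nra).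
      rewrite Rabs_pos_eq in HD by lra.
      destruct (MVT_seg (fun r => pe r t) (fun r => k r t) r b) as [c [Hcc E]].
      * lra.
      * apply Cc; lra.
      * intros; apply Dk; lra.
      * apply Rabs_lt_between in Hrr.
        specialize (HD c t ltac:(unfold strip; lra) ltac:(apply Rabs_lt_between; lra) ltac:(lra)).
        apply Rabs_lt_between in HD. nra.
Qed.

Lemma rotated_reflection al x y : ann a b x y -> 0 < x -> rot al u x y <= rot al u (- x) y.
Proof.
  intros HA Hx.
  set (P := fun x y => cos al * p x y + sin al * q x y).
  set (Q := fun x y => - sin al * p x y + cos al * q x y).
  assert (HP := C1_ann_lin a b (cos al) (sin al) _ _ _ _ _ _ hp hq). fold P in HP.
  assert (HQ := C1_ann_lin a b (- sin al) (cos al) _ _ _ _ _ _ hp hq). fold Q in HQ.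
  assert (HrU := C1_ann_rot a b al _ _ _ hu). fold P in HrU. fold Q in HrU.
  assert (HrP := C1_ann_rot a b al _ _ _ HP).
  assert (HrQ := C1_ann_rot a b al _ _ _ HQ).
  set (P1 := rot al (fun x y => cos al * (cos al * p1 x y + sin al * q1 x y) +
     sin al * (cos al * p2 x y + sin al * q2 x y))) in *.
  set (Q2 := rot al (fun x y => - sin al * (- sin al * p1 x y + cos al * q1 x y) +
     cos al * (- sin al * p2 x y + cos al * q2 x y))) in *.
  (* The Laplacian is invariant under rotations. *)
  assert (HW : forall x y, P1 x y + Q2 x y = rot al w x y).
  { intros x' y'. unfold P1, Q2, rot, w.
    pose proof (sin2_cos2 al) as Hs. unfold Rsqr in Hs.
    set (X := x' * cos al - y' * sin al). set (Y := x' * sin al + y' * cos al).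
    transitivity ((p1 X Y + q2 X Y) * (sin al * sin al + cos al * cos al));
      [ring|rewrite Hs; ring]. }
  assert (HR : forall x y, ann a b x y -> ann a b (x * cos al - y * sin al) (x * sin al + y * cos al))
    by (intros; unfold ann; rewrite n2_rot; auto).
  destruct polar_vorticity_lipschitz as [M [HM Hlip]].
  apply (moving_planes a b ca cb M (rot al u) (rot al P) (rot al Q) P1 Q2); auto.
  - apply HrU.
  - intros x' y' H. destruct (proj2 HrU x' y' H). destruct (proj2 HrP x' y' H).
    destruct (proj2 HrQ x' y' H). auto.
  - intros x' y' H. apply (cont_ann_interior a b); auto. apply HrU, ann_cann; auto.
  - intros x' y' H. apply hca. rewrite n2_rot; auto.
  - intros x' y' H. apply hcb. rewrite n2_rot; auto.
  - intros x' y' H. apply u_between, HR; auto.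
  - intros x1 y1 x2 y2 H1 H2. rewrite !HW. unfold rot.
    destruct (ann_polar a b _ _ hab (HR _ _ H1)) as [r1 [t1 [Hr1 [-> ->]]]].
    destruct (ann_polar a b _ _ hab (HR _ _ H2)) as [r2 [t2 [Hr2 [-> ->]]]].
    apply Hlip; auto.
  (* A wall point of angle [be] in the rotated frame has angle [be + al] in the original one, and
     [0 < z1] means [0 < cos be], the condition for a negative directional derivative. *)
  - intros z1 z2 Hz Hz1.
    destruct (polar_exists z1 z2) as [be [Ez1 Ez2]].
    set (r0 := sqrt (n2 z1 z2)) in *.
    assert (Hr0 : r0 = a \/ r0 = b).
    { unfold r0. destruct Hz as [-> | ->]; rewrite sqrt_pow2; lra. }
    assert (Hcb : 0 < cos (be + al - al)).
    { replace (be + al - al) with be by ring.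
      assert (0 < r0) by (destruct Hr0; lra). nra. }
    destruct (directional_derivative_wall r0 (be + al) al Hr0 Hcb) as [e [He HE]].
    destruct (local_polar r0 (be + al) e ltac:(destruct Hr0; lra) He) as [d [Hd HD]].
    assert (Eu : r0 * cos (be + al) = z1 * cos al - z2 * sin al)
      by (rewrite Ez1, Ez2, cos_plus; ring).
    assert (Ev : r0 * sin (be + al) = z1 * sin al + z2 * cos al)
      by (rewrite Ez1, Ez2, sin_plus; ring).
    exists (d / 2). split; [lra|]. intros x' y' H Hx' Hy'.
    destruct (rot_close al z1 z2 x' y' d Hd Hx' Hy') as [C1 C2].
    rewrite <- Eu in C1. rewrite <- Ev in C2.
    destruct (HD _ _ C1 C2) as [r [t [Hr [Hrr [Htt [E1 E2]]]]]].
    unfold rot, P. rewrite E1, E2. apply HE; auto.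
    assert (HA' := HR _ _ H). rewrite E1, E2 in HA'. unfold ann in HA'. rewrite n2_pol in HA'. nra.
Qed.

(* The reflection across the bisector of the angles [s] and [t] exchanges the two points. *)
Lemma ordered_radial r s t : a < r < b -> U r s = U r t.
Proof.
  assert (key : forall r s t, a < r < b -> U r s <= U r t).
  { clear r s t. intros r s t Hr.
    assert (pt : forall al, rot al u (r * cos (s - al)) (r * sin (s - al)) = U r s).
    { intros al. unfold rot, U, pol. f_equal.
      - replace (cos s) with (cos (s - al + al)) by (f_equal; ring). rewrite cos_plus; ring.
      - replace (sin s) with (sin (s - al + al)) by (f_equal; ring). rewrite sin_plus; ring. }
    assert (pt' : forall al, PI - (s - al) = t - al \/ - PI - (s - al) = t - al ->
       rot al u (- (r * cos (s - al))) (r * sin (s - al)) = U r t).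
    { intros al Hal.
      assert (C : cos (t - al) = - cos (s - al) /\ sin (t - al) = sin (s - al)).
      { destruct Hal as [<- | <-]; generalize (s - al); intros z.
        - rewrite cos_minus, sin_minus, cos_PI, sin_PI. split; ring.
        - rewrite cos_minus, sin_minus, cos_neg, sin_neg, cos_PI, sin_PI. split; ring. }
      destruct C as [C1 C2].
      replace (- (r * cos (s - al))) with (r * cos (t - al)) by (rewrite C1; ring).
      rewrite <- C2. unfold rot, U, pol. f_equal.
      - replace (cos t) with (cos (t - al + al)) by (f_equal; ring). rewrite cos_plus; ring.
      - replace (sin t) with (sin (t - al + al)) by (f_equal; ring). rewrite sin_plus; ring. }
    (* A quarter turn back from the bisector [(s + t) / 2]: the direction normal to the mirror.
       [al + PI] is the opposite direction, and the sign of [cos (s - al)] tells for which of the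
       two the first point lies in the half-plane [x > 0] of the reflection inequality. *)
    set (al := (s + t - PI) / 2).
    assert (E1 : PI - (s - al) = t - al) by (unfold al; field).
    assert (E2 : - PI - (s - (al + PI)) = t - (al + PI)) by (unfold al; field).
    destruct (Rtotal_order 0 (cos (s - al))) as [H|[H|H]].
    - rewrite <- (pt al), <- (pt' al) by auto. apply rotated_reflection.
      + apply pol_ann; lra.
      + apply Rmult_lt_0_compat; lra.
    - rewrite <- (pt al), <- (pt' al) by auto. rewrite <- H, Rmult_0_r, Ropp_0. lra.
    - rewrite <- (pt (al + PI)), <- (pt' (al + PI)) by auto. apply rotated_reflection.
      + apply pol_ann; lra.
      + apply Rmult_lt_0_compat; [lra|].
        replace (s - (al + PI)) with (s - al - PI) by ring.
        rewrite cos_minus, cos_PI, sin_PI. lra. }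
  intros Hr. apply Rle_antisym; auto.
Qed.

End Radial_symmetry.

(** Equal wall values are excluded, since an interior value would lie strictly above and strictly
    below them; the reversed order of the wall values is treated through [- u]. *)
Lemma radial_symmetry (a b ca cb : R) (u p q p1 p2 q1 q2 w1 w2 : R -> R -> R) :
  0 < a < b ->
  C1_ann a b u p q -> C1_ann a b p p1 p2 -> C1_ann a b q q1 q2 ->
  C1_ann a b (fun x y => p1 x y + q2 x y) w1 w2 ->
  (forall x y, cann a b x y -> p2 x y = q1 x y) ->
  (forall x y, ann a b x y -> w1 x y * q x y = w2 x y * p x y) ->
  (forall x y, n2 x y = a ^ 2 -> u x y = ca) ->
  (forall x y, n2 x y = b ^ 2 -> u x y = cb) ->
  (forall x y, n2 x y = a ^ 2 \/ n2 x y = b ^ 2 -> x * q x y = y * p x y) ->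
  (forall x y, ann a b x y -> p x y <> 0 \/ q x y <> 0) ->
  ((forall x y, n2 x y = b ^ 2 -> p x y <> 0 \/ q x y <> 0) /\
   (exists x y, n2 x y = a ^ 2 /\ (p x y <> 0 \/ q x y <> 0))) \/
  ((forall x y, n2 x y = a ^ 2 -> p x y <> 0 \/ q x y <> 0) /\
   (exists x y, n2 x y = b ^ 2 /\ (p x y <> 0 \/ q x y <> 0))) ->
  forall r s t, a < r < b -> pol u r s = pol u r t.
Proof.
  intros hab hu hp hq hw hsym htr hca hcb htan hcrit hstag r s t Hr.
  assert (nz : forall x y, p x y <> 0 \/ q x y <> 0 -> - p x y <> 0 \/ - q x y <> 0)
    by (intros; lra).
  destruct (Rtotal_order cb ca) as [H|[H|H]].
  - apply (ordered_radial a b ca cb u p q p1 p2 q1 q2 w1 w2); auto.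
  - exfalso.
    assert (HA : ann a b ((a + b) / 2 * cos 0) ((a + b) / 2 * sin 0)) by (apply pol_ann; lra).
    destruct (lower_value_on_wall a b u p q _ _ hab hu hcrit HA) as [x [y [H1 H2]]].
    destruct (lower_value_on_wall a b _ _ _ _ _ hab (C1_ann_opp _ _ _ _ _ hu)
      (fun x y HA => nz _ _ (hcrit x y HA)) HA) as [x' [y' [H1' H2']]].
    assert (E : u x y = ca) by (destruct H1 as [H1|H1]; [apply hca|rewrite hcb by auto]; auto).
    assert (E' : u x' y' = ca) by (destruct H1' as [H1'|H1']; [apply hca|rewrite hcb by auto]; auto).
    lra.
  - apply Ropp_eq_reg.
    apply (ordered_radial a b (- ca) (- cb) (fun x y => - u x y) (fun x y => - p x y)
      (fun x y => - q x y) (fun x y => - p1 x y) (fun x y => - p2 x y) (fun x y => - q1 x y)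
      (fun x y => - q2 x y) (fun x y => - w1 x y) (fun x y => - w2 x y)); auto using C1_ann_opp.
    + destruct (C1_ann_opp _ _ _ _ _ hw) as [C D]. split.
      * intros x y HK. destruct (C x y HK) as [C1 [C2 C3]]. split; [|auto].
        intros eps He. destruct (C1 eps He) as [d [Hd HD]]. exists d; split; auto.
        intros x' y' HK' Hx Hy. specialize (HD x' y' HK' Hx Hy).
        replace (- p1 x' y' + - q2 x' y' - (- p1 x y + - q2 x y)) with
          (- (p1 x' y' + q2 x' y') - - (p1 x y + q2 x y)) by ring. auto.
      * intros x y HA. destruct (D x y HA) as [D1 D2]. split.
        -- apply (is_derive_ext (fun t => - (p1 t y + q2 t y))); [intros; apply Ropp_plus_distr|auto].
        -- apply (is_derive_ext (fun t => - (p1 x t + q2 x t))); [intros; apply Ropp_plus_distr|auto].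
    + intros x y HK. rewrite hsym; auto.
    + intros x y HA. specialize (htr x y HA). lra.
    + intros x y E. rewrite (hca _ _ E); auto.
    + intros x y E. rewrite (hcb _ _ E); auto.
    + intros x y E. specialize (htan x y E). lra.
    + destruct hstag as [[A [x [y [B1 B2]]]]|[A [x [y [B1 B2]]]]]; [left|right];
      (split; [auto|exists x, y; auto]).
Qed.

(** * Stream function and vorticity *)

Lemma continuity_2d_slice (f : R -> R -> R) x y : continuity_2d_pt f x y ->
  continuous (fun t => f t y) x /\ continuous (fun t => f x t) y.
Proof.
  intros H. split; apply continuity_pt_filterlim; intros eps He;
  destruct (H (mkposreal eps He)) as [d Hd]; exists d; (split; [apply cond_pos|]);
  intros z [_ Hz]; simpl in *; unfold Rdist in *; apply Hd; auto;
  rewrite Rminus_diag, Rabs_R0; apply cond_pos.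
Qed.

Lemma clamp_continuity_2d a b f : a <= b ->
  (forall r t, a <= r <= b -> cont_in (strip a b) f r t) ->
  forall r t, continuity_2d_pt (fun r t => f (clamp a b r) t) r t.
Proof.
  intros Hab Hf r t eps.
  destruct (Hf (clamp a b r) t (clamp_in a b r Hab) eps (cond_pos eps)) as [d [Hd HD]].
  exists (mkposreal d Hd). simpl. intros r' t' Hr Ht. apply HD; auto.
  - apply clamp_in; auto.
  - eapply Rle_lt_trans; [apply clamp_lip; auto|auto].
Qed.

Lemma ex_RInt_slice (f : R -> R -> R) x al be : (forall x y, continuity_2d_pt f x y) ->
  ex_RInt (fun t => f x t) al be.
Proof.
  intros H. apply (ex_RInt_continuous (V := R_CompleteNormedModule)). intros z _.
  apply (continuity_2d_slice f); auto.
Qed.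

Lemma RInt_param_cont_seg (f : R -> R -> R) t0 t a b : t0 <= t ->
  (forall x y, continuity_2d_pt f x y) ->
  cont_seg a b (fun r => RInt (fun s => f r s) t0 t).
Proof.
  intros Ht Hf r Hr eps He.
  destruct (uniform_continuity_2d f a b t0 t (fun x y _ _ => Hf x y)
    (mkposreal (eps / (t - t0 + 1)) ltac:(apply Rdiv_lt_0_compat; lra))) as [d Hd].
  simpl in Hd.
  exists d. split; [apply cond_pos|]. intros r' Hr' Hrr.
  assert (E : RInt (fun s => f r' s) t0 t - RInt (fun s => f r s) t0 t =
    RInt (fun s => f r' s - f r s) t0 t).
  { symmetry. apply (RInt_minus (V := R_CompleteNormedModule)); apply ex_RInt_slice; auto. }
  rewrite E.
  apply Rle_lt_trans with ((t - t0) * (eps / (t - t0 + 1))).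
  - apply abs_RInt_le_const; auto.
    + apply (ex_RInt_minus (V := R_NormedModule)); apply ex_RInt_slice; auto.
    + intros s Hs. left. apply Hd; auto. rewrite Rminus_diag, Rabs_R0. apply cond_pos.
  - replace eps with ((t - t0 + 1) * (eps / (t - t0 + 1))) at 2 by (field; lra).
    apply Rmult_lt_compat_r; [apply Rdiv_lt_0_compat; lra|lra].
Qed.

Lemma is_derive_RInt_upper (f : R -> R) al x : (forall t, continuous f t) ->
  is_derive (fun x => RInt f al x) x (f x).
Proof.
  intros Hf. apply (is_derive_RInt f (fun x => RInt f al x) al x); auto.
  exists (mkposreal 1 Rlt_0_1). intros y _.
  apply (RInt_correct (V := R_CompleteNormedModule)).
  apply (ex_RInt_continuous (V := R_CompleteNormedModule)); auto.
Qed.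

Section Stream_function.

Variables (a b : R) (A1 A2 a1 a2 b1 b2 : R -> R -> R).
Hypothesis hab : 0 < a < b.
Hypothesis h1 : C1_ann a b A1 a1 a2.
Hypothesis h2 : C1_ann a b A2 b1 b2.
Hypothesis hdiv : forall x y, ann a b x y -> a1 x y + b2 x y = 0.
Hypothesis hwall : forall x y, n2 x y = a ^ 2 \/ n2 x y = b ^ 2 -> x * A1 x y + y * A2 x y = 0.

(** Polar derivatives of the stream function: [g] is the angular component of the flow, [h] is [- r]
    times the radial one, and [gt] is the common value of the derivatives of [g] in [t] and of [h]
    in [r]. As [U] integrates [g] along rays from the inner wall, its periodicity in the angle is
    immediate; what has to be proved is that its derivative in [t] is [h]. *)
Let g r t := - pol A1 r t * sin t + pol A2 r t * cos t.
Let h r t := r * (- sin t * pol A2 r t - cos t * pol A1 r t).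
Let gt r t := - sin t * (r * (- sin t * pol a1 r t + cos t * pol a2 r t)) - cos t * pol A1 r t
  + (cos t * (r * (- sin t * pol b1 r t + cos t * pol b2 r t)) - sin t * pol A2 r t).
Let U r t := RInt (fun s => g (clamp a b s) t) a r.

Lemma cont_g r t : a <= r <= b -> cont_in (strip a b) g r t.
Proof.
  intros H. assert (H1 := pol_cont_in a b A1 hab (fun x y K => proj1 (proj1 h1 x y K)) r t H).
  assert (H2 := pol_cont_in a b A2 hab (fun x y K => proj1 (proj1 h2 x y K)) r t H). unfold g. contin.
Qed.

Lemma cont_h r t : a <= r <= b -> cont_in (strip a b) h r t.
Proof.
  intros H. assert (H1 := pol_cont_in a b A1 hab (fun x y K => proj1 (proj1 h1 x y K)) r t H).
  assert (H2 := pol_cont_in a b A2 hab (fun x y K => proj1 (proj1 h2 x y K)) r t H). unfold h. contin.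
Qed.

Lemma cont_gt r t : a <= r <= b -> cont_in (strip a b) gt r t.
Proof.
  intros H. assert (H1 := pol_cont_in a b A1 hab (fun x y K => proj1 (proj1 h1 x y K)) r t H).
  assert (H2 := pol_cont_in a b A2 hab (fun x y K => proj1 (proj1 h2 x y K)) r t H).
  assert (H3 := pol_cont_in a b a1 hab (fun x y K => proj1 (proj2 (proj1 h1 x y K))) r t H).
  assert (H4 := pol_cont_in a b a2 hab (fun x y K => proj2 (proj2 (proj1 h1 x y K))) r t H).
  assert (H5 := pol_cont_in a b b1 hab (fun x y K => proj1 (proj2 (proj1 h2 x y K))) r t H).
  assert (H6 := pol_cont_in a b b2 hab (fun x y K => proj2 (proj2 (proj1 h2 x y K))) r t H).
  unfold gt. contin.
Qed.

Lemma h_wall r t : r = a \/ r = b -> h r t = 0.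
Proof.
  intros Hr. assert (H := hwall (r * cos t) (r * sin t)). rewrite n2_pol in H.
  specialize (H ltac:(destruct Hr; subst; auto)). unfold h, pol. lra.
Qed.

Lemma g_derive r t : a < r < b -> is_derive (fun t => g r t) t (gt r t).
Proof.
  intros Hr.
  destruct (differentiable_is_derive _ _ _ _ _
    (pol_differentiable a b A1 a1 a2 r t ltac:(lra) h1 Hr)) as [_ D1].
  destruct (differentiable_is_derive _ _ _ _ _
    (pol_differentiable a b A2 b1 b2 r t ltac:(lra) h2 Hr)) as [_ D2].
  unfold g, gt. evar_last.
  - apply (is_derive_plus (V := R_NormedModule)).
    + apply (is_derive_mult (fun t => - pol A1 r t) sin);
        [apply (is_derive_opp (V := R_NormedModule)); exact D1|apply is_derive_sin
        |intros; apply Rmult_comm].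
    + apply (is_derive_mult (fun t => pol A2 r t) cos);
        [exact D2|apply is_derive_cos|intros; apply Rmult_comm].
  - unfold plus, mult, opp; simpl. ring.
Qed.

(* Incompressibility in polar form: [d_r h = d_t g]. *)
Lemma h_derive r t : a < r < b -> is_derive (fun r => h r t) r (gt r t).
Proof.
  intros Hr.
  destruct (differentiable_is_derive _ _ _ _ _
    (pol_differentiable a b A1 a1 a2 r t ltac:(lra) h1 Hr)) as [D1 _].
  destruct (differentiable_is_derive _ _ _ _ _
    (pol_differentiable a b A2 b1 b2 r t ltac:(lra) h2 Hr)) as [D2 _].
  assert (Hd := hdiv _ _ (pol_ann a b r t ltac:(lra) Hr)).
  fold (pol a1 r t) in Hd. fold (pol b2 r t) in Hd.
  unfold h, gt. evar_last.
  - apply (is_derive_mult (fun r => r) (fun r => - sin t * pol A2 r t - cos t * pol A1 r t));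
      [apply (is_derive_id (K := R_AbsRing))| |intros; apply Rmult_comm].
    apply (is_derive_minus (V := R_NormedModule)); apply is_derive_scal; eassumption.
  - unfold minus, plus, mult, opp, one; simpl.
    apply Rminus_diag_uniq.
    transitivity (- r * (sin t * sin t + cos t * cos t) * (pol a1 r t + pol b2 r t));
      [ring|rewrite Hd; ring].
Qed.

Lemma U_derive_r r t : is_derive (fun r => U r t) r (g (clamp a b r) t).
Proof.
  apply (is_derive_RInt_upper (fun s => g (clamp a b s) t)). intros s.
  apply (continuity_2d_slice (fun r t => g (clamp a b r) t)), clamp_continuity_2d; [lra|].
  apply cont_g.
Qed.

(** The difference of the two sides vanishes on the inner wall, where [U] and [h] do, and its
    derivative in [r] is zero by incompressibility. Derivatives are taken in the open interval, and
    continuity covers the walls. *)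
Lemma U_increment r t0 t : a <= r <= b -> t0 <= t ->
  U r t = U r t0 + RInt (fun s => h (clamp a b r) s) t0 t.
Proof.
  intros Hr Ht.
  assert (Ch : forall r t, continuity_2d_pt (fun r t => h (clamp a b r) t) r t)
    by (apply clamp_continuity_2d; [lra|apply cont_h]).
  assert (Cg : forall r t, continuity_2d_pt (fun r t => gt (clamp a b r) t) r t)
    by (apply clamp_continuity_2d; [lra|apply cont_gt]).
  set (E := fun r => U r t - U r t0 - RInt (fun s => h (clamp a b r) s) t0 t).
  assert (Ea : E a = 0).
  { unfold E, U. rewrite !RInt_point.
    rewrite (RInt_ext _ (fun _ => 0)).
    - rewrite RInt_const. unfold scal, zero; simpl; unfold mult; simpl. ring.
    - intros s _. rewrite clamp_id by lra. apply h_wall; auto. }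
  assert (CE : cont_seg a b E).
  { assert (CU : forall t, cont_seg a b (fun r => U r t)).
    { intros z. apply derive_cont_seg with (fun r => g (clamp a b r) z).
      intros; apply U_derive_r. }
    assert (CR := RInt_param_cont_seg (fun r s => h (clamp a b r) s) t0 t a b Ht Ch).
    intros x Hx eps He.
    destruct (CU t x Hx (eps / 3) ltac:(lra)) as [d1 [Hd1 D1]].
    destruct (CU t0 x Hx (eps / 3) ltac:(lra)) as [d2 [Hd2 D2]].
    destruct (CR x Hx (eps / 3) ltac:(lra)) as [d3 [Hd3 D3]].
    exists (Rmin d1 (Rmin d2 d3)). split; [repeat apply Rmin_glb_lt; auto|].
    pose proof (Rmin_l d1 (Rmin d2 d3)). pose proof (Rmin_r d1 (Rmin d2 d3)).
    pose proof (Rmin_l d2 d3). pose proof (Rmin_r d2 d3).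
    intros x' Hx' Hxx. specialize (D1 x' Hx' ltac:(lra)). specialize (D2 x' Hx' ltac:(lra)).
    specialize (D3 x' Hx' ltac:(lra)). apply Rabs_lt_between in D1, D2, D3.
    unfold E. apply Rabs_lt_between. lra. }
  assert (DE : forall x, a < x < b -> is_derive E x 0).
  { intros x Hx.
    assert (Hm : 0 < Rmin (x - a) (b - x)) by (apply Rmin_glb_lt; lra).
    assert (near : forall y, Rabs (y - x) < Rmin (x - a) (b - x) -> a < y < b).
    { intros y Hy. pose proof (Rmin_l (x - a) (b - x)). pose proof (Rmin_r (x - a) (b - x)).
      apply Rabs_lt_between in Hy. lra. }
    assert (Dh : forall y s, a < y < b -> is_derive (fun z => h (clamp a b z) s) y (gt y s)).
    { intros y s Hy. apply (is_derive_ext_loc (fun z => h z s)); [|apply h_derive; auto].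
      apply (filter_imp (fun z => a < z < b)); [|apply locally_open_interval; auto].
      intros z Hz. rewrite clamp_id; lra. }
    assert (DR : is_derive (fun r => RInt (fun s => h (clamp a b r) s) t0 t) x
      (RInt (fun s => Derive (fun z => h (clamp a b z) s) x) t0 t)).
    { apply (is_derive_RInt_param (fun r s => h (clamp a b r) s) t0 t x).
      - apply (filter_imp (fun z => a < z < b)); [|apply locally_open_interval; auto].
        intros z Hz s _. eexists; apply Dh; auto.
      - intros s _. apply (continuity_2d_pt_ext_loc (fun r t => gt (clamp a b r) t)); auto.
        exists (mkposreal _ Hm). simpl. intros y z Hy _. symmetry.
        rewrite clamp_id by (assert (H := near y Hy); lra).
        apply is_derive_unique, Dh; auto.
      - exists (mkposreal 1 Rlt_0_1). intros y _.
        apply (ex_RInt_slice (fun r s => h (clamp a b r) s)); auto. }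
    assert (EI : RInt (fun s => Derive (fun z => h (clamp a b z) s) x) t0 t = g x t - g x t0).
    { rewrite (RInt_ext _ (fun s => gt x s)) by (intros; apply is_derive_unique, Dh; auto).
      apply (is_RInt_unique (V := R_CompleteNormedModule)).
      apply (is_RInt_derive (V := R_CompleteNormedModule) (fun s => g x s)).
      - intros; apply g_derive; auto.
      - intros s _. apply (continuous_ext (fun s => gt (clamp a b x) s)).
        + intros; rewrite clamp_id; lra.
        + apply (continuity_2d_slice (fun r s => gt (clamp a b r) s)); auto. }
    rewrite EI in DR. unfold E. evar_last.
    - apply (is_derive_minus (V := R_NormedModule)); [|exact DR].
      apply (is_derive_minus (V := R_NormedModule)); apply U_derive_r.
    - unfold minus, plus, opp; simpl. rewrite clamp_id by lra. ring. }
  assert (E0 : E r = 0).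
  { destruct (Req_dec r a) as [->|Hne]; [exact Ea|].
    destruct (MVT_seg E (fun _ => 0) a r) as [c [_ Hc]]; try lra.
    - intros z Hz eps He. destruct (CE z ltac:(lra) eps He) as [d [Hd HD]].
      exists d; split; auto. intros; apply HD; auto; lra.
    - intros; apply DE; lra. }
  unfold E in E0. lra.
Qed.

Lemma U_derive_t r t : a <= r <= b -> is_derive (fun t => U r t) t (h r t).
Proof.
  intros Hr.
  apply (is_derive_ext_loc (fun z => U r (t - 1) + RInt (fun s => h (clamp a b r) s) (t - 1) z)).
  - apply (filter_imp (fun z => t - 1 < z < t + 1)); [|apply locally_open_interval; lra].
    intros z Hz. symmetry. apply U_increment; auto. lra.
  - evar_last.
    + apply (is_derive_plus (V := R_NormedModule)); [apply is_derive_const|].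
      apply (is_derive_RInt_upper (fun s => h (clamp a b r) s)). intros s.
      apply (continuity_2d_slice (fun r s => h (clamp a b r) s)), clamp_continuity_2d; [lra|].
      apply cont_h.
    + rewrite clamp_id by lra. unfold plus, zero; simpl. ring.
Qed.

Lemma U_wall_const t : U b t = U b 0.
Proof.
  assert (H : forall s t, s < t -> U b t = U b s).
  { intros s z Hs. rewrite (U_increment b s z) by lra.
    rewrite (RInt_ext _ (fun _ => 0)).
    - rewrite RInt_const. unfold scal; simpl; unfold mult; simpl. ring.
    - intros y _. rewrite clamp_id by lra. apply h_wall; auto. }
  destruct (Rtotal_order t 0) as [Hlt|[->|Hgt]]; auto. symmetry; auto.
Qed.

Lemma U_cont r t : a <= r <= b -> cont_in (strip a b) U r t.
Proof.
  intros Hr eps He.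
  assert (T0 : 0 < 2 * PI) by (pose proof PI_RGT_0; lra).
  destruct (strip_bounded a b (2 * PI) g T0 cont_g) as [B [HB HB']].
  { intros r' t'. unfold g. rewrite !pol_periodic.
    replace (t' + 2 * PI) with (t' + 2 * INR 1 * PI) by (simpl; ring).
    rewrite cos_period, sin_period; auto. }
  destruct (derive_cont_seg (fun t => U r t) (fun t => h r t) (t - 1) (t + 1)
    (fun z _ => U_derive_t r z Hr) t ltac:(lra) (eps / 2) ltac:(lra)) as [d [Hd HD]].
  set (e := Rmin (Rmin d 1) (eps / (2 * (B + 1)))).
  assert (H0 : 0 < Rmin d 1) by (apply Rmin_glb_lt; lra).
  assert (H1 : 0 < eps / (2 * (B + 1))) by (apply Rdiv_lt_0_compat; lra).
  assert (H2 : e <= Rmin d 1) by apply Rmin_l.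
  assert (H3 : e <= eps / (2 * (B + 1))) by apply Rmin_r.
  pose proof (Rmin_l d 1). pose proof (Rmin_r d 1).
  exists e. split; [apply Rmin_glb_lt; auto|].
  intros r' t' Hr' Hrr Htt.
  assert (Htt' : Rabs (t' - t) < 1) by lra. apply Rabs_lt_between in Htt'.
  specialize (HD t' ltac:(lra) ltac:(lra)).
  assert (Q : Rabs (U r' t' - U r t') <= B * Rabs (r' - r)).
  { apply (slope_abs_bound (fun r => U r t') (fun r => g (clamp a b r) t')).
    - apply derive_cont_seg with (fun r => g (clamp a b r) t'). intros; apply U_derive_r.
    - intros; apply U_derive_r.
    - intros; apply HB', clamp_in; lra. }
  assert (B * Rabs (r' - r) <= B * (eps / (2 * (B + 1)))) by (apply Rmult_le_compat_l; lra).
  assert (B * (eps / (2 * (B + 1))) <= eps / 2).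
  { replace (eps / 2) with ((B + 1) * (eps / (2 * (B + 1)))) by (field; lra).
    apply Rmult_le_compat_r; lra. }
  replace (U r' t' - U r t) with ((U r' t' - U r t') + (U r t' - U r t)) by ring.
  eapply Rle_lt_trans; [apply Rabs_triang|]. lra.
Qed.

Lemma U_differentiable r t : a < r < b -> differentiable_pt_lim U r t (g r t) (h r t).
Proof.
  intros Hr. replace (g r t) with (g (clamp a b r) t) by (rewrite clamp_id; lra).
  refine (differentiable_of_partials U (fun r t => g (clamp a b r) t) h r t _ _ _).
  - exists 1. split; [lra|]. intros; apply U_derive_r.
  - apply U_derive_t; lra.
  - apply clamp_continuity_2d; [lra|apply cont_g].
Qed.

(* [U] as a function of the point: the direction [(cos t, sin t)] is the normalized point. *)
Let u x y := RInt (fun s =>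
  - A1 (clamp a b s * (x / sqrt (n2 x y))) (clamp a b s * (y / sqrt (n2 x y))) * (y / sqrt (n2 x y)) +
  A2 (clamp a b s * (x / sqrt (n2 x y))) (clamp a b s * (y / sqrt (n2 x y))) * (x / sqrt (n2 x y)))
  a (sqrt (n2 x y)).

Lemma u_pol r t : 0 < r -> pol u r t = U r t.
Proof.
  intros Hr. unfold pol, u, U. rewrite n2_pol, sqrt_pow2 by lra.
  replace (r * cos t / r) with (cos t) by (field; lra).
  replace (r * sin t / r) with (sin t) by (field; lra).
  reflexivity.
Qed.

(** Locally a branch of the angle expresses [u] through [U], so the chain rule gives its Cartesian
    derivatives. *)
Lemma u_near r0 t0 : 0 < r0 -> exists d, 0 < d /\ forall x y,
  Rabs (x - r0 * cos t0) < d -> Rabs (y - r0 * sin t0) < d ->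
  u x y = U (sqrt (n2 x y)) (angle t0 x y).
Proof.
  intros Hr.
  destruct (continuity_2d_gt (fun x y => x * cos t0 + y * sin t0) (r0 * cos t0) (r0 * sin t0) 0)
    as [d [Hd HD]]; [apply linear_form_cont|rewrite polar_pairing; auto|].
  exists d; split; auto. intros x y Hx Hy. specialize (HD x y Hx Hy). simpl in HD.
  destruct (angle_spec t0 x y HD) as [E1 E2].
  rewrite <- u_pol.
  - unfold pol. rewrite <- E1, <- E2. reflexivity.
  - apply sqrt_lt_R0. unfold n2.
    destruct (Req_dec x 0) as [->|]; destruct (Req_dec y 0) as [->|]; nra.
Qed.

Lemma stream_function_exists : exists (u : R -> R -> R) ca cb,
  C1_ann a b u A2 (fun x y => - A1 x y) /\
  (forall x y, n2 x y = a ^ 2 -> u x y = ca) /\ (forall x y, n2 x y = b ^ 2 -> u x y = cb) /\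
  (forall r t, a < r < b -> is_derive (fun r => pol u r t) r (g r t)) /\
  (forall r t, a < r < b -> is_derive (fun t => pol u r t) t (h r t)).
Proof.
  exists u, 0, (U b 0). split; [split|split; [|split; [|split]]].
  - intros x y HK. split; [|split; [apply h2; auto|apply cont_in_opp, h1; auto]].
    apply cont_in_of_pol; auto. intros r t Hr eps He.
    destruct (U_cont r t Hr eps He) as [d [Hd HD]]. exists d; split; auto.
    intros r' t' Hr' H1 H2. unfold strip in Hr'. rewrite !u_pol by lra. apply HD; auto.
  - intros x y HA. destruct (ann_polar a b x y hab HA) as [r [t [Hr [-> ->]]]].
    fold (pol A2 r t). fold (pol A1 r t).
    destruct (u_near r t ltac:(lra)) as [d [Hd HD]].
    assert (Es : sqrt (n2 (r * cos t) (r * sin t)) = r) by (rewrite n2_pol, sqrt_pow2; lra).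
    assert (Ean := angle_pol r t).
    assert (D : differentiable_pt_lim U (sqrt (n2 (r * cos t) (r * sin t)))
      (angle t (r * cos t) (r * sin t)) (g r t) (h r t))
      by (rewrite Es, Ean; apply U_differentiable; auto).
    pose proof (sin2_cos2 t) as Hs. unfold Rsqr in Hs.
    assert (Hn : n2 (r * cos t) (r * sin t) = r ^ 2) by apply n2_pol.
    assert (HP := polar_pairing r t).
    assert (Z : r * sin t * cos t - r * cos t * sin t = 0) by ring.
    split.
    + apply (is_derive_ext_loc (fun x => U (sqrt (n2 x (r * sin t))) (angle t x (r * sin t)))).
      { exists (mkposreal d Hd). intros z Hz. symmetry. apply HD; [exact Hz|].
        rewrite Rminus_diag, Rabs_R0; auto. }
      apply is_derive_Reals.
      (* Chain rule: in [x] the radius has derivative [cos t] and the angle [- sin t / r]. *)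
      replace (pol A2 r t) with (g r t * cos t + h r t * (- sin t / r)).
      * apply (derivable_pt_lim_comp_2d U (fun x => sqrt (n2 x (r * sin t)))
          (fun x => angle t x (r * sin t))); [exact D| |].
        -- apply is_derive_Reals. unfold n2 in *. auto_derive.
           ++ apply Rlt_le_trans with (r ^ 2); [nra|right; rewrite <- Hn; ring].
           ++ simpl.
              replace (r * cos t * (r * cos t * 1) + r * sin t * (r * sin t * 1))
                with (r ^ 2) by (rewrite <- Hn; ring).
              rewrite sqrt_pow2 by lra. field. lra.
        -- apply is_derive_Reals. unfold angle. auto_derive.
           ++ rewrite HP. lra.
           ++ unfold Rminus in Z. rewrite HP, Z. unfold Rdiv. field. lra.
      * unfold g, h. transitivity (pol A2 r t * (sin t * sin t + cos t * cos t));
          [field; lra|rewrite Hs; ring].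
    + apply (is_derive_ext_loc (fun y => U (sqrt (n2 (r * cos t) y)) (angle t (r * cos t) y))).
      { exists (mkposreal d Hd). intros z Hz. symmetry. apply HD; [|exact Hz].
        rewrite Rminus_diag, Rabs_R0; auto. }
      apply is_derive_Reals.
      replace (- pol A1 r t) with (g r t * sin t + h r t * (cos t / r)).
      * apply (derivable_pt_lim_comp_2d U (fun y => sqrt (n2 (r * cos t) y))
          (fun y => angle t (r * cos t) y)); [exact D| |].
        -- apply is_derive_Reals. unfold n2 in *. auto_derive.
           ++ apply Rlt_le_trans with (r ^ 2); [nra|right; rewrite <- Hn; ring].
           ++ simpl.
              replace (r * cos t * (r * cos t * 1) + r * sin t * (r * sin t * 1))
                with (r ^ 2) by (rewrite <- Hn; ring).
              rewrite sqrt_pow2 by lra. field. lra.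
        -- apply is_derive_Reals. unfold angle. auto_derive.
           ++ rewrite HP. lra.
           ++ unfold Rminus in Z. rewrite HP, Z. unfold Rdiv. field. lra.
      * unfold g, h. transitivity (- pol A1 r t * (sin t * sin t + cos t * cos t));
          [field; lra|rewrite Hs; ring].
  - intros x y Hn. destruct (polar_exists x y) as [t [E1 E2]].
    rewrite Hn, sqrt_pow2 in E1, E2 by lra. rewrite E1, E2. fold (pol u a t).
    rewrite u_pol by lra. unfold U. rewrite RInt_point. reflexivity.
  - intros x y Hn. destruct (polar_exists x y) as [t [E1 E2]].
    rewrite Hn, sqrt_pow2 in E1, E2 by lra. rewrite E1, E2. fold (pol u b t).
    rewrite u_pol by lra. apply U_wall_const.
  - intros r t Hr. apply (is_derive_ext_loc (fun r => U r t)).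
    + apply (filter_imp (fun z => a < z < b)); [|apply locally_open_interval; auto].
      intros z Hz. symmetry. apply u_pol. lra.
    + replace (g r t) with (g (clamp a b r) t) by (rewrite clamp_id; lra). apply U_derive_r.
  - intros r t Hr. apply (is_derive_ext (fun t => U r t)).
    + intros z. symmetry. apply u_pol. lra.
    + apply U_derive_t. lra.
Qed.

End Stream_function.

(** The equation expresses the gradient of the pressure by the flow and its first derivatives, so
    this gradient is of class C^1. Equality of the mixed derivatives of the pressure is the curl of
    the equation; its quadratic terms add up to the divergence times the vorticity and vanish. *)
Lemma vorticity_transport (a b : R) (A1 A2 a1 a2 b1 b2 a11 a12 a21 a22 b11 b12 b21 b22 P : R -> R -> R) :
  C1_ann a b A1 a1 a2 -> C1_ann a b A2 b1 b2 ->
  C1_ann a b a1 a11 a12 -> C1_ann a b a2 a21 a22 ->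
  C1_ann a b b1 b11 b12 -> C1_ann a b b2 b21 b22 ->
  (forall x y, ann a b x y -> a1 x y + b2 x y = 0) ->
  (forall x y, ann a b x y ->
     is_derive (fun t => P t y) x (- (A1 x y * a1 x y + A2 x y * a2 x y)) /\
     is_derive (fun t => P x t) y (- (A1 x y * b1 x y + A2 x y * b2 x y))) ->
  forall x y, ann a b x y ->
    A1 x y * (b11 x y - a21 x y) + A2 x y * (b12 x y - a22 x y) = 0.
Proof.
  intros hA1 hA2 ha1 ha2 hb1 hb2 hdiv hP x y HA.
  destruct (ann_open a b x y HA) as [d [Hd HD]].
  assert (C : forall f f1 f2, C1_ann a b f f1 f2 ->
    continuity_2d_pt f x y /\ continuity_2d_pt f1 x y /\ continuity_2d_pt f2 x y).
  { intros f f1 f2 [Hc _]. destruct (Hc x y (ann_cann _ _ _ _ HA)) as [K1 [K2 K3]].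
    split; [|split]; apply (cont_ann_interior a b); auto. }
  destruct (C _ _ _ hA1) as [CA1 [Ca1 Ca2]]. destruct (C _ _ _ hA2) as [CA2 [Cb1 Cb2]].
  destruct (C _ _ _ ha1) as [_ [Ca11 Ca12]]. destruct (C _ _ _ ha2) as [_ [Ca21 Ca22]].
  destruct (C _ _ _ hb1) as [_ [Cb11 Cb12]]. destruct (C _ _ _ hb2) as [_ [Cb21 Cb22]].
  assert (S1 : a12 x y = a21 x y).
  { apply (schwarz_partials A1 a1 a2); auto. exists d; split; auto. intros x' y' Hx Hy.
    assert (H := HD x' y' Hx Hy). destruct (proj2 hA1 x' y' H).
    split; [auto|split; [auto|split; [apply ha1|apply ha2]; auto]]. }
  assert (S2 : b12 x y = b21 x y).
  { apply (schwarz_partials A2 b1 b2); auto. exists d; split; auto. intros x' y' Hx Hy.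
    assert (H := HD x' y' Hx Hy). destruct (proj2 hA2 x' y' H).
    split; [auto|split; [auto|split; [apply hb1|apply hb2]; auto]]. }
  assert (prod : forall (f g : R -> R) z f' g', is_derive f z f' -> is_derive g z g' ->
    is_derive (fun t => f t * g t) z (f' * g z + f z * g')).
  { intros. apply (is_derive_mult f g); auto. intros; apply Rmult_comm. }
  assert (SP := schwarz_partials P
    (fun x y => - (A1 x y * a1 x y + A2 x y * a2 x y))
    (fun x y => - (A1 x y * b1 x y + A2 x y * b2 x y))
    (fun x y => - ((a2 x y * a1 x y + A1 x y * a12 x y) + (b2 x y * a2 x y + A2 x y * a22 x y)))
    (fun x y => - ((a1 x y * b1 x y + A1 x y * b11 x y) + (b1 x y * b2 x y + A2 x y * b21 x y))) x y).
  simpl in SP.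
  assert (SP' : - ((a2 x y * a1 x y + A1 x y * a12 x y) + (b2 x y * a2 x y + A2 x y * a22 x y)) =
    - ((a1 x y * b1 x y + A1 x y * b11 x y) + (b1 x y * b2 x y + A2 x y * b21 x y))).
  { apply SP.
    - exists d; split; auto. intros x' y' Hx Hy. assert (H := HD x' y' Hx Hy).
      destruct (hP x' y' H) as [P1 P2]. destruct (proj2 hA1 x' y' H). destruct (proj2 hA2 x' y' H).
      destruct (proj2 ha1 x' y' H). destruct (proj2 ha2 x' y' H).
      destruct (proj2 hb1 x' y' H). destruct (proj2 hb2 x' y' H).
      split; [auto|split; [auto|split]]; apply (is_derive_opp (V := R_NormedModule));
      apply (is_derive_plus (V := R_NormedModule)).
      + apply (prod (fun t => A1 x' t) (fun t => a1 x' t)); auto.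
      + apply (prod (fun t => A2 x' t) (fun t => a2 x' t)); auto.
      + apply (prod (fun t => A1 t y') (fun t => b1 t y')); auto.
      + apply (prod (fun t => A2 t y') (fun t => b2 t y')); auto.
    - apply continuity_2d_pt_opp.
      repeat first [assumption|apply continuity_2d_pt_plus|apply continuity_2d_pt_mult].
    - apply continuity_2d_pt_opp.
      repeat first [assumption|apply continuity_2d_pt_plus|apply continuity_2d_pt_mult]. }
  specialize (hdiv x y HA). rewrite S1 in SP'. rewrite S2.
  assert (E : b2 x y = - a1 x y) by lra. rewrite E in SP'. lra.
Qed.

(** * The steady flow *)

Lemma enorm_ge0 x : 0 <= enorm x.
Proof. apply sqrt_pos. Qed.

Lemma enorm_sq x y : enorm (x, y) ^ 2 = n2 x y.
Proof.
  unfold enorm; simpl fst; simpl snd. change (x ^ 2 + y ^ 2) with (n2 x y).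
  rewrite pow2_sqrt; auto. unfold n2; nra.
Qed.

Lemma annulus_iff a b x y : 0 < a < b -> annulus a b (x, y) <-> ann a b x y.
Proof.
  intros Hab. unfold annulus, ann. rewrite <- enorm_sq. assert (H := enorm_ge0 (x, y)).
  split; intros [H1 H2]; split; nra.
Qed.

Lemma closed_annulus_iff a b x y : 0 < a < b -> closed_annulus a b (x, y) <-> cann a b x y.
Proof.
  intros Hab. unfold closed_annulus, cann. rewrite <- enorm_sq. assert (H := enorm_ge0 (x, y)).
  split; intros [H1 H2]; split; nra.
Qed.

Lemma circle_iff r x y : 0 < r -> circle r (x, y) <-> n2 x y = r ^ 2.
Proof.
  intros Hr. unfold circle. rewrite <- enorm_sq. assert (H := enorm_ge0 (x, y)).
  split; intros E; [rewrite E; auto|]. nra.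
Qed.

Lemma enorm_pol r t : 0 <= r -> enorm (r * cos t, r * sin t) = r.
Proof.
  intros Hr. unfold enorm; simpl fst; simpl snd.
  change (sqrt (n2 (r * cos t) (r * sin t)) = r). rewrite n2_pol. apply sqrt_pow2; auto.
Qed.

Lemma continuous_on_cont_in (K : R * R -> Prop) (f : R * R -> R) x y :
  continuous_on K f -> K (x, y) ->
  cont_in (fun x y => K (x, y)) (fun x y => f (x, y)) x y.
Proof.
  intros Hf HK eps He.
  destruct (Hf (x, y) HK (fun z => Rabs (z - f (x, y)) < eps)) as [d Hd].
  - exists (mkposreal eps He). intros z Hz. exact Hz.
  - exists d. split; [apply cond_pos|]. intros x' y' HK' Hx Hy.
    apply (Hd (x', y')); auto. split; [exact Hx|exact Hy].
Qed.

Lemma Cn_on_continuous n U K f : Cn_on n U K f -> continuous_on K f.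
Proof. destruct n; simpl; tauto. Qed.

Lemma Cn_on_C1_ann n a b f : 0 < a < b ->
  Cn_on (S n) (annulus a b) (closed_annulus a b) f ->
  exists f1 f2, Cn_on n (annulus a b) (closed_annulus a b) f1 /\
    Cn_on n (annulus a b) (closed_annulus a b) f2 /\
    C1_ann a b (fun x y => f (x, y)) (fun x y => f1 (x, y)) (fun x y => f2 (x, y)).
Proof.
  intros Hab [Hc [f1 [f2 [Hd [H1 H2]]]]]. exists f1, f2. split; [auto|split; [auto|split]].
  - assert (C : forall g, continuous_on (closed_annulus a b) g ->
      forall x y, cann a b x y -> cont_in (cann a b) (fun x y => g (x, y)) x y).
    { intros g Hg x y HK.
      apply (cont_in_subset (fun x y => closed_annulus a b (x, y))).
      - intros x' y'; apply closed_annulus_iff; auto.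
      - apply continuous_on_cont_in; auto. apply closed_annulus_iff; auto. }
    intros x y HK. apply Cn_on_continuous in H1, H2. auto.
  - intros x y HA. apply annulus_iff in HA; auto. exact (Hd (x, y) HA).
Qed.

Lemma Cn_on_ray n a b f : 0 < a < b ->
  Cn_on n (annulus a b) (closed_annulus a b) f -> Cn_segment n a b (fun r => f (r, 0)).
Proof.
  intros Hab.
  assert (En : forall r, 0 <= r -> enorm (r, 0) = r).
  { intros r Hr. rewrite <- (enorm_pol r 0 Hr) at 2. rewrite cos_0, sin_0. f_equal.
    f_equal; ring. }
  assert (C : forall g : R * R -> R, continuous_on (closed_annulus a b) g ->
    continuous_on (fun r : R => a <= r <= b) (fun r : R => g (r, 0))).
  { intros g Hg r Hr P HP.
    assert (Hr' : closed_annulus a b (r, 0)) by (unfold closed_annulus; rewrite En; lra).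
    destruct (Hg (r, 0) Hr' P HP) as [d Hd]. exists d. intros z Hz Hzr.
    apply (Hd (z, 0)).
    - split; [exact Hz|apply ball_center].
    - unfold closed_annulus; rewrite En; lra. }
  revert f. induction n; intros f; simpl.
  - apply C.
  - intros [Hc [f1 [f2 [Hd [H1 H2]]]]]. split; [apply C; auto|].
    exists (fun r => f1 (r, 0)). split; [|apply IHn; auto].
    intros r Hr. apply (Hd (r, 0)). unfold annulus; rewrite En; lra.
Qed.

Lemma strip_zero a b F r t : a < b -> (forall r t, a <= r <= b -> cont_in (strip a b) F r t) ->
  (forall r t, a < r < b -> F r t = 0) -> a <= r <= b -> F r t = 0.
Proof.
  intros Hab HF H0 Hr. destruct (Req_dec (F r t) 0) as [|Hne]; auto. exfalso.
  destruct (HF r t Hr (Rabs (F r t)) (Rabs_pos_lt _ Hne)) as [d [Hd HD]].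
  destruct (interior_near a b r d Hab Hr Hd) as [r' [Hr' Hrr]].
  specialize (HD r' t ltac:(unfold strip; lra) Hrr ltac:(rewrite Rminus_diag, Rabs_R0; auto)).
  rewrite H0 in HD by auto. rewrite Rminus_0_l, Rabs_Ropp in HD. lra.
Qed.

Theorem theorem1p2 (a b : R) (hab : 0 < a < b) (v : R * R -> R * R)
    (hv1 : Cn_on 2 (annulus a b) (closed_annulus a b) (v1 v))
    (hv2 : Cn_on 2 (annulus a b) (closed_annulus a b) (v2 v))
    (hEuler : exists p : R * R -> R, steady_Euler (annulus a b) v p)
    (hCa : forall x : R * R, circle a x -> dot (v x) (e_r x) = 0)
    (hCb : forall x : R * R, circle b x -> dot (v x) (e_r x) = 0)
    (hstag :
       Strict_Included (R * R) (stagnation_set (closed_annulus a b) v) (circle a) \/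
       Strict_Included (R * R) (stagnation_set (closed_annulus a b) v) (circle b)) :
  (forall x : R * R, closed_annulus a b x -> 0 < enorm (v x)) /\
  circular (annulus a b) v /\
  exists V : R -> R,
    Cn_segment 2 a b V /\
    ((forall r : R, a <= r <= b -> 0 < V r) \/
     (forall r : R, a <= r <= b -> V r < 0)) /\
    (forall x : R * R, closed_annulus a b x ->
       v x = scal (V (enorm x)) (e_theta x)).
Proof.
  assert (hV2 := Cn_on_ray 2 a b _ hab hv2).
  destruct (Cn_on_C1_ann 1 a b _ hab hv1) as [a1 [a2 [Ha1 [Ha2 CA1]]]].
  destruct (Cn_on_C1_ann 1 a b _ hab hv2) as [b1 [b2 [Hb1 [Hb2 CA2]]]].
  destruct (Cn_on_C1_ann 0 a b _ hab Ha1) as [a11 [a12 [_ [_ Ca1]]]].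
  destruct (Cn_on_C1_ann 0 a b _ hab Ha2) as [a21 [a22 [_ [_ Ca2]]]].
  destruct (Cn_on_C1_ann 0 a b _ hab Hb1) as [b11 [b12 [_ [_ Cb1]]]].
  destruct (Cn_on_C1_ann 0 a b _ hab Hb2) as [b21 [b22 [_ [_ Cb2]]]].
  clear Ha1 Ha2 Hb1 Hb2.
  set (A1 := fun x y => v1 v (x, y)) in *. set (A2 := fun x y => v2 v (x, y)) in *.
  destruct hEuler as [P [_ [_ [[_ [g1 [g2 [HP _]]]] HE]]]].
  assert (Euler : forall x y, ann a b x y ->
    A1 x y * a1 (x, y) + A2 x y * a2 (x, y) + g1 (x, y) = 0 /\
    A1 x y * b1 (x, y) + A2 x y * b2 (x, y) + g2 (x, y) = 0 /\
    a1 (x, y) + b2 (x, y) = 0).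
  { intros x y HA.
    assert (HA' : annulus a b (x, y)) by (apply annulus_iff; auto).
    destruct (HE (x, y) HA') as [E1 [E2 E3]]. destruct (HP (x, y) HA') as [P1 P2].
    destruct (proj2 CA1 x y HA) as [D1 D2]. destruct (proj2 CA2 x y HA) as [D3 D4].
    apply is_derive_unique in P1, P2, D1, D2, D3, D4.
    rewrite <- P1, <- P2, <- D1, <- D2, <- D3, <- D4.
    split; [exact E1|split; [exact E2|exact E3]]. }
  assert (hdiv : forall x y, ann a b x y -> a1 (x, y) + b2 (x, y) = 0) by apply Euler.
  assert (htrans := vorticity_transport a b A1 A2 _ _ _ _ _ _ _ _ _ _ _ _ (fun x y => P (x, y))
    CA1 CA2 Ca1 Ca2 Cb1 Cb2 hdiv).
  assert (hwall : forall x y, n2 x y = a ^ 2 \/ n2 x y = b ^ 2 -> x * A1 x y + y * A2 x y = 0).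
  { assert (W : forall r x y, 0 < r -> circle r (x, y) -> dot (v (x, y)) (e_r (x, y)) = 0 ->
      x * A1 x y + y * A2 x y = 0).
    { intros r x y Hr Hc Hd. unfold circle in Hc.
      unfold dot, e_r in Hd; simpl in Hd. rewrite Hc in Hd.
      change (A1 x y * (x / r) + A2 x y * (y / r) = 0) in Hd.
      apply Rmult_eq_reg_r with (/ r); [|apply Rinv_neq_0_compat; lra].
      rewrite Rmult_0_l, <- Hd. unfold Rdiv; ring. }
    intros x y [H|H]; apply circle_iff in H; try lra; eapply W; eauto; lra. }
  destruct (stream_function_exists a b A1 A2 _ _ _ _ hab CA1 CA2 hdiv hwall)
    as [u [ca [cb [Cu [uca [ucb [Dr Dt]]]]]]].
  assert (hnz : forall x y, enorm (v (x, y)) <> 0 -> A2 x y <> 0 \/ - A1 x y <> 0).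
  { intros x y H. destruct (Req_dec (A2 x y) 0) as [E2|]; auto.
    destruct (Req_dec (A1 x y) 0) as [E1|]; [|right; lra]. exfalso; apply H.
    unfold A1, A2, v1, v2 in E1, E2. unfold enorm. rewrite E1, E2.
    replace (0 ^ 2 + 0 ^ 2) with 0 by ring. apply sqrt_0. }
  (* Strict inclusion is split into its two consequences: no zero of the flow off the circle, and
     some point of the circle where the flow does not vanish. *)
  assert (hstag0 : forall r, a <= r <= b ->
    Strict_Included (R * R) (stagnation_set (closed_annulus a b) v) (circle r) ->
    (forall x y, cann a b x y -> n2 x y <> r ^ 2 -> A2 x y <> 0 \/ - A1 x y <> 0) /\
    exists x y, n2 x y = r ^ 2 /\ (A2 x y <> 0 \/ - A1 x y <> 0)).
  { intros r Hr [HS HSne]. assert (Hr0 : 0 < r) by lra. split.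
    - intros x y HK Hn. apply hnz. intros E. apply Hn. apply circle_iff; auto.
      apply HS. split; auto. apply closed_annulus_iff; auto.
    - apply NNPP; intros Hno. apply HSne. apply Extensionality_Ensembles. split; auto.
      intros [x y] Hc. unfold In in *. apply NNPP; intros Hns.
      assert (Hn : n2 x y = r ^ 2) by (apply circle_iff; auto).
      apply Hno. exists x, y. split; auto. apply hnz. intros E. apply Hns.
      split; auto. apply closed_annulus_iff; auto. unfold cann. nra. }
  assert (Hab2 : a ^ 2 < b ^ 2) by nra.
  assert (hcrit : forall x y, ann a b x y -> A2 x y <> 0 \/ - A1 x y <> 0).
  { intros x y HA.
    destruct hstag as [HS|HS]; apply hstag0 in HS; try lra; destruct HS as [HS _];
    apply HS; try (apply ann_cann; auto); unfold ann in HA; lra. }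
  assert (hstag1 :
    ((forall x y, n2 x y = b ^ 2 -> A2 x y <> 0 \/ - A1 x y <> 0) /\
     (exists x y, n2 x y = a ^ 2 /\ (A2 x y <> 0 \/ - A1 x y <> 0))) \/
    ((forall x y, n2 x y = a ^ 2 -> A2 x y <> 0 \/ - A1 x y <> 0) /\
     (exists x y, n2 x y = b ^ 2 /\ (A2 x y <> 0 \/ - A1 x y <> 0)))).
  { destruct hstag as [HS|HS]; apply hstag0 in HS; try lra; destruct HS as [HS HS'];
      [left|right]; (split; [intros x y Hn; apply HS; unfold cann; lra|auto]). }
  clear hstag hstag0 hnz.
  assert (Cneg := C1_ann_opp _ _ _ _ _ CA1).
  (* As the gradient of [u] is [(v2, - v1)], this function is the Laplacian of [u] and also the
     vorticity. *)
  assert (Cw : C1_ann a b (fun x y => b1 (x, y) + - a2 (x, y))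
    (fun x y => b11 (x, y) - a21 (x, y)) (fun x y => b12 (x, y) - a22 (x, y))).
  { destruct Cb1 as [C D]. destruct Ca2 as [C' D']. split.
    - intros x y HK. destruct (C x y HK) as [C1 [C2 C3]]. destruct (C' x y HK) as [C4 [C5 C6]].
      split; [|split]; contin.
    - intros x y HA. destruct (D x y HA) as [D1 D2]. destruct (D' x y HA) as [D3 D4].
      split; apply (is_derive_minus (V := R_NormedModule)); auto. }
  (* Symmetry of the Hessian of [u] is incompressibility, extended to the walls by continuity. *)
  assert (hsym : forall x y, cann a b x y -> b2 (x, y) = - a1 (x, y)).
  { intros x y HK. destruct (cann_polar a b x y hab HK) as [r [t [Hr [-> ->]]]].
    enough (a1 (r * cos t, r * sin t) + b2 (r * cos t, r * sin t) = 0) by lra.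
    apply (strip_zero a b (pol (fun x y => a1 (x, y) + b2 (x, y))) r t); auto; [lra| |].
    - apply pol_cont_in; auto. intros x y HK'.
      destruct (proj1 CA1 x y HK') as [_ [C1 _]]. destruct (proj1 CA2 x y HK') as [_ [_ C2]]. contin.
    - intros r' t' Hr'. apply hdiv, pol_ann; lra. }
  assert (htr : forall x y, ann a b x y ->
    A1 x y * (b11 (x, y) - a21 (x, y)) + A2 x y * (b12 (x, y) - a22 (x, y)) = 0).
  { apply htrans. intros x y HA. destruct (Euler x y HA) as [E1 [E2 _]].
    apply annulus_iff in HA; auto. destruct (HP (x, y) HA) as [P1 P2].
    replace (- (A1 x y * a1 (x, y) + A2 x y * a2 (x, y))) with (g1 (x, y)) by lra.
    replace (- (A1 x y * b1 (x, y) + A2 x y * b2 (x, y))) with (g2 (x, y)) by lra.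
    auto. }
  assert (hrad : forall r s t, a < r < b -> pol u r s = pol u r t).
  { apply (radial_symmetry a b ca cb u A2 (fun x y => - A1 x y) _ _ _ _ _ _
      hab Cu CA2 Cneg Cw hsym); auto.
    - intros x y HA. specialize (htr x y HA). lra.
    - intros x y Hn. specialize (hwall x y Hn). lra. }
  (* The angular component on the positive first axis, so that its regularity up to both ends is
     that of [v2 v] restricted to a ray. *)
  set (V := fun r => A2 r 0).
  assert (EV : forall r, V r = pol A2 r 0).
  { intros r. unfold V, pol. rewrite cos_0, sin_0. f_equal; ring. }
  assert (cV : forall r t, a <= r <= b -> cont_in (strip a b) (fun r _ => V r) r t).
  { intros r t Hr eps He.
    destruct (pol_cont_in a b A2 hab (fun x y K => proj1 (proj1 CA2 x y K)) r 0 Hr eps He)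
      as [d [Hd HD]]. exists d; split; auto. intros r' t' Hr' H1 _.
    rewrite !EV. apply HD; auto. rewrite Rminus_diag, Rabs_R0; auto. }
  (* Independence of the angle passes from the stream function to its polar derivatives: the radial
     component of the flow vanishes and the angular one is that of the first axis. *)
  assert (hint : forall r t, a < r < b ->
    pol A1 r t + V r * sin t = 0 /\ pol A2 r t + - (V r * cos t) = 0).
  { intros r t Hr.
    assert (G : - pol A1 r t * sin t + pol A2 r t * cos t = V r).
    { assert (D0 := Dr r 0 Hr). rewrite cos_0, sin_0 in D0.
      replace (V r) with (- pol A1 r 0 * 0 + pol A2 r 0 * 1) by (rewrite EV; ring).
      rewrite <- (is_derive_unique _ _ _ (Dr r t Hr)). apply is_derive_unique.
      apply (is_derive_ext_loc (fun r => pol u r 0)); [|exact D0].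
      apply (filter_imp (fun z => a < z < b)); [|apply locally_open_interval; auto].
      intros z Hz. apply hrad; auto. }
    assert (H0 : r * (- sin t * pol A2 r t - cos t * pol A1 r t) = 0).
    { rewrite <- (is_derive_unique _ _ _ (Dt r t Hr)). apply is_derive_unique.
      apply (is_derive_ext (fun _ => pol u r 0)); [intros; apply hrad; auto|].
      exact (is_derive_const (V := R_NormedModule) (pol u r 0) t). }
    apply Rmult_integral in H0. destruct H0 as [|H0]; [lra|].
    pose proof (sin2_cos2 t) as Hs. unfold Rsqr in Hs. rewrite <- G.
    split.
    - transitivity (- cos t * (- sin t * pol A2 r t - cos t * pol A1 r t) +
        pol A1 r t * (1 - (sin t * sin t + cos t * cos t))); [ring|rewrite H0, Hs; ring].
    - transitivity (- sin t * (- sin t * pol A2 r t - cos t * pol A1 r t) +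
        pol A2 r t * (1 - (sin t * sin t + cos t * cos t))); [ring|rewrite H0, Hs; ring]. }
  assert (hA : forall r t, a <= r <= b -> pol A1 r t = - (V r * sin t) /\ pol A2 r t = V r * cos t).
  { intros r t Hr.
    assert (CP1 : forall r t, a <= r <= b -> cont_in (strip a b) (pol A1) r t)
      by (apply pol_cont_in; auto; apply CA1).
    assert (CP2 : forall r t, a <= r <= b -> cont_in (strip a b) (pol A2) r t)
      by (apply pol_cont_in; auto; apply CA2).
    assert (Z1 : pol A1 r t + V r * sin t = 0).
    { apply (strip_zero a b (fun r t => pol A1 r t + V r * sin t) r t); auto; [lra| |].
      - intros r' t' Hr'. specialize (cV r' t' Hr'). specialize (CP1 r' t' Hr'). contin.
      - intros r' t' Hr'. apply hint; auto. }
    assert (Z2 : pol A2 r t + - (V r * cos t) = 0).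
    { apply (strip_zero a b (fun r t => pol A2 r t + - (V r * cos t)) r t); auto; [lra| |].
      - intros r' t' Hr'. specialize (cV r' t' Hr'). specialize (CP2 r' t' Hr'). contin.
      - intros r' t' Hr'. apply hint; auto. }
    lra. }
  (* A zero of [V] would be a whole circle of zeros of the flow, against the nonvanishing point on
     each wall and the absence of critical points inside. *)
  assert (Vnz : forall r, a <= r <= b -> V r <> 0).
  { intros r Hr E0.
    assert (Z : forall x y, n2 x y = r ^ 2 -> ~ (A2 x y <> 0 \/ - A1 x y <> 0)).
    { intros x y Hn Hor. destruct (polar_exists x y) as [t [Ex Ey]].
      rewrite Hn, sqrt_pow2 in Ex, Ey by lra.
      destruct (hA r t Hr) as [Z1 Z2]. rewrite E0 in Z1, Z2.
      unfold pol in Z1, Z2. rewrite <- Ex, <- Ey in Z1, Z2. lra. }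
    assert (Hn0 : n2 (r * cos 0) (r * sin 0) = r ^ 2) by apply n2_pol.
    destruct (Req_dec r a) as [->|Hra];
    [|destruct (Req_dec r b) as [->|Hrb]].
    - destruct hstag1 as [[_ [x [y [Hn Hor]]]]|[HS _]]; [exact (Z x y Hn Hor)|].
      exact (Z _ _ Hn0 (HS _ _ Hn0)).
    - destruct hstag1 as [[HS _]|[_ [x [y [Hn Hor]]]]]; [|exact (Z x y Hn Hor)].
      exact (Z _ _ Hn0 (HS _ _ Hn0)).
    - apply (Z _ _ Hn0), hcrit, pol_ann; lra. }
  assert (hV : forall x, closed_annulus a b x -> v x = scal (V (enorm x)) (e_theta x)).
  { intros [x y] HK. apply closed_annulus_iff in HK; auto.
    destruct (cann_polar a b x y hab HK) as [r [t [Hr [-> ->]]]].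
    unfold e_theta. rewrite enorm_pol by lra. destruct (hA r t Hr) as [E1 E2].
    unfold pol, A1, A2, v1, v2 in E1, E2.
    rewrite (surjective_pairing (v (r * cos t, r * sin t))), E1, E2.
    unfold scal; simpl; unfold prod_scal, scal; simpl; unfold mult; simpl.
    f_equal; field; lra. }
  split; [|split].
  - intros x HK. rewrite hV by auto. destruct x as [x y].
    apply closed_annulus_iff in HK; auto.
    destruct (cann_polar a b x y hab HK) as [r [t [Hr [-> ->]]]].
    unfold e_theta. rewrite enorm_pol by lra.
    unfold scal; simpl; unfold prod_scal, scal; simpl; unfold mult; simpl.
    assert (HVr := Vnz r Hr). pose proof (sin2_cos2 t) as Hs. unfold Rsqr in Hs.
    unfold enorm; simpl fst; simpl snd. apply sqrt_lt_R0.
    replace ((V r * (- (r * sin t) / r)) ^ 2 + (V r * (r * cos t / r)) ^ 2)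
      with (V r ^ 2 * (sin t * sin t + cos t * cos t)) by (field; lra).
    rewrite Hs, Rmult_1_r. apply pow2_gt_0; auto.
  - intros x HA. exists (V (enorm x)). apply hV. unfold closed_annulus, annulus in *; lra.
  - exists V. split; [exact hV2|split; [|exact hV]].
    assert (CV : forall r1 r2, a <= r1 -> r2 <= b -> cont_seg r1 r2 V)
      by (intros; apply (strip_cont_seg a b (fun r _ => V r) 0); auto).
    assert (nochange : forall r s, a <= r <= b -> a <= s <= b -> 0 < V r -> V s < 0 -> False).
    { intros r s Hr Hs Pr Ns. destruct (Rle_lt_dec r s) as [H|H].
      - destruct (IVT_seg V r s 0 H (CV r s ltac:(lra) ltac:(lra))) as [z [Hz Ez]]; [lra|].
        apply (Vnz z); auto. lra.
      - destruct (IVT_seg V s r 0 ltac:(lra) (CV s r ltac:(lra) ltac:(lra))) as [z [Hz Ez]]; [lra|].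
        apply (Vnz z); auto. lra. }
    destruct (Rtotal_order (V a) 0) as [H|[H|H]].
    + right. intros r Hr. destruct (Rtotal_order (V r) 0) as [H'|[H'|H']]; auto.
      * exfalso; apply (Vnz r); auto.
      * exfalso; apply (nochange r a); auto; lra.
    + exfalso; apply (Vnz a); auto; lra.
    + left. intros r Hr. destruct (Rtotal_order (V r) 0) as [H'|[H'|H']]; auto.
      * exfalso; apply (nochange a r); auto; lra.
      * exfalso; apply (Vnz r); auto.
Qed.
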